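(* Let $\Sigma_h^\alpha$ (not necessarily contained in $\Sigma^\alpha$), $V_h^\alpha\subset V^\alpha$, $W_h^\beta=W_{1h}^\beta\times W_{2h}^\beta$ with $W_{1h}^\beta\subset H_0^1(\beta;\mathbb R^2)$ and $W_{2h}^\beta$ (not necessarily contained in $H^2_0(\beta)$) be finite element spaces, and let $f^\alpha\in L^2(\alpha;\mathbb R^3)$, $f^\beta\in L^2(\beta;\mathbb R^3)$. Consider the nonconforming method: find $(\sigma_h^\alpha,u_h^\alpha,u_h^\beta)\in\Sigma_h^\alpha\times V_h^\alpha\times W_h^\beta$ such that $$a_h(\sigma_h^\alpha,u_h^\beta;\tau_h^\alpha,v_h^\beta)+b_h(u_h^\alpha;\tau_h^\alpha,v_h^\beta)=(f^\beta,v_h^\beta)_\beta,\qquad b_h(v_h^\alpha;\sigma_h^\alpha,u_h^\beta)=-(f^\alpha,v_h^\alpha)_\alpha\qquad(\ast)$$ for all $(\tau_h^\alpha,v_h^\alpha,v_h^\beta)\in\Sigma_h^\alpha\times V_h^\alpha\times W_h^\beta$. Consider the assumptions (constants $C>0$ independent of the mesh sizes): (A1) $|||\cdot|||_h$ is a norm on $(\tilde\Sigma^\alpha+\Sigma_h^\alpha)\times(W^\beta+W_h^\beta)$. (A2) $|a_h(\sigma_h,u_h;\tau_h,v_h)|\le C|||(\sigma_h,u_h)|||_h\,|||(\tau_h,v_h)|||_h$ and $|b_h(w_h;\sigma_h,u_h)|\le C|||(\sigma_h,u_h)|||_h\|w_h\|_{0,\alpha}$ for all $(\sigma_h,u_h)\in(\tilde\Sigma^\alpha+\Sigma_h^\alpha)\times(W^\beta+W_h^\beta)$,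 $(\tau_h,v_h)\in\Sigma_h^\alpha\times W_h^\beta$, $w_h\in V_h^\alpha$. (A3) $(\mathcal C_0^{-1}\tau_h,\tau_h)_\alpha\ge C\|\tau_h\|_{\operatorname{div},h}^2$ for all $\tau_h\in B_h^{nc}:=\{\tau_h\in\Sigma_h^\alpha:(\operatorname{div}_h\tau_h,v_h)_\alpha=0\ \forall v_h\in V_h^\alpha\}$, and $\displaystyle\inf_{v_h\in V_h^\alpha}\sup_{\tau_h\in\Sigma_h^\alpha}\frac{(\operatorname{div}_h\tau_h,v_h)_\alpha}{\|v_h\|_{0,\alpha}\|\tau_h\|_{\operatorname{div},h}}\ge C$. (A4) For a positive integer $k$, $\displaystyle\inf_{(\tau_h,v_h)\in\Sigma_h^\alpha\times W_h^\beta}|||(\sigma^\alpha-\tau_h,u^\beta-v_h)|||_h+\inf_{w_h\in V_h^\alpha}\|u^\alpha-w_h\|_{0,\alpha}\le C(h_\alpha^k+h_\beta^k)$. (A5) For the same $k$, $\displaystyle\sup_{(\tau_h,v_h)\in\Sigma_h^\alpha\times W_h^\beta}\frac{|a_h(\sigma^\alpha,u^\beta;\tau_h,v_h)+b_h(u^\alpha;\tau_h,v_h)-(f^\beta,v_h)_\beta|}{|||(\tau_h,v_h)|||_h}\le C(h_\alpha^k+h_\beta^k)$. Here $(\sigma^\alpha,u^\alpha,u^\beta)\in\Sigma^\alpha\times V^\alpha\times W^\beta$ is the exact solution of the continuous mixed problem, and in (A4)–(A5) $\sigma^\alpha\in\tilde\Sigma^\alpha$. Then, under (A1)–(A3), $(\ast)$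 is well-posed, i.e. there exists a unique solution $(\sigma_h^\alpha,u_h^\alpha,u_h^\beta)\in\Sigma_h^\alpha\times V_h^\alpha\times W_h^\beta$, and $$|||(\sigma_h^\alpha,u_h^\beta)|||_h+\|u_h^\alpha\|_{0,\alpha}\le C(\|f^\alpha\|_{0,\alpha}+\|f^\beta\|_{0,\beta}).$$ Moreover, if (A4)–(A5) also hold, then $$|||(\sigma^\alpha-\sigma_h^\alpha,u^\beta-u_h^\beta)|||_h+\|u^\alpha-u_h^\alpha\|_{0,\alpha}\le C(h_\alpha^k+h_\beta^k).$$
   Context: Geometry: $\alpha\subset\mathbb R^3$ is a bounded polyhedron (elastic body); $\beta$ is a bounded polygon in the $(x_1,x_2)$-plane (plate), viewed as a planar subset of $\mathbb R^3$ orthogonal to the $x_3$ direction. They are rigidly joined along the interface $\Gamma$, a planar part (face) of $\partial\alpha$ contained in $\beta$. $n^\alpha,n^\beta$ are unit outward normals (of $\partial\alpha,\partial\beta$, or of mesh elements). Indices $i,j,l\in\{1,2,3\}$, $I,J,L\in\{1,2\}$; repeated indices are summed. $\mathbb S$ is the space of symmetric $3\times3$ real matrices. $\|\cdot\|_{m,G},|\cdot|_{m,G}$ are the $H^m(G)$ norm and seminorm, $(\cdot,\cdot)_G$ the $L^2(G)$ inner product, $\langle\cdot,\cdot\rangle_{\partial\alpha}$ the duality between $H^{-1/2}(\partial\alpha;\mathbb R^3)$ and $H^{1/2}(\partial\alpha;\mathbb R^3)$. Material laws: $E_\alpha,E_\beta,t_\beta>0$ and $\nu_\alpha,\nu_\beta\in(0,1/2)$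 are constants. $\mathcal C_0:\mathbb S\to\mathbb S$ is $(\mathcal C_0\varepsilon)_{ij}=\frac{E_\alpha}{1+\nu_\alpha}\varepsilon_{ij}+\frac{E_\alpha\nu_\alpha}{(1+\nu_\alpha)(1-2\nu_\alpha)}\varepsilon_{ll}\delta_{ij}$, with inverse $\mathcal C_0^{-1}$. For the plate, with $v=(v_1,v_2,v_3)$: $\varepsilon^\beta_{IJ}(v)=\frac12(\partial_Iv_J+\partial_Jv_I)$, $\sigma^\beta_{IJ}(v)=\frac{E_\beta t_\beta}{1-\nu_\beta^2}\big((1-\nu_\beta)\varepsilon^\beta_{IJ}(v)+\nu_\beta\varepsilon^\beta_{LL}(v)\delta_{IJ}\big)$, $K^\beta_{IJ}(v)=-\partial^2v_3/\partial x_I\partial x_J$, $M^\beta_{IJ}(v)=\frac{E_\beta t_\beta^3}{12(1-\nu_\beta^2)}\big((1-\nu_\beta)K^\beta_{IJ}(v)+\nu_\beta K^\beta_{LL}(v)\delta_{IJ}\big)$. Continuous problem: $H(\operatorname{div},\alpha;\mathbb S)=\{\tau\in L^2(\alpha;\mathbb S):\operatorname{div}\tau\in L^2(\alpha;\mathbb R^3)\}$; $H^{1/2}_{00}(\partial\alpha\setminus\Gamma;\mathbb R^3)$ is the set of $v\in H^{1/2}(\partial\alpha\setminus\Gamma;\mathbb R^3)$ whose zero extension lies in $H^{1/2}(\partial\alpha;\mathbb R^3)$; $\Sigma^\alpha=\{\tau\in H(\operatorname{div},\alpha;\mathbb S):\langle\tau n^\alpha,v\rangle_{\partial\alpha}=0\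 \forall v\in H^{1/2}_{00}(\partial\alpha\setminus\Gamma;\mathbb R^3)\}$ ($v$ extended by zero); $V^\alpha=L^2(\alpha;\mathbb R^3)$; $W^\beta=H^1_0(\beta;\mathbb R^2)\times H^2_0(\beta)$, with $H^2_0(\beta)=\{v\in H^2(\beta):v=\nabla v\cdot n^\beta=0\text{ on }\partial\beta\}$. For $v\in H^1(\beta;\mathbb R^3)$, $\hat v\in H^{1/2}(\partial\alpha;\mathbb R^3)$ is a bounded extension of $v|_\Gamma$ ($\|\hat v\|_{1/2,\partial\alpha}\le C\|v\|_{1,\beta}$). The exact solution $(\sigma^\alpha,u^\alpha,u^\beta)\in\Sigma^\alpha\times V^\alpha\times W^\beta$ satisfies, for all $(\tau,w,v)\in\Sigma^\alpha\times V^\alpha\times W^\beta$: $(\mathcal C_0^{-1}\sigma^\alpha,\tau)_\alpha+(\operatorname{div}\tau,u^\alpha)_\alpha-\langle\tau n^\alpha,\hat u^\beta\rangle_{\partial\alpha}=0$; $(\operatorname{div}\sigma^\alpha,w)_\alpha=-(f^\alpha,w)_\alpha$; $\langle\sigma^\alpha n^\alpha,\hat v\rangle_{\partial\alpha}+(\sigma^\beta(u^\beta),\varepsilon^\beta(v))_\beta+(M^\beta(u^\beta),K^\beta(v))_\beta=(f^\beta,v)_\beta$. $\tilde\Sigma^\alpha=\Sigma^\alpha\cap H^s(\alpha;\mathbb S)$ with a fixed $s>1/2$. Discretization: $\mathcal T_h^\alpha$ (tetrahedra) and $\mathcal T_h^\beta$ (triangles) are shape-regular meshes of $\alpha$ and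 $\beta$ with maximal element diameters $h_\alpha,h_\beta$; they need not match on $\Gamma$. $\mathcal F_\Gamma^\alpha$ is the set of faces of elements of $\mathcal T_h^\alpha$ contained in $\Gamma$ (a triangulation of $\Gamma$); $h_F$ is the diameter of $F$. Finite element spaces are finite-dimensional spaces of piecewise polynomials: $\Sigma_h^\alpha$ of $\mathbb S$-valued ones and $V_h^\alpha$ of $\mathbb R^3$-valued ones on $\mathcal T_h^\alpha$, $W_{1h}^\beta,W_{2h}^\beta$ on $\mathcal T_h^\beta$. $\operatorname{div}_h,K_h^\beta,M_h^\beta$ are the elementwise versions of $\operatorname{div},K^\beta,M^\beta$. $\|\tau\|_{\operatorname{div},h}^2=\|\tau\|_{0,\alpha}^2+\|\operatorname{div}_h\tau\|_{0,\alpha}^2+\sum_{F\in\mathcal F_\Gamma^\alpha}h_F\|\tau n^\alpha\|_{0,F}^2$; $|v|_{2,h}^2=\sum_{K\in\mathcal T_h^\beta}|v|_{2,K}^2$; $|||(\tau,v)|||_h^2=\|\tau\|_{\operatorname{div},h}^2+\sum_{I=1}^2|v_I|_{1,\beta}^2+|v_3|_{2,h}^2$. $\Pi_3^\beta$ is an interpolation operator mapping $H^2_0(\beta)+W_{2h}^\beta$ into $H^1(\beta)$, and $\Pi^\beta v=(v_1,v_2,\Pi_3^\beta v_3)$. For $(\sigma,u),(\tau,v)\in(\tilde\Sigma^\alpha+\Sigma_h^\alpha)\times(W^\beta+W_h^\beta)$ and $w\in V^\alpha$: $a_h(\sigma,u;\tau,v)=(\mathcal C_0^{-1}\sigma,\tau)_\alpha+(\sigma^\beta(u),\varepsilon^\beta(v))_\beta+(M_h^\beta(u),K_h^\beta(v))_\beta+(\sigma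 n^\alpha,\Pi^\beta v)_\Gamma-(\tau n^\alpha,\Pi^\beta u)_\Gamma$, $b_h(w;\tau,v)=(\operatorname{div}_h\tau,w)_\alpha$. $C$ denotes generic positive constants independent of mesh sizes and of the functions involved, except that in (A4), (A5) and the final error estimate $C$ may depend on the (fixed) exact solution and data. Infima and suprema of quotients are over nonzero elements.
   Formalization: The stability bound with a mesh-independent C fails under (A1)–(A3) alone; it is proved assuming ‖z‖_{0,β} ≤ C|z|_{2,h} on W_{2h}^β uniformly in the mesh (also necessary). Without this, C may depend on the mesh. Existence, uniqueness and the error estimate are unchanged. *)

(* Defs.v *)
From HB Require Import structures.
From mathcomp Require Import all_boot all_order all_algebra.
From mathcomp Require Import all_classical all_reals all_analysis.

Set Implicit Arguments.
Unset Strict Implicit.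
Unset Printing Implicit Defensive.

Import Order.TTheory GRing.Theory Num.Theory.
Import numFieldNormedType.Exports.

Local Open Scope classical_set_scope.
Local Open Scope ring_scope.

(* The library builds Lebesgue measure on R^n only as a product measure on
   iterated pairs, whereas points are most convenient as row vectors.
   [euclid R n] carries the n-fold product Lebesgue measure together with the
   coordinate bijection onto 'rV_n. *)
Record euclid (R : realType) (n : nat) := Euclid {
  edisp : measure_display;
  esort : measurableType edisp;
  emu : {measure set esort -> \bar R};
  ept : esort -> 'rV[R]_n }.

Definition E1 (R : realType) : euclid R 1 :=
  @Euclid R 1 _ _ (@lebesgue_measure R) (fun p => \row_(_ < 1) p).

Definition E2 (R : realType) : euclid R 2 :=
  @Euclid R 2 _ _ (@lebesgue_measure R \x @lebesgue_measure R)%E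
    (fun p => \row_(i < 2) if i == 0 :> nat then p.1 else p.2).

Definition E3 (R : realType) : euclid R 3 :=
  @Euclid R 3 _ _
    ((@lebesgue_measure R \x @lebesgue_measure R) \x @lebesgue_measure R)%E
    (fun p => \row_(i < 3) if i == 0 :> nat then p.1.1
                           else if i == 1 :> nat then p.1.2 else p.2).

Section Integration.
Context {R : realType} {n : nat}.
Variable E : euclid R n.
Implicit Types (D : set 'rV[R]_n) (f g : 'rV[R]_n -> R).

Definition eint D (f : 'rV[R]_n -> \bar R) : \bar R :=
  (\int[emu E]_(p in @ept _ _ E @^-1` D) f (ept p))%E.

Definition rint D f : R :=
  \int[emu E]_(p in @ept _ _ E @^-1` D) f (ept p).

Definition ae_on D (P : 'rV[R]_n -> Prop) : Prop :=
  {ae emu E, forall p, D (ept p) -> P (ept p)}.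

Definition meas_on D f : Prop :=
  measurable_fun (@ept _ _ E @^-1` D) (fun p => f (ept p)).

Definition L2 D f : Prop :=
  meas_on D f /\ (eint D (fun x => (f x ^+ 2)%:E) < +oo)%E.

End Integration.

Section VectorValued.
Context {R : realType} {n : nat}.
Variable E : euclid R n.

Definition cmp {m} (v : 'rV[R]_n -> 'rV[R]_m) (i : 'I_m) : 'rV[R]_n -> R :=
  fun x => v x 0 i.

Definition mcmp {m} (t : 'rV[R]_n -> 'M[R]_m) (i j : 'I_m) : 'rV[R]_n -> R :=
  fun x => t x i j.

Definition L2v {m} (D : set 'rV[R]_n) (v : 'rV[R]_n -> 'rV[R]_m) : Prop :=
  forall i, L2 E D (cmp v i).

Definition dotv {m} (D : set 'rV[R]_n) (v w : 'rV[R]_n -> 'rV[R]_m) : R :=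
  rint E D (fun x => \sum_i v x 0 i * w x 0 i).

Definition norm0v {m} (D : set 'rV[R]_n) (v : 'rV[R]_n -> 'rV[R]_m) : R :=
  Num.sqrt (dotv D v v).

Definition dotm {m} (D : set 'rV[R]_n) (s t : 'rV[R]_n -> 'M[R]_m) : R :=
  rint E D (fun x => \sum_i \sum_j s x i j * t x i j).

End VectorValued.

Section Smooth.
Context {R : realType} {d : nat}.
Implicit Types (f : 'rV[R]_d.+1 -> R) (G : set 'rV[R]_d.+1).

Definition partial (i : 'I_d.+1) f : 'rV[R]_d.+1 -> R :=
  fun x => 'D_(delta_mx 0 i) (f : 'rV[R]_d.+1 -> R^o) x.

Definition pderiv (a : seq 'I_d.+1) f : 'rV[R]_d.+1 -> R := foldr partial f a.

Definition smooth f : Prop := forall a : seq 'I_d.+1,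
  continuous (pderiv a f : 'rV[R]_d.+1 -> R^o) /\
  forall i x, derivable (pderiv a f : 'rV[R]_d.+1 -> R^o) x (delta_mx 0 i).

Definition test_fun G f : Prop :=
  smooth f /\
  exists K : set 'rV[R]_d.+1,
    [/\ compact K, K `<=` G & forall x, ~ K x -> f x = 0].

End Smooth.

Section Sobolev.
Context {R : realType} {d : nat}.
Variable E : euclid R d.+1.
Implicit Types (G : set 'rV[R]_d.+1) (u g : 'rV[R]_d.+1 -> R).

Definition weak_deriv G (a : seq 'I_d.+1) u g : Prop :=
  forall phi, test_fun G phi ->
    rint E G (fun x => u x * pderiv a phi x) =
    (-1) ^+ size a * rint E G (fun x => g x * phi x).

Definition has_wderiv G a u : Prop := exists g, L2 E G g /\ weak_deriv G a u g.

(* the square-integrable weak derivative (unique a.e.), 0 if there is none *)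
Definition wderiv G a u : 'rV[R]_d.+1 -> R :=
  xget (fun=> 0) [set g | L2 E G g /\ weak_deriv G a u g].

Definition Hm G (m : nat) u : Prop :=
  L2 E G u /\ forall a, (size a <= m)%N -> has_wderiv G a u.

(* the sum runs over ordered index tuples, so that mixed derivatives are
   counted with multiplicity: |u|_2^2 = sum_IJ ||d_I d_J u||^2 *)
Definition semi2 G (k : nat) u : R :=
  \sum_(a : k.-tuple 'I_d.+1) rint E G (fun x => wderiv G a u x ^+ 2).

Definition norm2 G (m : nat) u : R := \sum_(k < m.+1) semi2 G k u.

Definition enorm {n} (x : 'rV[R]_n) : R := Num.sqrt (\sum_i x 0 i ^+ 2).

(* squared Sobolev-Slobodeckij seminorm, 0 < theta < 1 *)
Definition slobodeckij G (theta : R) u : \bar R :=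
  eint E G (fun x => eint E G (fun y =>
    ((u x - u y) ^+ 2 / (enorm (x - y) `^ (d.+1%:R + 2 * theta)))%:E)).

Definition Hs G (s : R) u : Prop :=
  let m := Num.truncn s in
  let theta := s - m%:R in
  Hm G m u /\
  (0 < theta -> forall a : m.-tuple 'I_d.+1,
     (slobodeckij G theta (wderiv G a u) < +oo)%E).

Definition Hs_norm2 G (s : R) u : R :=
  let m := Num.truncn s in
  let theta := s - m%:R in
  norm2 G m u +
  if 0 < theta
  then \sum_(a : m.-tuple 'I_d.+1) fine (slobodeckij G theta (wderiv G a u))
  else 0.

(* H^1_0: closure of the test functions in H^1 *)
Definition H10 G u : Prop :=
  Hm G 1 u /\
  exists phi : nat -> 'rV[R]_d.+1 -> R,
    (forall k, test_fun G (phi k)) /\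
    (fun k => norm2 G 1 (fun x => phi k x - u x)) @ \oo --> (0 : R).

End Sobolev.

Section Simplices.
Context {R : realType}.

(* a matrix stands for the points given by its rows *)
Definition hull {k d} (A : 'M[R]_(k, d)) : set 'rV[R]_d :=
  [set c *m A | c in
    [set c : 'rV[R]_k | (forall i, 0 <= c 0 i) /\ \sum_i c 0 i = 1]].

Definition verts {k d} (A : 'M[R]_(k, d)) : set 'rV[R]_d :=
  [set x | exists i, x = row i A].

Definition conv_hull {d} (P : set 'rV[R]_d) : set 'rV[R]_d :=
  [set x | exists k (A : 'M[R]_(k, d)), verts A `<=` P /\ hull A x].

Definition aff_indep {k d} (A : 'M[R]_(k, d)) : Prop :=
  forall c : 'rV[R]_k, \sum_i c 0 i = 0 -> c *m A = 0 -> c = 0.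

Definition diam {d} (G : set 'rV[R]_d) : R :=
  sup [set r | exists x y, [/\ G x, G y & r = enorm (x - y)]].

(* bounded polyhedral domain: no slits, finite union of simplices *)
Definition polyhedral_domain {d} (G : set 'rV[R]_d.+1) : Prop :=
  [/\ open G, connected G, G !=set0, interior (closure G) = G &
      exists T : seq 'M[R]_(d.+2, d.+1),
        (forall A, A \in T -> aff_indep A) /\
        closure G = [set x | exists2 A, A \in T & hull A x]].

Definition triangulation {d} (G : set 'rV[R]_d.+1)
    (T : seq 'M[R]_(d.+2, d.+1)) : Prop :=
  [/\ uniq T,
      forall A, A \in T -> aff_indep A,
      closure G = [set x | exists2 A, A \in T & hull A x] &
      forall A B, A \in T -> B \in T -> A != B ->
        interior (hull A) `&` interior (hull B) = set0 /\
        hull A `&` hull B = conv_hull (verts A `&` verts B)].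

Definition elt {d} (K : 'M[R]_(d.+2, d.+1)) : set 'rV[R]_d.+1 :=
  interior (hull K).

Definition mesh_size {d} (T : seq 'M[R]_(d.+2, d.+1)) : R :=
  \big[Num.max/0]_(K <- T) diam (hull K).

Definition contains_ball {d} (K : 'M[R]_(d.+2, d.+1)) (rho : R) : Prop :=
  exists x, forall y, enorm (y - x) <= rho -> hull K y.

Definition shape_regular {d} (I : Type)
    (T : I -> seq 'M[R]_(d.+2, d.+1)) : Prop :=
  exists2 kappa : R, 0 < kappa &
    forall i K, K \in T i -> contains_ball K (kappa * diam (hull K)).

(* face opposite to vertex i *)
Definition face {d} (K : 'M[R]_(d.+2, d.+1)) (i : 'I_d.+2) :
  'M[R]_(d.+1, d.+1) := row' i K.

Definition outward_normal {d} (K : 'M[R]_(d.+2, d.+1)) (i : 'I_d.+2) :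
    'rV[R]_d.+1 :=
  xget 0 [set n | [/\ enorm n = 1,
    forall j k, j != i -> k != i -> \sum_l n 0 l * (K j l - K k l) = 0 &
    forall j, j != i -> \sum_l n 0 l * (K i l - K j l) < 0]].

(* Finite element spaces: functions are polynomial in the open elements; their
   values on the mesh skeleton are unconstrained apart from measurability. *)
Definition is_polynomial {d} (p : 'rV[R]_d -> R) : Prop :=
  exists N (c : {ffun 'I_d -> 'I_N} -> R),
    forall x, p x = \sum_a c a * \prod_(i < d) x 0 i ^+ a i.

Definition pw_poly {d} (E : euclid R d.+1) (G : set 'rV[R]_d.+1)
    (T : seq 'M[R]_(d.+2, d.+1)) (f : 'rV[R]_d.+1 -> R) : Prop :=
  meas_on E G f /\
  forall K, K \in T ->
    exists p, is_polynomial p /\ forall x, elt K x -> f x = p x.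

(* P is a span of finitely many functions satisfying Q *)
Definition fin_dim_space {X : Type} {U : lmodType R} (Q : (X -> U) -> Prop)
    (P : set (X -> U)) : Prop :=
  exists m (b : 'I_m -> X -> U), (forall i, Q (b i)) /\
    P = [set f | exists c : 'I_m -> R, f = fun x => \sum_i c i *: b i x].

End Simplices.

Section BoundaryTraces.
Context {R : realType} {d : nat}.
Variables (E : euclid R d.+2) (E' : euclid R d.+1).

Definition unit_simplex : set 'rV[R]_d.+1 :=
  [set y | (forall i, 0 <= y 0 i) /\ \sum_i y 0 i <= 1].

(* affine parametrisation of the (d+1)-simplex with vertices the rows of A *)
Definition facet_pt (A : 'M[R]_(d.+2, d.+2)) (y : 'rV[R]_d.+1) : 'rV[R]_d.+2 :=
  row ord0 A + \sum_(i < d.+1) y 0 i *: (row (lift ord0 i) A - row ord0 A).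

Definition boundary (G : set 'rV[R]_d.+2) : set 'rV[R]_d.+2 := closure G `\` G.

(* trace of u in H^1(G) on the flat boundary piece hull A: the L^2 limit of the
   restrictions of smooth functions converging to u in H^1(G) *)
Definition has_trace_on (G : set 'rV[R]_d.+2) (u : 'rV[R]_d.+2 -> R)
    (A : 'M[R]_(d.+2, d.+2)) (g : 'rV[R]_d.+2 -> R) : Prop :=
  exists phi : nat -> 'rV[R]_d.+2 -> R,
    [/\ forall k, smooth (phi k),
        (fun k => norm2 E G 1 (fun x => phi k x - u x)) @ \oo --> (0 : R),
        L2 E' unit_simplex (g \o facet_pt A) &
        (fun k => rint E' unit_simplex
           (fun y => (phi k (facet_pt A y) - g (facet_pt A y)) ^+ 2))
          @ \oo --> (0 : R)].

Definition boundary_facet (G : set 'rV[R]_d.+2) (A : 'M[R]_(d.+2, d.+2)) :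
  Prop := aff_indep A /\ hull A `<=` boundary G.

Definition has_trace (G : set 'rV[R]_d.+2) (u g : 'rV[R]_d.+2 -> R) : Prop :=
  forall A, boundary_facet G A -> has_trace_on G u A g.

(* u = 0 and (grad u) . n = 0 on the boundary; the sign of n is immaterial *)
Definition H20 (G : set 'rV[R]_d.+2) (u : 'rV[R]_d.+2 -> R) : Prop :=
  Hm E G 2 u /\
  forall A, boundary_facet G A ->
    has_trace_on G u A (fun=> 0) /\
    forall n : 'rV[R]_d.+2, enorm n = 1 ->
      (forall j k, \sum_l n 0 l * (A j l - A k l) = 0) ->
      has_trace_on G (fun x => \sum_l n 0 l * wderiv E G [:: l] u x) A
        (fun=> 0).

End BoundaryTraces.

(* alpha in R^3; beta and Gamma are given in the coordinates (x_1, x_2) *)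
Record problem (R : realType) := Problem {
  alpha : set 'rV[R]_3;
  beta : set 'rV[R]_2;
  Gam : set 'rV[R]_2;
  Ea : R; nua : R;
  Eb : R; nub : R; tb : R;
  sreg : R }.

Section Elasticity.
Context {R : realType}.
Implicit Types (sg tau : 'rV[R]_3 -> 'M[R]_3) (u v : 'rV[R]_2 -> 'rV[R]_3)
  (w : 'rV[R]_3 -> 'rV[R]_3).

Definition embed (x : 'rV[R]_2) : 'rV[R]_3 :=
  \row_(i < 3) if i == 0 :> nat then x 0 0
               else if i == 1 :> nat then x 0 1 else 0.

Definition inp (I : 'I_2) : 'I_3 := widen_ord (leqnSn 2) I.
Definition out : 'I_3 := ord_max.

Variable P : problem R.

Definition problem_ok : Prop :=
  [/\ polyhedral_domain (alpha P), polyhedral_domain (beta P) &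
      polyhedral_domain (Gam P)] /\
  (Gam P `<=` beta P /\ embed @` Gam P `<=` boundary (alpha P)) /\
  [/\ 0 < Ea P, 0 < Eb P & 0 < tb P] /\
  [/\ 0 < nua P < 2^-1, 0 < nub P < 2^-1 & 2^-1 < sreg P].

Definition symv tau : Prop := forall x, (tau x)^T = tau x.

Definition C0 (e : 'M[R]_3) : 'M[R]_3 :=
  (Ea P / (1 + nua P)) *: e +
  ((Ea P * nua P / ((1 + nua P) * (1 - 2 * nua P))) * \tr e)%:M.

(* inverse of C0 on symmetric matrices *)
Definition C0inv (t : 'M[R]_3) : 'M[R]_3 :=
  xget 0 [set e : 'M[R]_3 | e^T = e /\ C0 e = t].

Definition weak_div (G : set 'rV[R]_3) tau w : Prop :=
  forall i phi, test_fun G phi ->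
    rint (E3 R) G (fun x => \sum_j tau x i j * partial j phi x) =
    - rint (E3 R) G (fun x => w x 0 i * phi x).

Definition wdiv (G : set 'rV[R]_3) tau : 'rV[R]_3 -> 'rV[R]_3 :=
  xget (fun=> 0) [set w | L2v (E3 R) G w /\ weak_div G tau w].

Definition Hdiv tau : Prop :=
  [/\ symv tau,
      forall i j, L2 (E3 R) (alpha P) (mcmp tau i j) &
      exists w, L2v (E3 R) (alpha P) w /\ weak_div (alpha P) tau w].

(* H^{1/2}(boundary of alpha; R^3) is the trace space of H^1(alpha; R^3) *)
Definition trace_lift (g V : 'rV[R]_3 -> 'rV[R]_3) : Prop :=
  forall i, Hm (E3 R) (alpha P) 1 (cmp V i) /\
            has_trace (E3 R) (E2 R) (alpha P) (cmp V i) (cmp g i).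

Definition Hhalf (g : 'rV[R]_3 -> 'rV[R]_3) : Prop := exists V, trace_lift g V.

(* extension by zero of the elements of H^{1/2}_{00} *)
Definition Hhalf00 (g : 'rV[R]_3 -> 'rV[R]_3) : Prop :=
  Hhalf g /\ ae_on (E2 R) (Gam P) (fun x => g (embed x) = 0).

(* <tau n, g>, defined through Green's formula *)
Definition duality tau (g : 'rV[R]_3 -> 'rV[R]_3) : R :=
  xget 0 [set r | exists2 V, trace_lift g V &
    r = rint (E3 R) (alpha P) (fun x => \sum_i \sum_j
          tau x i j * wderiv (E3 R) (alpha P) [:: j] (cmp V i) x)
      + dotv (E3 R) (alpha P) (wdiv (alpha P) tau) V].

Definition Sigma_a tau : Prop :=
  Hdiv tau /\ forall g, Hhalf00 g -> duality tau g = 0.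

Definition Sigma_t tau : Prop :=
  Sigma_a tau /\ forall i j, Hs (E3 R) (alpha P) (sreg P) (mcmp tau i j).

Definition W_b v : Prop :=
  (forall I, H10 (E2 R) (beta P) (cmp v (inp I))) /\
  H20 (E2 R) (E1 R) (beta P) (cmp v out).

(* hat v: bounded extension of v restricted to Gamma; the norm of H^{1/2} is
   the quotient norm of the trace space *)
Definition is_extension (ext : ('rV[R]_2 -> 'rV[R]_3) -> 'rV[R]_3 -> 'rV[R]_3) :
    Prop :=
  exists2 C : R, 0 < C &
  forall v, (forall i, Hm (E2 R) (beta P) 1 (cmp v i)) ->
    ae_on (E2 R) (Gam P) (fun x => ext v (embed x) = v x) /\
    exists2 V, trace_lift (ext v) V &
      Num.sqrt (\sum_i norm2 (E3 R) (alpha P) 1 (cmp V i)) <=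
      C * Num.sqrt (\sum_i norm2 (E2 R) (beta P) 1 (cmp v i)).

Definition strain v (I J : 'I_2) : 'rV[R]_2 -> R := fun x =>
  2^-1 * (wderiv (E2 R) (beta P) [:: I] (cmp v (inp J)) x +
          wderiv (E2 R) (beta P) [:: J] (cmp v (inp I)) x).

Definition membrane v (I J : 'I_2) : 'rV[R]_2 -> R := fun x =>
  Eb P * tb P / (1 - nub P ^+ 2) *
  ((1 - nub P) * strain v I J x +
   nub P * (\sum_L strain v L L x) * (I == J)%:R).

(* curvature and moments on a subdomain G of the plate: beta or an element *)
Definition curv (G : set 'rV[R]_2) v (I J : 'I_2) : 'rV[R]_2 -> R := fun x =>
  - wderiv (E2 R) G [:: I; J] (cmp v out) x.

Definition moment (G : set 'rV[R]_2) v (I J : 'I_2) : 'rV[R]_2 -> R := fun x =>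
  Eb P * tb P ^+ 3 / (12 * (1 - nub P ^+ 2)) *
  ((1 - nub P) * curv G v I J x +
   nub P * (\sum_L curv G v L L x) * (I == J)%:R).

Definition membrane_form u v : R :=
  rint (E2 R) (beta P) (fun x => \sum_I \sum_J
    membrane u I J x * strain v I J x).

Definition bending_form (G : set 'rV[R]_2) u v : R :=
  rint (E2 R) G (fun x => \sum_I \sum_J moment G u I J x * curv G v I J x).

Definition exact_solution
    (ext : ('rV[R]_2 -> 'rV[R]_3) -> 'rV[R]_3 -> 'rV[R]_3)
    (fa : 'rV[R]_3 -> 'rV[R]_3) (fb : 'rV[R]_2 -> 'rV[R]_3)
    sg (ua : 'rV[R]_3 -> 'rV[R]_3) (ub : 'rV[R]_2 -> 'rV[R]_3) : Prop :=
  [/\ Sigma_a sg, L2v (E3 R) (alpha P) ua & W_b ub] /\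
  [/\ forall tau, Sigma_a tau ->
        dotm (E3 R) (alpha P) (C0inv \o sg) tau
        + dotv (E3 R) (alpha P) (wdiv (alpha P) tau) ua
        - duality tau (ext ub) = 0,
      forall w, L2v (E3 R) (alpha P) w ->
        dotv (E3 R) (alpha P) (wdiv (alpha P) sg) w =
        - dotv (E3 R) (alpha P) fa w &
      forall v, W_b v ->
        duality sg (ext v) + membrane_form ub v + bending_form (beta P) ub v =
        dotv (E2 R) (beta P) fb v].

(* part of the plane x_3 = 0 covered by face i of K *)
Definition face2 (K : 'M[R]_(4, 3)) (i : 'I_4) : set 'rV[R]_2 :=
  embed @^-1` hull (face K i).

(* g is the trace operator H^s(K) -> L^2(F), F being face i of K, lying in the
   plane x_3 = 0: bounded linear extension of the restriction to F of smooth
   functions *)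
Definition trace_operator (s : R) (K : 'M[R]_(4, 3)) (i : 'I_4)
    (g : ('rV[R]_3 -> R) -> 'rV[R]_2 -> R) : Prop :=
  [/\ forall u : 'rV[R]_3 -> R,
        Hs (E3 R) (elt K) s u -> L2 (E2 R) (face2 K i) (g u),
      forall (a b : R) (u v : 'rV[R]_3 -> R),
        Hs (E3 R) (elt K) s u -> Hs (E3 R) (elt K) s v ->
        ae_on (E2 R) (face2 K i) (fun x =>
          g (fun y => a * u y + b * v y) x = a * g u x + b * g v x),
      exists2 C : R, 0 < C & forall u : 'rV[R]_3 -> R, Hs (E3 R) (elt K) s u ->
        Num.sqrt (rint (E2 R) (face2 K i) (fun x => g u x ^+ 2)) <=
        C * Num.sqrt (Hs_norm2 (E3 R) (elt K) s u) &
      forall u phi : 'rV[R]_3 -> R, Hs (E3 R) (elt K) s u -> smooth phi ->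
        ae_on (E2 R) (face2 K i) (fun x =>
          g (fun y => u y + phi y) x = g u x + phi (embed x))].

Definition trace_operators
    (g : 'M[R]_(4, 3) -> 'I_4 -> ('rV[R]_3 -> R) -> 'rV[R]_2 -> R) : Prop :=
  forall K i, aff_indep K -> (forall j, j != i -> K j out = 0) ->
    trace_operator (sreg P) K i (g K i).

Record discretization := Discretization {
  Ta : seq 'M[R]_(4, 3);
  Tb : seq 'M[R]_(3, 2);
  Sh : set ('rV[R]_3 -> 'M[R]_3);
  Vh : set ('rV[R]_3 -> 'rV[R]_3);
  W1h : set ('rV[R]_2 -> 'rV[R]_2);
  W2h : set ('rV[R]_2 -> R);
  Pi3 : ('rV[R]_2 -> R) -> 'rV[R]_2 -> R }.

Definition sum_space {X : Type} {U : zmodType} (A B : set (X -> U)) :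
    set (X -> U) :=
  [set f | exists a b, [/\ A a, B b & f = fun x => a x + b x]].

Section Discrete.
Variable g : 'M[R]_(4, 3) -> 'I_4 -> ('rV[R]_3 -> R) -> 'rV[R]_2 -> R.
Variable D : discretization.

Definition in_Gam (K : 'M[R]_(4, 3)) (i : 'I_4) : bool :=
  `[< hull (face K i) `<=` embed @` closure (Gam P) >].

Definition discretization_ok : Prop :=
  [/\ triangulation (alpha P) (Ta D),
      triangulation (beta P) (Tb D) &
      embed @` closure (Gam P) `<=`
        [set x | exists K i, [/\ K \in Ta D, in_Gam K i & hull (face K i) x]]] /\
  [/\ fin_dim_space (fun tau => symv tau /\
        forall i j, pw_poly (E3 R) (alpha P) (Ta D) (mcmp tau i j)) (Sh D),
      fin_dim_space (fun w : 'rV[R]_3 -> 'rV[R]_3 =>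
        forall i, pw_poly (E3 R) (alpha P) (Ta D) (cmp w i)) (Vh D),
      fin_dim_space (fun v : 'rV[R]_2 -> 'rV[R]_2 =>
        forall I, pw_poly (E2 R) (beta P) (Tb D) (cmp v I)) (W1h D) &
      @fin_dim_space R _ R^o (pw_poly (E2 R) (beta P) (Tb D)) (W2h D)] /\
  [/\ Vh D `<=` L2v (E3 R) (alpha P) &
      W1h D `<=` [set v | forall I, H10 (E2 R) (beta P) (cmp v I)]] /\
  (* the interpolation operator is linear and acts on a.e. classes *)
  let X := sum_space (H20 (E2 R) (E1 R) (beta P)) (W2h D) in
  [/\ forall z, X z -> Hm (E2 R) (beta P) 1 (Pi3 D z),
      forall (a b : R) z z', X z -> X z' ->
        ae_on (E2 R) (beta P) (fun x =>
          Pi3 D (fun y => a * z y + b * z' y) x =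
          a * Pi3 D z x + b * Pi3 D z' x) &
      forall z z', X z -> X z' ->
        ae_on (E2 R) (beta P) (fun x => z x = z' x) ->
        ae_on (E2 R) (beta P) (fun x => Pi3 D z x = Pi3 D z' x)].

Definition W_h v : Prop :=
  W1h D (fun x => \row_I v x 0 (inp I)) /\ W2h D (cmp v out).

Definition XS : set ('rV[R]_3 -> 'M[R]_3) := sum_space Sigma_t (Sh D).
Definition XW : set ('rV[R]_2 -> 'rV[R]_3) := sum_space W_b W_h.

Definition PiB v : 'rV[R]_2 -> 'rV[R]_3 := fun x =>
  \row_i if i == out then Pi3 D (cmp v out) x else v x 0 i.

(* (tau n) on face i of K *)
Definition ntrace tau (K : 'M[R]_(4, 3)) (i : 'I_4) : 'rV[R]_2 -> 'rV[R]_3 :=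
  fun x => \row_k \sum_j g K i (mcmp tau k j) x * outward_normal K i 0 j.

(* (tau n, z)_Gamma *)
Definition Gam_form tau (z : 'rV[R]_2 -> 'rV[R]_3) : R :=
  \sum_(K <- Ta D) \sum_(i | in_Gam K i)
    dotv (E2 R) (face2 K i) (ntrace tau K i) z.

Definition norm_divh tau : R :=
  Num.sqrt (dotm (E3 R) (alpha P) tau tau
    + \sum_(K <- Ta D) dotv (E3 R) (elt K) (wdiv (elt K) tau) (wdiv (elt K) tau)
    + \sum_(K <- Ta D) \sum_(i | in_Gam K i) diam (hull (face K i)) *
        dotv (E2 R) (face2 K i) (ntrace tau K i) (ntrace tau K i)).

(* |z|_{2,h} *)
Definition semi_2h (z : 'rV[R]_2 -> R) : R :=
  Num.sqrt (\sum_(K <- Tb D) semi2 (E2 R) (elt K) 2 z).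

Definition tnorm tau v : R :=
  Num.sqrt (norm_divh tau ^+ 2
    + \sum_I semi2 (E2 R) (beta P) 1 (cmp v (inp I))
    + semi_2h (cmp v out) ^+ 2).

Definition a_h sg u tau v : R :=
  dotm (E3 R) (alpha P) (C0inv \o sg) tau + membrane_form u v
  + \sum_(K <- Tb D) bending_form (elt K) u v
  + Gam_form sg (PiB v) - Gam_form tau (PiB u).

(* b_h(w; tau, v) does not depend on v *)
Definition b_h w tau : R :=
  \sum_(K <- Ta D) dotv (E3 R) (elt K) (wdiv (elt K) tau) w.

Definition discrete_solution
    (fa : 'rV[R]_3 -> 'rV[R]_3) (fb : 'rV[R]_2 -> 'rV[R]_3)
    sg (ua : 'rV[R]_3 -> 'rV[R]_3) (ub : 'rV[R]_2 -> 'rV[R]_3) : Prop :=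
  [/\ Sh D sg, Vh D ua & W_h ub] /\
  forall tau w v, Sh D tau -> Vh D w -> W_h v ->
    a_h sg ub tau v + b_h ua tau = dotv (E2 R) (beta P) fb v /\
    b_h w sg = - dotv (E3 R) (alpha P) fa w.

(* functions are identified when equal a.e. *)
Definition eqS sg tau : Prop :=
  ae_on (E3 R) (alpha P) (fun x => sg x = tau x).
Definition eqV w w' : Prop :=
  ae_on (E3 R) (alpha P) (fun x => w x = w' x).
Definition eqW u v : Prop :=
  ae_on (E2 R) (beta P) (fun x => u x = v x).

Definition A1 : Prop :=
  [/\ forall sg u tau v, XS sg -> XW u -> XS tau -> XW v ->
        tnorm (fun x => sg x + tau x) (fun x => u x + v x) <=
        tnorm sg u + tnorm tau v,
      forall (c : R) sg u, XS sg -> XW u ->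
        tnorm (fun x => c *: sg x) (fun x => c *: u x) = `|c| * tnorm sg u &
      forall sg u, XS sg -> XW u -> tnorm sg u = 0 ->
        eqS sg (fun=> 0) /\ eqW u (fun=> 0)].

Definition A2 (C : R) : Prop :=
  forall sg u tau v w, XS sg -> XW u -> Sh D tau -> W_h v -> Vh D w ->
    `|a_h sg u tau v| <= C * tnorm sg u * tnorm tau v /\
    `|b_h w sg| <= C * tnorm sg u * norm0v (E3 R) (alpha P) w.

Definition B_nc tau : Prop := Sh D tau /\ forall w, Vh D w -> b_h w tau = 0.

Definition inf_sup : \bar R :=
  ereal_inf [set y | exists w, [/\ Vh D w, ~ eqV w (fun=> 0) &
    y = ereal_sup [set z | exists tau, [/\ Sh D tau, ~ eqS tau (fun=> 0) &
      z = (b_h w tau / (norm0v (E3 R) (alpha P) w * norm_divh tau))%:E]]]].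

Definition A3 (C : R) : Prop :=
  (forall tau, B_nc tau ->
     C * norm_divh tau ^+ 2 <= dotm (E3 R) (alpha P) (C0inv \o tau) tau) /\
  (C%:E <= inf_sup)%E.

Definition approx_error sg (ua : 'rV[R]_3 -> 'rV[R]_3) ub : \bar R :=
  let e1 := [set z | exists tau v, [/\ Sh D tau, W_h v &
    z = (tnorm (fun x => sg x - tau x) (fun x => ub x - v x))%:E]] in
  let e2 := [set z | exists w, Vh D w /\
    z = (norm0v (E3 R) (alpha P) (fun x => ua x - w x))%:E] in
  (ereal_inf e1 + ereal_inf e2)%E.

Definition consistency_error (fb : 'rV[R]_2 -> 'rV[R]_3)
    sg (ua : 'rV[R]_3 -> 'rV[R]_3) ub : \bar R :=
  ereal_sup [set z | exists tau v, [/\ Sh D tau, W_h v,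
     ~ (eqS tau (fun=> 0) /\ eqW v (fun=> 0)) &
     z = (`|a_h sg ub tau v + b_h ua tau - dotv (E2 R) (beta P) fb v|
          / tnorm tau v)%:E]].

Definition rate (k : nat) : R := mesh_size (Ta D) ^+ k + mesh_size (Tb D) ^+ k.

End Discrete.

End Elasticity.

(* Main.v *)
Require Import Defs.
From HB Require Import structures.
From mathcomp Require Import all_boot all_order all_algebra.
From mathcomp Require Import all_classical all_reals all_analysis.
From mathcomp Require Import measurable_realfun lra ring.

Set Implicit Arguments.
Unset Strict Implicit.
Unset Printing Implicit Defensive.

Import Order.TTheory GRing.Theory Num.Theory.
Import numFieldNormedType.Exports.

Local Open Scope classical_set_scope.
Local Open Scope ring_scope.


(** On each mesh the discrete problem is a saddle point problem on
    finite-dimensional spaces: the primal unknown is the pair of the stress in the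
    body and the displacement of the plate, the multiplier is the displacement of
    the body, and the constraint is the elementwise divergence.  The two interface
    terms of [a_h] are skew, so they cancel on the diagonal, and
    [a_h (u, y; u, y)] is the sum of the compliance energy of [u] and the elastic
    energy of the plate displacement [y].  The former is coercive on the kernel of
    the constraint by hypothesis.  The latter is coercive unconditionally
    ([plate_coercive]): the bending energy dominates the broken Hessian pointwise,
    and the membrane energy dominates the full gradient by Korn's inequality for
    clamped plates, which rests on the identity
    (d_i u, d_j w) = (d_j u, d_i w) for u in H^1_0 and w in H^1 ([H10_swap]).

    Brezzi's theory then applies.  In finite dimension it only takes linear algebra:
    [saddle_exists] obtains a solution from the fact that the homogeneous adjoint
    problem has only trivial solutions, and [saddle_stable] bounds every solution by
    lifting the constraint data ([constraint_lift]), using coercivity for the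
    remainder and the inf-sup condition for the multiplier.  The constant,
    [stab_const], involves only the constants of the hypotheses and the material
    parameters.  The data enter through the norms of two functionals.  The load of
    the plate is bounded by Poincare's inequality for its in-plane part and, for its
    transverse part, by the control of the L^2 norm by the broken H^2 seminorm,
    which holds on every single mesh because in finite dimension a seminorm is
    controlled by any other one with a smaller kernel ([span_kernel_bound],
    [mesh_poincare]).

    For the error estimate ([quasi_optimal]), let (tau, v, w) be arbitrary discrete
    functions.  The difference of the discrete solution and (tau, v, w) solves the
    discrete problem whose data are the approximation error of (tau, v, w), measured
    through the boundedness of the forms, and the consistency functional of the
    exact solution.  Stability, the triangle inequality and the passage to the
    infimum over (tau, v, w) give the estimate.

    Most of the text justifies the manipulations that this argument takes for
    granted.  Weak derivatives and divergences are only determined up to null sets,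
    by the fundamental lemma of the calculus of variations ([ae_zero]), which is
    proved with explicit smooth bumps on boxes.  That a closed element agrees with
    its interior, a domain with its closure and with the union of the elements of a
    mesh, up to null sets, comes down to hyperplanes being null.  The trace of a
    stress on a face depends only on its values in the element, so that the trace of
    a finite element function is the restriction of a polynomial
    ([trace_affine]).  All forms are sums of integrals of products of quantities
    that are square-integrable and linear up to null sets on the discrete functions
    and on the exact solution ([obs], [bil_at_rint]); this gives their
    bilinearity in the form in which the abstract theory consumes it. *)

(** * Integrals of almost everywhere defined functions *)

Section AlmostEverywhereIntegral.
Context d (T : measurableType d) (R : realType)
  (mu : {measure set T -> \bar R}).
Local Open Scope ereal_scope.
Import HBNNSimple.

(** A simple function below [f], cut off on the exceptional null set, lies below [g]
    and has the same integral. *)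
Lemma ge0_integral_ae_le (f g : T -> \bar R) :
  (forall x, 0 <= f x) -> (forall x, 0 <= g x) ->
  {ae mu, forall x, f x = g x} -> \int[mu]_x f x <= \int[mu]_x g x.
Proof.
move=> f0 g0 [N [mN muN subN]].
rewrite (ge0_integralTE _ f0) (ge0_integralTE _ g0).
apply: ge_ereal_sup => _ [h /= hf <-].
have mCN : measurable (~` N) by exact: measurableC.
have pE x : (proj_nnsfun h mCN x = h x * \1_(~` N) x)%R by [].
apply: ereal_sup_ubound; exists (proj_nnsfun h mCN).
  move=> x; rewrite -[leLHS]/((h x * \1_(~` N) x)%:E) indicE.
  have [xN|xN] := boolP (x \in ~` N); last by rewrite mulr0.
  rewrite mulr1; apply: le_trans (hf x) _.
  suff -> : f x = g x by [].
  by apply: contrapT => /subN; apply: (set_mem xN).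
rewrite -!integralT_nnsfun.
apply: ge0_ae_eq_integral => //.
- exact/measurable_EFinP.
- exact/measurable_EFinP.
- by move=> x _; rewrite lee_fin.
- by move=> x _; rewrite lee_fin.
exists N; split=> // x hx; apply: contrapT => nN; apply: hx => _.
by rewrite pE indicE mem_set// mulr1.
Qed.

(** The integral being defined as a supremum over simple functions, this holds for
    arbitrary functions and domains, so that traces and weak derivatives can be
    replaced by almost everywhere equal ones at no cost. *)
Lemma integral_ae (D D' : set T) (f g : T -> \bar R) :
  {ae mu, forall x, (f \_ D) x = (g \_ D') x} ->
  \int[mu]_(x in D) f x = \int[mu]_(x in D') g x.
Proof.
move=> fg; rewrite integral_mkcond [RHS]integral_mkcond.
move: (f \_ D) (g \_ D') fg => {D D'}{}f {}g fg.
rewrite integralE [RHS]integralE.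
have gf : {ae mu, forall x, g x = f x} by apply: filterS fg.
congr (_ - _); apply/eqP; rewrite eq_le; apply/andP; split;
  apply: ge0_integral_ae_le => //;
  by [apply: filterS fg => x; rewrite ?funeposE ?funenegE => ->
     |apply: filterS gf => x; rewrite ?funeposE ?funenegE => ->].
Qed.

End AlmostEverywhereIntegral.

Lemma ae1 d (T : measurableType d) (R : realType)
    (mu : {measure set T -> \bar R}) (P Q : T -> Prop) :
  {ae mu, forall x, P x} -> (forall x, P x -> Q x) -> {ae mu, forall x, Q x}.
Proof. by move=> HP PQ; apply: filterS HP. Qed.

Lemma ae2 d (T : measurableType d) (R : realType)
    (mu : {measure set T -> \bar R}) (P Q S : T -> Prop) :
  {ae mu, forall x, P x} -> {ae mu, forall x, Q x} ->
  (forall x, P x -> Q x -> S x) -> {ae mu, forall x, S x}.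
Proof. by move=> HP HQ PQ; apply: filterS2 HP HQ. Qed.

Section EuclidIntegral.
Context {R : realType} {n : nat} (E : euclid R n).
Implicit Types (D : set 'rV[R]_n) (f g : 'rV[R]_n -> R).

Definition mdom D : Prop := measurable (@ept _ _ E @^-1` D).

Lemma ae_onI D (P Q : 'rV[R]_n -> Prop) :
  ae_on E D P -> ae_on E D Q -> ae_on E D (fun x => P x /\ Q x).
Proof. by move=> HP HQ; apply: (ae2 HP HQ) => x Px Qx Dx; split; auto. Qed.

Lemma ae_onS D (P Q : 'rV[R]_n -> Prop) :
  (forall x, D x -> P x -> Q x) -> ae_on E D P -> ae_on E D Q.
Proof. by move=> PQ HP; apply: (ae1 HP) => x Px Dx; apply: PQ (Px Dx). Qed.

Lemma ae_on_sub D D' (P : 'rV[R]_n -> Prop) :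
  D' `<=` D -> ae_on E D P -> ae_on E D' P.
Proof. by move=> sD H; apply: (ae1 H) => x Px /sD. Qed.

Lemma ae_onT D (P : 'rV[R]_n -> Prop) :
  (forall x, D x -> P x) -> ae_on E D P.
Proof. by move=> H; apply: aeW => x; apply: H. Qed.

Lemma ae_on_fin D (I : finType) (P : I -> 'rV[R]_n -> Prop) :
  (forall i, ae_on E D (P i)) -> ae_on E D (fun x => forall i, P i x).
Proof.
move=> H.
have : ae_on E D (fun x => forall i, i \in enum I -> P i x).
  elim: (enum I) => [|i s IH]; first exact: ae_onT.
  apply: ae_onS (ae_onI (H i) IH) => x _ [Pi Ps] j.
  by rewrite inE => /predU1P[->//|/Ps].
by apply: ae_onS => x _ Hx i; apply: Hx; rewrite mem_enum.
Qed.

Lemma eint_ae_dom D D' (f g : 'rV[R]_n -> \bar R) :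
  ae_on E setT (fun x => (D x <-> D' x) /\ (D x -> f x = g x)) ->
  eint E D f = eint E D' g.
Proof.
move=> H; apply: integral_ae; apply: (ae1 H) => p /(_ I)[DD fg].
rewrite !patchE; have [Dp|Dp] := pselect (D (ept p)).
  rewrite !mem_set//=; [exact: fg|exact/DD].
by rewrite !memNset//= => /DD.
Qed.

Lemma rint_ae_dom D D' f g :
  ae_on E setT (fun x => (D x <-> D' x) /\ (D x -> f x = g x)) ->
  rint E D f = rint E D' g.
Proof.
move=> H; congr fine; apply: (@eint_ae_dom D D' (EFin \o f) (EFin \o g)).
by apply: ae_onS H => x _ [DD fg]; split=> // /fg /= ->.
Qed.

Lemma rint_ae D f g : ae_on E D (fun x => f x = g x) -> rint E D f = rint E D g.
Proof.
by move=> H; apply: rint_ae_dom; apply: (ae1 H) => p Hp _; split.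
Qed.

Lemma eint_ae D (f g : 'rV[R]_n -> \bar R) :
  ae_on E D (fun x => f x = g x) -> eint E D f = eint E D g.
Proof.
by move=> H; apply: eint_ae_dom; apply: (ae1 H) => p Hp _; split.
Qed.

(** The integrable representative is a function on the measure space, so that the
    abstract theory applies to it whether or not [ept] is a bijection. *)
Definition intg D f : Prop := exists2 h : esort E -> R,
  (emu E).-integrable (@ept _ _ E @^-1` D) (EFin \o h) &
  {ae emu E, forall p, D (ept p) -> f (ept p) = h p}.

Lemma rint_intg D f (h : esort E -> R) :
  {ae emu E, forall p, D (ept p) -> f (ept p) = h p} ->
  rint E D f = \int[emu E]_(p in @ept _ _ E @^-1` D) h p.
Proof.
move=> H; congr fine; apply: integral_ae; apply: (ae1 H) => p Hp.
rewrite !patchE; case: ifPn => // /set_mem /= Dp; by rewrite Hp.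
Qed.

Lemma intg_ae D f g : ae_on E D (fun x => f x = g x) -> intg D f -> intg D g.
Proof.
move=> fg [h ih fh]; exists h => //.
by apply: (ae2 fg fh) => p fgp fhp Dp; rewrite -fgp// fhp.
Qed.

Lemma intg_lin D (a b : R) f g : mdom D -> intg D f -> intg D g ->
  intg D (fun x => a * f x + b * g x) /\
  rint E D (fun x => a * f x + b * g x) = a * rint E D f + b * rint E D g.
Proof.
move=> mD [h ih fh] [k ik gk].
have ia : (emu E).-integrable (@ept _ _ E @^-1` D) (EFin \o (fun p => a * h p)).
  by have := integrableZl mD a ih; apply: eq_integrable.
have ib : (emu E).-integrable (@ept _ _ E @^-1` D) (EFin \o (fun p => b * k p)).
  by have := integrableZl mD b ik; apply: eq_integrable.
have H : {ae emu E, forall p, D (ept p) ->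
    a * f (ept p) + b * g (ept p) = a * h p + b * k p}.
  by apply: (ae2 fh gk) => p fhp gkp Dp; rewrite fhp ?gkp.
split.
  exists (fun p => a * h p + b * k p) => //.
  by have := integrableD mD ia ib; apply: eq_integrable.
rewrite (rint_intg H) (rint_intg fh) (rint_intg gk).
by rewrite RintegralD// !RintegralZl.
Qed.

Lemma intg0 D : intg D (fun=> 0).
Proof. by exists (fun=> 0); [exact: integrable0|exact: aeW]. Qed.

Lemma rint0 D : rint E D (fun=> 0) = 0.
Proof. by rewrite /rint /Rintegral integral0. Qed.

Lemma rint0_ae D f : ae_on E D (fun x => f x = 0) -> rint E D f = 0.
Proof. by move=> /rint_ae->; rewrite rint0. Qed.

Lemma intgD D f g : mdom D -> intg D f -> intg D g ->
  intg D (fun x => f x + g x).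
Proof.
move=> mD If Ig; have [H _] := intg_lin 1 1 mD If Ig.
by apply: intg_ae H; apply: ae_onT => x _; rewrite !mul1r.
Qed.

Lemma rintD D f g : mdom D -> intg D f -> intg D g ->
  rint E D (fun x => f x + g x) = rint E D f + rint E D g.
Proof.
move=> mD If Ig; have [_] := intg_lin 1 1 mD If Ig; rewrite !mul1r => <-.
by apply: rint_ae; apply: ae_onT => x _; rewrite !mul1r.
Qed.

Lemma intgZ D (a : R) f : mdom D -> intg D f -> intg D (fun x => a * f x).
Proof.
move=> mD If; have [H _] := intg_lin a 0 mD If If.
by apply: intg_ae H; apply: ae_onT => x _; rewrite mul0r addr0.
Qed.

Lemma rintZ D (a : R) f : mdom D -> intg D f ->
  rint E D (fun x => a * f x) = a * rint E D f.
Proof.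
move=> mD If; have [_] := intg_lin a 0 mD If If; rewrite mul0r addr0 => <-.
by apply: rint_ae; apply: ae_onT => x _; rewrite mul0r addr0.
Qed.

Lemma intg_sum D (I : Type) (s : seq I) (P : pred I) (F : I -> 'rV[R]_n -> R) :
  mdom D -> (forall i, P i -> intg D (F i)) ->
  intg D (fun x => \sum_(i <- s | P i) F i x).
Proof.
move=> mD iF; elim: s => [|i s IH].
  by apply: intg_ae (intg0 D); apply: ae_onT => x _; rewrite big_nil.
case Pi: (P i); last first.
  by apply: intg_ae IH; apply: ae_onT => x _; rewrite big_cons Pi.
apply: intg_ae (intgD mD (iF _ Pi) IH).
by apply: ae_onT => x _; rewrite big_cons Pi.
Qed.

Lemma rint_sum D (I : Type) (s : seq I) (P : pred I) (F : I -> 'rV[R]_n -> R) :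
  mdom D -> (forall i, P i -> intg D (F i)) ->
  rint E D (fun x => \sum_(i <- s | P i) F i x) =
  \sum_(i <- s | P i) rint E D (F i).
Proof.
move=> mD iF; elim: s => [|i s IH].
  by rewrite big_nil rint0_ae//; apply: ae_onT => x _; rewrite big_nil.
rewrite big_cons; case Pi: (P i); last first.
  by rewrite -IH; apply: rint_ae; apply: ae_onT => x _; rewrite big_cons Pi.
rewrite -IH -rintD//; [|exact: iF|exact: intg_sum].
by apply: rint_ae; apply: ae_onT => x _; rewrite big_cons Pi.
Qed.

Lemma intg_restrict D D' f : mdom D -> mdom D' -> intg D f ->
  intg D' (fun x => if `[< D x >] then f x else 0).
Proof.
move=> mD mD' [h ih fh]; exists (h \_ (@ept _ _ E @^-1` D)).
  apply: (@integrableS _ _ _ _ setT) => //.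
  rewrite integrable_mkcond in ih => //.
  by apply: eq_integrable ih => // p _; rewrite /= !patchE; case: ifP.
apply: (ae1 fh) => p fhp Dp; rewrite patchE; case: asboolP => Dx.
  by rewrite mem_set//= fhp.
by rewrite memNset.
Qed.

Lemma rint_ge0 D f : (forall x, D x -> 0 <= f x) -> 0 <= rint E D f.
Proof. by move=> f0; apply: Rintegral_ge0 => p; apply: f0. Qed.

Lemma rint_le D f g : mdom D -> intg D f -> intg D g ->
  (forall x, D x -> f x <= g x) -> rint E D f <= rint E D g.
Proof.
move=> mD If Ig fg; rewrite -subr_ge0.
have [_] := intg_lin 1 (-1) mD Ig If; rewrite mul1r mulN1r => <-.
by apply: rint_ge0 => x Dx; rewrite mul1r mulN1r subr_ge0 fg.
Qed.

(** Like [intg], a property of the almost everywhere class of [f], stable under all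
    the substitutions below, whereas [L2] demands that [f] itself be measurable. *)
Definition sqi D f : Prop := exists2 h : esort E -> R,
  measurable_fun (@ept _ _ E @^-1` D) h /\
  (emu E).-integrable (@ept _ _ E @^-1` D) (EFin \o (fun p => h p ^+ 2)) &
  {ae emu E, forall p, D (ept p) -> f (ept p) = h p}.

Definition ip D f g : R := rint E D (fun x => f x * g x).

Lemma L2_sqi D f : mdom D -> L2 E D f -> sqi D f.
Proof.
move=> mD [mf f2]; exists (f \o @ept _ _ E); last exact: aeW.
split=> //; apply/integrableP; split.
  by apply/measurable_EFinP; apply: measurable_funX.
apply: le_lt_trans f2; rewrite le_eqVlt; apply/orP; left; apply/eqP.
by apply: eq_integral => p _; rewrite gee0_abs// lee_fin sqr_ge0.
Qed.

Lemma sqi_ae D f g : ae_on E D (fun x => f x = g x) -> sqi D f -> sqi D g.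
Proof.
move=> fg [h mh fh]; exists h => //.
by apply: (ae2 fg fh) => p fgp fhp Dp; rewrite -fgp// fhp.
Qed.

Lemma sqi_intgM D f g : mdom D -> sqi D f -> sqi D g ->
  intg D (fun x => f x * g x).
Proof.
move=> mD [h [mh ih] fh] [k [mk ik] gk]; exists (fun p => h p * k p); last first.
  by apply: (ae2 fh gk) => p fhp gkp Dp; rewrite fhp ?gkp.
apply: (le_integrable mD _ _ (integrableD mD ih ik)).
  by apply/measurable_EFinP; apply: measurable_funM.
move=> p _ /=; rewrite lee_fin [leRHS]ger0_norm ?addr_ge0 ?sqr_ge0//.
have := sqr_ge0 (`|h p| - `|k p|); have := normr_ge0 (h p); have := normr_ge0 (k p).
rewrite normrM -(real_normK (num_real (h p))) -(real_normK (num_real (k p))).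
nra.
Qed.

Lemma sqi_lin D (a b : R) f g : mdom D -> sqi D f -> sqi D g ->
  sqi D (fun x => a * f x + b * g x).
Proof.
move=> mD [h [mh ih] fh] [k [mk ik] gk].
exists (fun p => a * h p + b * k p); last first.
  by apply: (ae2 fh gk) => p fhp gkp Dp; rewrite fhp ?gkp.
have m1 : measurable_fun (@ept _ _ E @^-1` D) (fun p => a * h p + b * k p).
  by apply: measurable_funD; apply: measurable_funM.
split=> //.
have i1 := integrableZl mD (2 * a ^+ 2) ih.
have i2 := integrableZl mD (2 * b ^+ 2) ik.
apply: (le_integrable mD _ _ (integrableD mD i1 i2)).
  by apply/measurable_EFinP; apply: measurable_funX.
move=> p _ /=; rewrite lee_fin.
rewrite ger0_norm ?sqr_ge0// [leRHS]ger0_norm; last first.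
  by rewrite addr_ge0// mulr_ge0 ?sqr_ge0// mulr_ge0 ?sqr_ge0.
have := sqr_ge0 (a * h p - b * k p); nra.
Qed.

Lemma sqi0 D : sqi D (fun=> 0).
Proof.
exists (fun=> 0); last exact: aeW.
split=> //; rewrite (_ : _ \o _ = cst 0%E); first exact: integrable0.
by apply/funext => p /=; rewrite expr0n.
Qed.

Lemma sqiD D f g : mdom D -> sqi D f -> sqi D g -> sqi D (fun x => f x + g x).
Proof.
move=> mD sf sg; apply: sqi_ae (sqi_lin 1 1 mD sf sg).
by apply: ae_onT => x _; rewrite !mul1r.
Qed.

Lemma sqi_sum D (I : Type) (s : seq I) (P : pred I) (F : I -> 'rV[R]_n -> R) :
  mdom D -> (forall i, P i -> sqi D (F i)) ->
  sqi D (fun x => \sum_(i <- s | P i) F i x).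
Proof.
move=> mD iF; elim: s => [|i s IH].
  by apply: sqi_ae (sqi0 D); apply: ae_onT => x _; rewrite big_nil.
case Pi: (P i); last first.
  by apply: sqi_ae IH; apply: ae_onT => x _; rewrite big_cons Pi.
apply: sqi_ae (sqiD mD (iF _ Pi) IH).
by apply: ae_onT => x _; rewrite big_cons Pi.
Qed.

Lemma sqi_sub D D' f : mdom D -> mdom D' -> D' `<=` D -> sqi D f -> sqi D' f.
Proof.
move=> mD mD' sD [h [mh ih] fh]; exists h.
  have sp : @ept _ _ E @^-1` D' `<=` @ept _ _ E @^-1` D by move=> p; apply: sD.
  split; first exact: measurable_funS mh.
  exact: integrableS ih.
by apply: (ae1 fh) => p fhp /sD.
Qed.

Lemma sqi_restrict D D' f : mdom D -> mdom D' -> sqi D f ->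
  sqi D' (fun x => if `[< D x >] then f x else 0).
Proof.
move=> mD mD' [h [mh ih] fh]; exists (h \_ (@ept _ _ E @^-1` D)).
  have mh' : measurable_fun setT (h \_ (@ept _ _ E @^-1` D)).
    by apply/(measurable_restrictT _ _).1.
  split; first exact: measurable_funS mh'.
  apply: (@integrableS _ _ _ _ setT) => //.
  rewrite integrable_mkcond in ih => //.
  apply: eq_integrable ih => // p _; rewrite /= !patchE.
  by case: ifP => // _; rewrite expr0n.
apply: (ae1 fh) => p fhp Dp; rewrite patchE; case: asboolP => Dx.
  by rewrite mem_set//= fhp.
by rewrite memNset.
Qed.

Lemma sqi_null D D' f : mdom D -> mdom D' ->
  ae_on E setT (fun x => D' x -> D x) -> sqi D f -> sqi D' f.
Proof.
move=> mD mD' sD sf; apply: sqi_ae (sqi_restrict mD mD' sf).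
by apply: (ae1 sD) => p Dp Dp'; rewrite asboolT//; exact: Dp.
Qed.

Lemma ipC D f g : ip D f g = ip D g f.
Proof. by apply: rint_ae; apply: ae_onT => x _; rewrite mulrC. Qed.

Lemma ip_linl D (a b : R) f f' g : mdom D -> sqi D f -> sqi D f' -> sqi D g ->
  ip D (fun x => a * f x + b * f' x) g = a * ip D f g + b * ip D f' g.
Proof.
move=> mD sf sf' sg.
have [_ <-] := intg_lin a b mD (sqi_intgM mD sf sg) (sqi_intgM mD sf' sg).
by apply: rint_ae; apply: ae_onT => x _; rewrite mulrDl !mulrA.
Qed.

Lemma ip_linr D (a b : R) f f' g : mdom D -> sqi D f -> sqi D f' -> sqi D g ->
  ip D g (fun x => a * f x + b * f' x) = a * ip D g f + b * ip D g f'.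
Proof. by move=> mD sf sf' sg; rewrite ipC ip_linl// ![ip _ g _]ipC. Qed.

Lemma ip_ae D f f' g g' : ae_on E D (fun x => f x = f' x) ->
  ae_on E D (fun x => g x = g' x) -> ip D f g = ip D f' g'.
Proof.
move=> ff gg; apply: rint_ae; apply: ae_onS (ae_onI ff gg).
by move=> x _ [-> ->].
Qed.

Lemma ip_ge0 D f : 0 <= ip D f f.
Proof. by apply: rint_ge0 => x _; rewrite -expr2 sqr_ge0. Qed.

Lemma ip0l D f g : ae_on E D (fun x => f x = 0) -> ip D f g = 0.
Proof.
by move=> f0; apply: rint0_ae; apply: ae_onS f0 => x _ ->; rewrite mul0r.
Qed.

End EuclidIntegral.

Section CauchySchwarz.
Context {R : rcfType}.

(** Cauchy-Schwarz for a semidefinite form: [a], [b] and [c] are the values of the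
    form on (u, u), (u, v) and (v, v). The leading coefficient may vanish, since the
    seminorms below may have a kernel. *)
Lemma discriminant_le (a b c : R) :
  (forall t, 0 <= a + 2 * t * b + t ^+ 2 * c) -> b ^+ 2 <= a * c.
Proof.
move=> H; have a0 : 0 <= a.
  by have := H 0; rewrite mulr0 mul0r expr0n mul0r !addr0.
have [c0|] := ltP 0 c.
  have := H (- (b / c)).
  have -> : a + 2 * - (b / c) * b + (- (b / c)) ^+ 2 * c = (a * c - b ^+ 2) / c.
    by field; rewrite gt_eqF.
  by rewrite pmulr_lge0 ?invr_gt0// subr_ge0.
move=> c0; have [b0|b0] := eqVneq b 0.
  rewrite b0 expr0n; suff -> : c = 0 by rewrite mulr0.
  apply/eqP; rewrite eq_le c0 /=; apply: contraT; rewrite -ltNge => cn.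
  pose t := 1 + a / - c.
  have a1 : 0 <= a / - c by rewrite divr_ge0// oppr_ge0 ltW.
  have := H t; rewrite b0 mulr0 addr0.
  have e : a = (a / - c) * - c by rewrite divfK// oppr_eq0 lt_eqF.
  have : 0 <= (a / - c) ^+ 2 by rewrite sqr_ge0.
  rewrite /t {2}e; move: (a / - c) a1 => u u0 u2; nra.
exfalso.
have := H (- (a + 1) / (2 * b)).
have -> : a + 2 * (- (a + 1) / (2 * b)) * b = -1 by field.
have : 0 <= (- (a + 1) / (2 * b)) ^+ 2 by rewrite sqr_ge0.
nra.
Qed.

Lemma ler_norm_sqrtM (a b c : R) : 0 <= a -> b ^+ 2 <= a * c ->
  `|b| <= Num.sqrt a * Num.sqrt c.
Proof.
by move=> a0 H; rewrite -sqrtrM// -sqrtr_sqr ler_wsqrtr.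
Qed.

End CauchySchwarz.
(** * Lebesgue measure on the plane and in space *)

Section Boxes.
Context {R : realType} {n : nat}.
Implicit Types (a b x : 'rV[R]_n) (U : set 'rV[R]_n).

Definition obox a b : set 'rV[R]_n := [set x | forall i, a 0 i < x 0 i < b 0 i].
Definition cbox a b : set 'rV[R]_n := [set x | forall i, a 0 i <= x 0 i <= b 0 i].

Definition rat_vec (q : 'rV[rat]_n) : 'rV[R]_n := map_mx ratr q.

Lemma sub_obox_cbox a b : obox a b `<=` cbox a b.
Proof. by move=> x H i; have /andP[? ?] := H i; rewrite !ltW. Qed.

Lemma oboxI a b a' b' : obox a b `&` obox a' b' =
  obox (\row_i Num.max (a 0 i) (a' 0 i)) (\row_i Num.min (b 0 i) (b' 0 i)).
Proof.
apply/seteqP; split => x.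
  by move=> [H H'] i; rewrite !mxE gt_max lt_min; case/andP: (H i) => -> ->;
     case/andP: (H' i) => -> ->.
by move=> H; split=> i; have := H i;
  rewrite !mxE gt_max lt_min => /andP[/andP[h1 h2] /andP[h3 h4]]; apply/andP.
Qed.

Lemma cbox_compact a b : compact (cbox a b).
Proof.
have := @rV_compact R n (fun i => `[a 0 i, b 0 i]%classic)
  (fun i => @segment_compact _ _ _).
congr compact; apply/seteqP; split => x /= H i; have := H i;
  by rewrite /= ?in_itv.
Qed.

(** The closed box is required to lie in [U] so that functions supported in it have
    compact support in [U]; rational corners leave only countably many boxes. *)
Lemma open_rat_box U x : open U -> U x ->
  exists a b : 'rV[rat]_n,
    obox (rat_vec a) (rat_vec b) x /\ cbox (rat_vec a) (rat_vec b) `<=` U.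
Proof.
move=> oU Ux; have : nbhs x U by apply: open_nbhs_nbhs.
move=> /nbhs_ballP[e /= e0 eU].
have Ha (i : 'I_n) : exists q : rat, x 0 i - e < ratr q < x 0 i.
  have /rat_in_itvoo[q] : x 0 i - e < x 0 i by rewrite ltrBlDr ltrDl.
  by rewrite in_itv/=; exists q.
have Hb (i : 'I_n) : exists q : rat, x 0 i < ratr q < x 0 i + e.
  have /rat_in_itvoo[q] : x 0 i < x 0 i + e by rewrite ltrDl.
  by rewrite in_itv/=; exists q.
have [a Pa] := choice Ha; have [b Pb] := choice Hb.
exists (\row_i a i), (\row_i b i); split=> [i|y Hy].
  by rewrite !mxE; case/andP: (Pa i) => _ ->; case/andP: (Pb i) => ->.
apply: eU; split=> // i j; rewrite ord1; have := Hy j; rewrite !mxE.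
case/andP: (Pa j) => a1 a2; case/andP: (Pb j) => b1 b2 /andP[h1 h2].
by rewrite /ball /= ltr_distl; apply/andP; split; lra.
Qed.

Definition cubeR (M : R) : set 'rV[R]_n := obox (const_mx (- M)) (const_mx M).

End Boxes.

Section EuclidMeasurability.
Context {R : realType} {n : nat} (E : euclid R n).
Hypothesis coordE : forall i, measurable_fun setT (fun p => @ept _ _ E p 0 i).

Lemma mset_obox_coord (a b : 'rV[R]_n) : mdom E (obox a b).
Proof.
rewrite /mdom; have -> : @ept _ _ E @^-1` obox a b =
    \bigcap_(i in [set: 'I_n]) (setT `&` (fun p => @ept _ _ E p 0 i) @^-1` `]a 0 i, b 0 i[%classic).
  by apply/seteqP; split=> x H; [move=> i _; split=> //|move=> i; have [_] := H i I];
    rewrite /= in_itv/=; [exact: H|].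
by apply: fin_bigcap_measurable => // i _; apply: coordE.
Qed.

Lemma mset_open_coord (U : set 'rV[R]_n) : open U -> mdom E U.
Proof.
move=> oU.
pose F k : set 'rV[R]_n := if @unpickle ('rV[rat]_n * 'rV[rat]_n)%type k is Some (a, b) then
  (if `[< obox (rat_vec a) (rat_vec b) `<=` U >] then obox (rat_vec a) (rat_vec b)
   else set0) else set0.
rewrite /mdom; have -> : @ept _ _ E @^-1` U = \bigcup_k (@ept _ _ E @^-1` F k).
  apply/seteqP; split => p /=.
    move=> Up; have [a [b [H1 H2]]] := open_rat_box oU Up.
    exists (pickle (a, b)) => //=; rewrite /F pickleK.
    by case: asboolP => // -[]; apply: subset_trans H2; apply: sub_obox_cbox.
  by move=> [k _] /=; rewrite /F; case: unpickle => // -[a b]; case: asboolP => // H /H.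
apply: bigcup_measurable => k _; rewrite /F.
case: unpickle => [[a b]|]; last by rewrite preimage_set0.
by case: asboolP => _; [exact: mset_obox_coord|rewrite preimage_set0].
Qed.

Lemma continuous_measurable_coord (f : 'rV[R]_n -> R) : continuous f ->
  measurable_fun setT (fun p => f (@ept _ _ E p)).
Proof.
move=> cf; apply: (measurability _ (RGenOpens.measurableE R)) => //.
move=> _ [_ [x [y ->]] <-]; rewrite setTI.
apply: (mset_open_coord (U := f @^-1` `]x, y[%classic)).
by apply: open_comp; [move=> z _; exact: cf|exact: itv_open].
Qed.

End EuclidMeasurability.

Section Slices.
Context {R : realType} {n : nat}.
Implicit Types (f : 'rV[R]_n -> R) (x v : 'rV[R]_n).

Lemma is_derive_line f x v (t : R) : derivable (f : 'rV[R]_n -> R^o) (x + t *: v) v ->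
  is_derive t 1 (fun s : R => f (x + s *: v) : R^o) ('D_v (f : 'rV[R]_n -> R^o) (x + t *: v)).
Proof.
have E : (fun h : R => h^-1 *: ((fun s : R => f (x + s *: v) : R^o) (h *: 1 + t)
      - f (x + t *: v))) =
    (fun h : R => h^-1 *: ((f (h *: v + (x + t *: v)) : R^o) - f (x + t *: v))).
  apply/funext => h; rewrite /= -[h%:A]/(h * 1) mulr1 scalerDl.
  by rewrite (addrCA (h *: v)).
move=> df; split.
  by move: df; rewrite /derivable /= => df; rewrite -[X in cvg X]/(_ @ 0^') E.
by rewrite /derive /= E.
Qed.

Lemma derivable_line f x v : derivable (fun s : R => f (x + s *: v) : R^o) 0 1 ->
  derivable (f : 'rV[R]_n -> R^o) x v /\
  'D_v (f : 'rV[R]_n -> R^o) x = 'D_1 (fun s : R => f (x + s *: v) : R^o) 0.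
Proof.
have E : (fun h : R => h^-1 *: ((fun s : R => f (x + s *: v) : R^o) (h *: 1 + 0)
      - f (x + 0 *: v))) =
    (fun h : R => h^-1 *: ((f (h *: v + x) : R^o) - f x)).
  by apply/funext => h; rewrite /= -[h%:A]/(h * 1) mulr1 addr0 scale0r addr0 (addrC x).
move=> df; split; last by rewrite /derive /= E.
by move: df; rewrite /derivable /= E.
Qed.

Lemma continuous_line f x v : continuous f -> continuous (fun s : R => f (x + s *: v)).
Proof.
move=> cf s; apply: (@continuous_comp _ _ _ (fun s : R => x + s *: v) f); last exact: cf.
apply: continuousD; first exact: cst_continuous.
by apply: continuousZl; exact: cvg_id.
Qed.

End Slices.

Section OneDim.
Context {R : realType}.
Notation leb := (@lebesgue_measure R).

(** The multivariate integration by parts reduces to this statement on lines. *)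
Lemma integral_derive_eq0 (F f : R -> R) (M : R) : continuous f ->
  (forall t : R, is_derive t (1 : R) (F : R -> R^o) (f t)) ->
  (forall t, M <= `|t| -> F t = 0) ->
  (\int[leb]_t (f t)%:E)%E = 0%E.
Proof.
move=> cf dF F0.
have [M0|M0] := lerP M 0.
  have F00 : F = cst 0 by apply/funext => t; apply: F0; apply: le_trans M0 _.
  apply: integral0_eq => t _; congr EFin.
  by have := @derive_val _ _ _ _ _ _ _ (dF t); rewrite F00 => <-; rewrite derive_cst.
have f0 t : M < `|t| -> f t = 0.
  move=> Mt; have dFt := @derive_val _ _ _ _ _ _ _ (dF t); rewrite -dFt.
  have : \forall s \near t, F s = cst 0 s.
    have : \forall s \near t, M < `|s|.
      by apply: (@cvgr_gt _ _ (nbhs t) _ (fun s : R => `|s|) `|t|) => //; exact: norm_continuous.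
    by apply: filterS => s Ms; rewrite F0 // ltW.
  move=> H; rewrite (@near_eq_derive _ _ _ F (cst 0) t 1)//; first by rewrite derive_cst.
pose N := M + 1.
have N0 : - N < N by rewrite /N; lra.
have -> : (\int[leb]_t (f t)%:E)%E = (\int[leb]_(t in `[(- N)%R, N]) (f t)%:E)%E.
  rewrite [RHS]integral_mkcond; apply: eq_integral => t _; rewrite patchE.
  case: ifPn => // tN; rewrite f0//.
  rewrite ltNge ler_norml; apply: contra tN => /andP[h1 h2].
  by apply/mem_set; rewrite /= in_itv/= /N; apply/andP; split; lra.
rewrite (@continuous_FTC2 _ f F) //.
- rewrite !F0 ?subee//; rewrite ?normrN ger0_norm /N; lra.
- by apply: continuous_subspaceT.
- have cF : continuous F.
    move=> t; have [dt _] := dF t.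
    exact/differentiable_continuous/derivable1_diffP.
  split.
  + by move=> t _; have [] := dF t.
  + by apply: cvg_at_right_filter; exact: cF.
  + by apply: cvg_at_left_filter; exact: cF.
- by move=> t _; rewrite derive1E; exact: derive_val.
Qed.

End OneDim.

(** What the later parts use of Lebesgue measure in several variables: the
    Borel sets are generated by boxes, bounded boxes have finite measure,
    hyperplanes are null, and the integral of a partial derivative of a
    compactly supported function vanishes. *)
Record lebesgue_like (R : realType) (n : nat) (E : euclid R n.+1) : Prop := {
  ll_coord : forall i, measurable_fun setT (fun p => @ept _ _ E p 0 i);
  ll_gen : forall S : set (set (esort E)), sigma_algebra setT S ->
    (forall a b, S (@ept _ _ E @^-1` obox a b)) ->
    forall A, measurable A -> S A;
  ll_cube : forall M : R, (emu E (@ept _ _ E @^-1` cubeR M) < +oo)%E;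
  ll_hyper : forall (m : 'rV[R]_n.+1) c, m != 0 ->
    emu E (@ept _ _ E @^-1` [set x | \sum_i m 0 i * x 0 i = c]) = 0%E;
  ll_ibp : forall i (f : 'rV[R]_n.+1 -> R) (M : R), continuous f ->
    (forall x, derivable (f : 'rV[R]_n.+1 -> R^o) x (delta_mx 0 i)) ->
    continuous (partial i f) ->
    (forall x, ~ cubeR M x -> f x = 0) ->
    rint E setT (partial i f) = 0 }.

Section GeneratedByBoxes.
Context {R : realType} {n : nat} (E : euclid R n).

(** A strip is the union of boxes with growing sides in the other directions. *)
Lemma gen_coord (S : set (set (esort E))) : sigma_algebra setT S ->
  (forall a b, S (@ept _ _ E @^-1` obox a b)) ->
  forall i (B : set R), measurable B -> S ((fun p => @ept _ _ E p 0 i) @^-1` B).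
Proof.
move=> sS HS i B mB.
pose S' := [set B : set R | S ((fun p => @ept _ _ E p 0 i) @^-1` B)].
have [S0 SD SU] := sS.
have sS' : sigma_algebra setT S'.
  split.
  - by rewrite /S' /= preimage_set0.
  - by move=> A SA; rewrite /S' /= setTD preimage_setC -setTD; apply: SD.
  - by move=> F SF; rewrite /S' /= preimage_bigcup; apply: SU.
have e := f_equal (fun X : set (set R) => X B) (RGenOpens.measurableE R).
have HB : <<s RGenOpens.G (R := R) >> B := eq_ind _ (fun X : Prop => X) mB _ e.
apply: (HB S'); split=> // A [x [y ->]].
rewrite /S' /=.
have -> : (fun p => @ept _ _ E p 0 i) @^-1` `]x, y[%classic = \bigcup_k
    (@ept _ _ E @^-1` obox (\row_j if j == i then x else - k%:R)
                           (\row_j if j == i then y else k%:R)).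
  apply/seteqP; split => p /=.
    rewrite in_itv /= => Hp.
    pose M := \sum_j `|@ept _ _ E p 0 j|.
    exists (Num.truncn M).+1 => //= j; rewrite !mxE; case: eqP => [->//|_].
    rewrite -ltr_norml; apply: le_lt_trans (truncnS_gt _).
    by rewrite /M (bigD1 j)//= lerDl sumr_ge0.
  by move=> [k _] /= /(_ i); rewrite !mxE eqxx in_itv.
by apply: SU => k; apply: HS.
Qed.

End GeneratedByBoxes.

Lemma cube_finite_sum (R : realType) n (M : R) i (x : 'rV[R]_n) :
  cubeR M x -> `|x 0 i| < M.
Proof. by move=> /(_ i); rewrite !mxE ltr_norml. Qed.

Lemma continuous_cube_integrable (R : realType) n (E : euclid R n)
    (f : 'rV[R]_n -> R) (M : R) :
  (forall i, measurable_fun setT (fun p => @ept _ _ E p 0 i)) ->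
  (emu E (@ept _ _ E @^-1` cubeR M) < +oo)%E ->
  continuous f -> (forall x, ~ cubeR M x -> f x = 0) ->
  (emu E).-integrable setT (EFin \o (f \o @ept _ _ E)).
Proof.
move=> mE fE cf f0.
have mc : measurable (@ept _ _ E @^-1` cubeR M) by exact: mset_obox_coord.
have mf := continuous_measurable_coord mE cf.
have : (emu E).-integrable (@ept _ _ E @^-1` cubeR M) (EFin \o (f \o @ept _ _ E)).
  apply: measurable_bounded_integrable => //; first exact: measurable_funS mf.
  have : bounded_set (f @` cbox (const_mx (- M)) (const_mx M)).
    apply: compact_bounded; apply: continuous_compact; last exact: cbox_compact.
    exact: continuous_subspaceT.
  move=> [N [Nr HN]]; exists N; split=> // r Nr' p /= Hp; apply: HN => //=.
  by exists (ept p) => //; apply: sub_obox_cbox.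
rewrite (integrable_mkcond _ mc); apply: eq_integrable => // p _.
rewrite patchE; case: ifPn => // /negP H /=; rewrite f0// => H'.
by apply: H; apply/mem_set.
Qed.

Lemma sum_ord2 (V : nmodType) (F : 'I_2 -> V) : \sum_i F i = F 0 + F 1.
Proof. by rewrite big_ord_recl big_ord1; congr (_ + F _); apply: val_inj. Qed.

Lemma sum_ord3 (V : nmodType) (F : 'I_3 -> V) : \sum_i F i = F 0 + F 1 + F (inord 2).
Proof.
rewrite big_ord_recl big_ord_recl big_ord1 addrA.
by congr (_ + F _ + F _); apply: val_inj; rewrite //= inordK.
Qed.

Lemma partial_cube0 (R : realType) n (i : 'I_n.+1) (f : 'rV[R]_n.+1 -> R) (M : R) :
  (forall x, ~ cubeR M x -> f x = 0) ->
  forall x, ~ cubeR (M + 1) x -> partial i f x = 0.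
Proof.
move=> f0 x Hx; rewrite /partial.
have H : \forall y \near x, (f : 'rV[R]_n.+1 -> R^o) y = cst 0 y.
  have [j Hj] : exists j, M + 1 <= `|x 0 j|.
    apply: contrapT => H; apply: Hx => j; rewrite !mxE -ltr_norml ltNge.
    by apply/negP => H'; apply: H; exists j.
  have : \forall y \near x, M < `|(y : 'rV[R]_n.+1) 0 j|.
    apply: (@cvgr_gt _ _ (nbhs x) _ (fun y : 'rV[R]_n.+1 => `|y 0 j|) `|x 0 j|) => //.
      apply: cvg_norm; exact: coord_continuous.
    by apply: lt_le_trans Hj; rewrite ltrDl.
  apply: filterS => y My; rewrite f0 // => /(cube_finite_sum j).
  by rewrite ltNge (ltW My).
by rewrite (near_eq_derive _ H) ?derive_cst.
Qed.

Lemma integral_partial_line (R : realType) n (i : 'I_n.+1) (f : 'rV[R]_n.+1 -> R)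
    (M : R) (c : 'rV[R]_n.+1) : continuous f ->
  (forall x, derivable (f : 'rV[R]_n.+1 -> R^o) x (delta_mx 0 i)) ->
  continuous (partial i f) ->
  (forall x, ~ cubeR M x -> f x = 0) ->
  (\int[@lebesgue_measure R]_t (partial i f (c + t *: delta_mx 0 i))%:E)%E = 0%E.
Proof.
move=> cf df cpf f0.
apply: (@integral_derive_eq0 _ (fun t => f (c + t *: delta_mx 0 i)) _ (M + `|c 0 i|)).
- exact: continuous_line.
- by move=> t; apply: is_derive_line.
- move=> t Mt; apply: f0 => /(cube_finite_sum i).
  rewrite !mxE !eqxx mulr1; have := ler_normB (c 0 i + t) (c 0 i).
  rewrite addrAC subrr add0r; lra.
Qed.

(** The product measure is defined by sections in the first variable; uniqueness of
    product measures gives access to those in the second one. *)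
Lemma product_null_ysection d1 d2 (T1 : measurableType d1) (T2 : measurableType d2)
    (R : realType) (m1 : {sigma_finite_measure set T1 -> \bar R})
    (m2 : {sigma_finite_measure set T2 -> \bar R}) (X : set (T1 * T2)) :
  measurable X -> (forall y, m1 (ysection X y) = 0%E) -> (m1 \x m2)%E X = 0%E.
Proof.
move=> mX X0; have -> : (m1 \x m2)%E X = (m1 \x^ m2)%E X.
  by apply: product_measure_unique => // B C mB mC; rewrite /= product_measure2E.
by apply: integral0_eq => y _ /=.
Qed.

(** The product measure bundled as a sigma-finite measure, so that the product
    construction and the Fubini theorem can be iterated. *)
Section SigmaFiniteProduct.
Context d1 d2 (T1 : measurableType d1) (T2 : measurableType d2) (R : realType)
  (m1 : {sigma_finite_measure set T1 -> \bar R})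
  (m2 : {sigma_finite_measure set T2 -> \bar R}).

Lemma product_sigma_finite : sigma_finite setT (m1 \x m2)%E.
Proof.
have /sigma_finiteP[F [TF ndF Foo]] := sigma_finiteT m1.
have /sigma_finiteP[G [TG ndG Goo]] := sigma_finiteT m2.
exists (fun n => F n `*` G n).
  rewrite -setXTT TF TG predeqE => -[x y]; split.
    move=> [/= [n _ Fnx] [k _ Gky]]; exists (maxn n k) => //; split.
    - by move: x Fnx; exact/subsetPset/ndF/leq_maxl.
    - by move: y Gky; exact/subsetPset/ndG/leq_maxr.
  by move=> [n _ []/= ? ?]; split; exists n.
move=> k; have [? ?] := Foo k; have [? ?] := Goo k.
split; first exact: measurableX.
by rewrite product_measure1E// lte_mul_pinfty// ge0_fin_numE.
Qed.
Definition prod_measure : set (T1 * T2) -> \bar R := (m1 \x m2)%E.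

HB.instance Definition _ := Measure.copy prod_measure
  ((m1 \x m2)%E : {measure set (T1 * T2)%type -> \bar R}).
HB.instance Definition _ := Measure_isSigmaFinite.Build _ _ _ prod_measure
  product_sigma_finite.

Definition sf_prod : {sigma_finite_measure set (T1 * T2)%type -> \bar R} :=
  prod_measure.

End SigmaFiniteProduct.

Section Plane.
Context {R : realType}.
Notation leb := (@lebesgue_measure R).
Notation row2 := (fun x y : R => @ept _ _ (E2 R) (x, y)).

Lemma E2_coord i : measurable_fun setT (fun p => @ept _ _ (E2 R) p 0 i).
Proof.
case: (boolP (i == 0 :> nat)) => i0.
  apply: (eq_measurable_fun fst) => [p _|]; first by rewrite /= mxE i0.
  exact: measurable_fst.
apply: (eq_measurable_fun snd) => [p _|]; first by rewrite /= mxE (negbTE i0).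
exact: measurable_snd.
Qed.

Lemma E2_gen (S : set (set (esort (E2 R)))) : sigma_algebra setT S ->
  (forall a b, S (@ept _ _ (E2 R) @^-1` obox a b)) ->
  forall A, measurable A -> S A.
Proof.
move=> sS HS A mA; have Hc := gen_coord sS HS.
move: mA; apply; split=> // _ [] [B mB <-]; rewrite setTI.
  have := Hc 0 B mB; congr S; apply/seteqP; by split => p /=; rewrite mxE.
have := Hc 1 B mB; congr S; apply/seteqP; by split => p /=; rewrite mxE.
Qed.

Lemma E2_cube M : (emu (E2 R) (@ept _ _ (E2 R) @^-1` cubeR M) < +oo)%E.
Proof.
have -> : @ept _ _ (E2 R) @^-1` cubeR M =
    `](- M), M[%classic `*` `](- M), M[%classic.
  apply/seteqP; split => -[x y] /= H.
    by have := H 0; have := H 1; rewrite /= !mxE /= !in_itv /= => -> ->.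
  by move=> i; case: H; rewrite !in_itv /= !mxE; case: ifP.
rewrite [X in (X < _)%E]product_measure1E//= lebesgue_measure_itv/=.
case: ifP => _; last by rewrite mul0e ltry.
by rewrite -EFinD -EFinM ltry.
Qed.

(** A line meets the parallels to one of the axes in single points. *)
Lemma E2_hyper (m : 'rV[R]_2) c : m != 0 ->
  emu (E2 R) (@ept _ _ (E2 R) @^-1` [set x | \sum_i m 0 i * x 0 i = c]) = 0%E.
Proof.
move=> m0; pose A := @ept _ _ (E2 R) @^-1` [set x | \sum_i m 0 i * x 0 i = c].
have AE p : A p <-> m 0 0 * p.1 + m 0 1 * p.2 = c.
  by rewrite /A /= sum_ord2 !mxE.
have mA : measurable A.
  have -> : A = (fun p : R * R => m 0 0 * p.1 + m 0 1 * p.2) @^-1` [set c].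
    by apply/seteqP; split => p /AE.
  rewrite -[X in measurable X]setTI.
  have mf : measurable_fun setT (fun p : R * R => m 0 0 * p.1 + m 0 1 * p.2).
    by apply: measurable_funD; apply: measurable_funM.
  exact: mf.
have [m1|m1] := eqVneq (m 0 1) 0.
  have m00 : m 0 0 != 0.
    apply: contra m0 => /eqP m00; apply/eqP/rowP => i; rewrite mxE.
    by case: i => [[|[|]]]// ?; [rewrite -[RHS]m00|rewrite -[RHS]m1];
      congr (m _ _); apply: val_inj.
  apply: product_null_ysection => // y.
  have -> : ysection A y = [set c / m 0 0]; last exact: lebesgue_measure_set1.
  apply/seteqP; split => x; rewrite /ysection /= inE AE /= m1 mul0r addr0.
    by move=> <-; field.
  by move=> ->; field.
apply: integral0_eq => x _ /=.
have -> : xsection A x = [set (c - m 0 0 * x) / m 0 1]; last exact: lebesgue_measure_set1.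
apply/seteqP; split => y; rewrite /xsection /= inE AE /=.
  by move=> <-; field.
by move=> ->; field.
Qed.

Lemma row2_line0 (x y : R) : row2 x y = row2 0 y + x *: delta_mx 0 0.
Proof.
apply/rowP => -[[|[|]]]// i; rewrite !mxE/= ?mulr1 ?add0r ?mulr0 ?addr0//.
Qed.

Lemma row2_line1 (x y : R) : row2 x y = row2 x 0 + y *: delta_mx 0 1.
Proof.
apply/rowP => -[[|[|]]]// i; rewrite !mxE/= ?mulr1 ?add0r ?mulr0 ?addr0//.
Qed.

(** By Fubini's theorem, integrating first along the direction of the derivative. *)
Lemma E2_ibp (i : 'I_2) (f : 'rV[R]_2 -> R) (M : R) : continuous f ->
  (forall x, derivable (f : 'rV[R]_2 -> R^o) x (delta_mx 0 i)) ->
  continuous (partial i f) ->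
  (forall x, ~ cubeR M x -> f x = 0) ->
  (\int[leb \x leb]_p (partial i f (@ept _ _ (E2 R) p))%:E)%E = 0%E.
Proof.
move=> cf df cpf f0.
have pf0 := @partial_cube0 _ _ i _ _ f0.
have intf := continuous_cube_integrable (E := E2 R) E2_coord (E2_cube _) cpf pf0.
have i0 : i = 0 \/ i = 1.
  by case: i {df cpf pf0 intf} => [[|[|]]]// ?; [left|right]; apply: val_inj.
case: i0 => ?; subst i.
  rewrite -(integral21_prod_meas1 intf); apply: integral0_eq => y _.
  rewrite -[RHS](integral_partial_line (row2 0 y) cf df cpf f0).
  by apply: eq_integral => x _; congr (partial _ f _)%:E; exact: row2_line0.
rewrite -(integral12_prod_meas1 intf); apply: integral0_eq => x _.
rewrite -[RHS](integral_partial_line (row2 x 0) cf df cpf f0).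
by apply: eq_integral => y _; congr (partial _ f _)%:E; exact: row2_line1.
Qed.

Lemma lebesgue_like_E2 : lebesgue_like (E2 R).
Proof.
split; [exact: E2_coord|exact: E2_gen|exact: E2_cube|exact: E2_hyper|].
by move=> i f M cf df cpf f0; rewrite /rint /Rintegral (E2_ibp cf df cpf f0).
Qed.

End Plane.

Lemma lty_mul_fin (R : realType) (x : \bar R) (r : R) :
  (0 <= x -> x < +oo -> x * r%:E < +oo)%E.
Proof. by case: x => //= x _ _; rewrite -EFinM ltry. Qed.

Section Space.
Context {R : realType}.
Notation leb := (@lebesgue_measure R).
Definition leb2 : {sigma_finite_measure set _ -> \bar R} :=
  @sf_prod _ _ _ _ _ leb leb.

(** The measure of [E3] presented as a product of a plane with a line, both factors
    being bundled as sigma-finite measures. *)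
Definition space3 : euclid R 3 := @Euclid R 3 _ _ (@sf_prod _ _ _ _ _ leb2 leb)
  (fun p => \row_(i < 3) if i == 0 :> nat then p.1.1
                         else if i == 1 :> nat then p.1.2 else p.2).

Lemma space3E : E3 R = space3.
Proof. by []. Qed.

Notation row3 := (fun x y z : R => @ept _ _ space3 (x, y, z)).
Notation row2 := (fun x y : R => @ept _ _ (E2 R) (x, y)).

Lemma E3_coord i : measurable_fun setT (fun p => @ept _ _ space3 p 0 i).
Proof.
have m1 : measurable_fun setT (fun p : R * R * R => p.1.1).
  by apply: (@measurableT_comp _ _ _ _ _ _ fst) => //; exact: measurable_fst.
have m2 : measurable_fun setT (fun p : R * R * R => p.1.2).
  by apply: (@measurableT_comp _ _ _ _ _ _ snd) => //; exact: measurable_fst.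
case: (boolP (i == 0 :> nat)) => i0.
  by apply: (eq_measurable_fun (fun p : R * R * R => p.1.1)) => [p _|//]; rewrite /= mxE i0.
case: (boolP (i == 1 :> nat)) => i1.
  by apply: (eq_measurable_fun (fun p : R * R * R => p.1.2)) => [p _|//];
    rewrite /= mxE (negbTE i0) i1.
apply: (eq_measurable_fun snd) => [p _|]; first by rewrite /= mxE (negbTE i0) (negbTE i1).
exact: measurable_snd.
Qed.

Lemma E3_gen (S : set (set (esort space3))) : sigma_algebra setT S ->
  (forall a b, S (@ept _ _ space3 @^-1` obox a b)) ->
  forall A, measurable A -> S A.
Proof.
move=> sS HS A mA; have Hc := gen_coord sS HS.
have [S0 SD SU] := sS.
move: mA; apply; split=> // _ [] [B mB <-]; rewrite setTI; last first.
  have := Hc (inord 2) B mB; congr S; apply/seteqP.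
  by split => p /=; rewrite mxE !inordK.
pose S' := [set B : set (R * R) | S (fst @^-1` B)].
change (S' B).
have sS' : sigma_algebra setT S'.
  split.
  - by rewrite /S' /= preimage_set0.
  - by move=> C SC; rewrite /S' /= setTD preimage_setC -setTD; apply: SD.
  - by move=> F SF; rewrite /S' /= preimage_bigcup; apply: SU.
move: mB; apply; split=> // _ [] [C mC <-]; rewrite setTI /S' /=.
  have := Hc 0 C mC; congr S; apply/seteqP; by split => p /=; rewrite mxE.
have := Hc 1 C mC; congr S; apply/seteqP; by split => p /=; rewrite mxE.
Qed.

Lemma E3_cube M : (emu space3 (@ept _ _ space3 @^-1` cubeR M) < +oo)%E.
Proof.
have -> : @ept _ _ space3 @^-1` cubeR M =
    (@ept _ _ (E2 R) @^-1` cubeR M) `*` `](- M), M[%classic.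
  apply/seteqP; split => -[[x y] z] /= H.
    split=> /=; last by have := H (inord 2); rewrite /= !mxE /= !inordK//= in_itv.
    move=> i; rewrite /= !mxE; case: ifP => _; first by have := H 0; rewrite !mxE.
    by have := H 1; rewrite !mxE.
  case: H => H; rewrite /= in_itv /= => H2 i; rewrite !mxE.
  case: ifP => _; first by have := H 0; rewrite !mxE.
  by case: ifP => _ //; have := H 1; rewrite !mxE.
have mc : mdom (E2 R) (cubeR M) := mset_obox_coord (@E2_coord R) _ _.
have h : (leb2 (@ept _ _ (E2 R) @^-1` cubeR M) < +oo)%E := E2_cube M.
set B : set R := `](- M), M[%classic.
have [r hr] : exists r : R, leb B = r%:E.
  rewrite lebesgue_measure_itv /= lte_fin; case: ifP => _; last by exists 0.
  by exists (M + M); rewrite -EFinB opprK.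
have -> : emu space3 ((@ept _ _ (E2 R) @^-1` cubeR M) `*` B) =
    (leb2 (@ept _ _ (E2 R) @^-1` cubeR M) * leb B)%E.
  by apply: product_measure1E => //; exact: measurable_itv.
by rewrite hr; apply: lty_mul_fin.
Qed.

(** A plane that is not vertical meets vertical lines in single points; a vertical
    one meets horizontal planes in lines. *)
Lemma E3_hyper (m : 'rV[R]_3) c : m != 0 ->
  emu space3 (@ept _ _ space3 @^-1` [set x | \sum_i m 0 i * x 0 i = c]) = 0%E.
Proof.
move=> m0; pose A := @ept _ _ space3 @^-1` [set x | \sum_i m 0 i * x 0 i = c].
pose k : 'I_3 := inord 2.
have AE p : A p <-> m 0 0 * p.1.1 + m 0 1 * p.1.2 + m 0 k * p.2 = c.
  by rewrite /A /= sum_ord3 !mxE/= inordK.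
have mA : measurable A.
  have -> : A = (fun p => \sum_i m 0 i * @ept _ _ space3 p 0 i) @^-1` [set c] by [].
  rewrite -[X in measurable X]setTI.
  have mf : measurable_fun setT (fun p => \sum_i m 0 i * @ept _ _ space3 p 0 i).
    by apply: measurable_sum => i; apply: measurable_funM => //; exact: E3_coord.
  exact: mf.
have [mk|mk] := eqVneq (m 0 k) 0.
  have m00 : (\row_(i < 2) if i == 0 then m 0 0 else m 0 1) != 0.
    apply: contra m0 => /eqP/rowP m00; apply/eqP/rowP => i; rewrite mxE.
    have := m00 0; have := m00 1; rewrite !mxE /= => h1 h0.
    case: i => [[|[|[|]]]]// ?; [rewrite -[RHS]h0|rewrite -[RHS]h1|rewrite -[RHS]mk];
      by congr (m _ _); apply: val_inj; rewrite //= inordK.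
  have H z : leb2 (ysection A z) = 0%E.
    rewrite -[RHS](E2_hyper c m00); congr (emu (E2 R) _).
    apply/seteqP; split => p; rewrite /ysection /= inE AE /= mk mul0r addr0.
      by rewrite sum_ord2 !mxE.
    by rewrite sum_ord2 !mxE.
  exact: (@product_null_ysection _ _ (esort (E2 R)) (esort (E1 R)) R
    leb2 leb A mA H).
apply: integral0_eq => p _ /=.
have -> : xsection A p = [set (c - m 0 0 * p.1 - m 0 1 * p.2) / m 0 k];
  last exact: lebesgue_measure_set1.
apply/seteqP; split => y; rewrite /xsection /= inE AE /=.
  by move=> <-; field.
by move=> ->; field.
Qed.

Lemma row3_line2 (x y z : R) : row3 x y z = row3 x y 0 + z *: delta_mx 0 (inord 2).
Proof.
apply/rowP => i; rewrite !mxE/= -val_eqE /= inordK//.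
by case: i => -[|[|[|]]]// i; rewrite /= ?mulr1 ?add0r ?mulr0 ?addr0.
Qed.

Definition lift_z (z : R) (u : 'rV[R]_2) : 'rV[R]_3 := row3 (u 0 0) (u 0 1) z.

Lemma lift_z_continuous z : continuous (lift_z z).
Proof.
have -> : lift_z z = (fun u : 'rV[R]_2 => row3 0 0 z +
    (u 0 0 *: delta_mx 0 0 + u 0 1 *: delta_mx 0 1)).
  apply/funext => u; apply/rowP => -[[|[|[|]]]]// i;
  by rewrite !mxE/= ?mulr1 ?add0r ?mulr0 ?addr0 ?add0r.
have ce j k : continuous (fun u : 'rV[R]_2 => u 0 j *: (delta_mx 0 k : 'rV[R]_3)).
  by move=> u; apply: continuousZr_tmp; exact: coord_continuous.
move=> u; apply: (cvgD (@cst_continuous _ _ (row3 0 0 z) u)).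
exact: (cvgD (ce _ _ u) (ce _ _ u)).
Qed.

Lemma lift_z_derive (f : 'rV[R]_3 -> R) (i : 'I_2) (j : 'I_3) (z : R) :
  i = j :> nat -> (forall x, derivable (f : 'rV[R]_3 -> R^o) x (delta_mx 0 j)) ->
  (forall u, derivable (f \o lift_z z : 'rV[R]_2 -> R^o) u (delta_mx 0 i)) /\
  partial i (f \o lift_z z) = partial j f \o lift_z z.
Proof.
move=> ij df.
have E u (s : R) : lift_z z (u + s *: delta_mx 0 i) = lift_z z u + s *: delta_mx 0 j.
  apply/rowP => k; rewrite !mxE -!val_eqE /= -ij.
  case: i {ij} => [[|[|]]]//= _; case: k => [[|[|[|]]]]//= _;
  by rewrite ?mulr1 ?add0r ?mulr0 ?addr0.
have H u : is_derive 0 (1 : R) (fun s : R => (f \o lift_z z) (u + s *: delta_mx 0 i) : R^o)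
    (partial j f (lift_z z u)).
  have -> : (fun s : R => (f \o lift_z z) (u + s *: delta_mx 0 i) : R^o) =
      (fun s : R => f (lift_z z u + s *: delta_mx 0 j) : R^o).
    by apply/funext => s /=; rewrite E.
  have := @is_derive_line R 3 f (lift_z z u) (delta_mx 0 j) 0.
  by rewrite scale0r addr0; apply.
split=> [u|].
  by have [d _] := H u; have [] := derivable_line d.
apply/funext => u; have [d v] := H u; have [_ e] := derivable_line d.
by rewrite /partial /= e v.
Qed.

Lemma lift_z_cube (M z : R) (f : 'rV[R]_3 -> R) :
  (forall x, ~ cubeR M x -> f x = 0) -> forall u, ~ cubeR M u -> f (lift_z z u) = 0.
Proof.
move=> f0 u Hu; apply: f0 => H; apply: Hu => i.
have := H 0; have := H 1; rewrite !mxE /=.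
by case: i => [[|[|]]]//= hi h1 h0; [move: h0|move: h1];
  congr (_ < u _ _ < _); apply: val_inj.
Qed.

(** Horizontal derivatives are handled in the horizontal planes, the vertical one on
    the vertical lines. *)
Lemma E3_ibp (i : 'I_3) (f : 'rV[R]_3 -> R) (M : R) : continuous f ->
  (forall x, derivable (f : 'rV[R]_3 -> R^o) x (delta_mx 0 i)) ->
  continuous (partial i f) ->
  (forall x, ~ cubeR M x -> f x = 0) ->
  (\int[@sf_prod _ _ _ _ _ leb2 leb]_p (partial i f (@ept _ _ space3 p))%:E)%E = 0%E.
Proof.
move=> cf df cpf f0.
have pf0 := @partial_cube0 _ _ i _ _ f0.
have intf := continuous_cube_integrable (E := space3) E3_coord (E3_cube _) cpf pf0.
have [i2|i2] := ltnP i 2.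
  rewrite -(integral21_prod_meas1 intf); apply: integral0_eq => z _.
  rewrite /fubini_G /=.
  have [dg pg] := lift_z_derive (i := Ordinal i2) z erefl df.
  have cg : continuous (f \o lift_z z).
    by move=> u; apply: continuous_comp; [exact: lift_z_continuous|exact: cf].
  have cpg : continuous (partial (Ordinal i2) (f \o lift_z z)).
    by rewrite pg => u; apply: continuous_comp; [exact: lift_z_continuous|exact: cpf].
  have := E2_ibp cg dg cpg (lift_z_cube z f0); rewrite pg => H.
  rewrite -[RHS]H; apply: eq_integral => -[x y] _ /=.
  by congr (partial i f _)%:E; rewrite /lift_z !mxE.
have i2' : i = inord 2.
  apply: val_inj; rewrite /= inordK//; apply/eqP; rewrite eqn_leq i2 andbT.
  by rewrite -ltnS ltn_ord.
subst i.
rewrite -(integral12_prod_meas1 intf); apply: integral0_eq => -[x y] _.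
rewrite -[RHS](integral_partial_line (row3 x y 0) cf df cpf f0).
by apply: eq_integral => z _; congr (partial _ f _)%:E; exact: row3_line2.
Qed.

Lemma lebesgue_like_E3 : lebesgue_like (E3 R).
Proof.
rewrite space3E.
split; [exact: E3_coord|exact: E3_gen|exact: E3_cube|exact: E3_hyper|].
by move=> i f M cf df cpf f0; rewrite /rint /Rintegral (E3_ibp cf df cpf f0).
Qed.

End Space.
(** * Smooth functions *)

Section SmoothLine.
Context {R : realType}.

(** Infinite differentiability, by coinduction: a function is smooth as soon as it
    belongs to some class of functions closed under differentiation. This avoids
    computing iterated derivatives. *)
Definition smooth1 (f : R -> R) : Prop := exists K : set (R -> R), K f /\
  forall h, K h -> exists2 h', K h' & forall x : R, is_derive x (1 : R) h (h' x).

Lemma smooth1_derive f : smooth1 f ->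
  exists2 f', smooth1 f' & forall x : R, is_derive x (1 : R) f (f' x).
Proof.
by move=> [K [Kf H]]; have [f' Kf' df] := H _ Kf; exists f' => //; exists K.
Qed.

Lemma smooth1_continuous f : smooth1 f -> continuous f.
Proof.
move=> /smooth1_derive[f' _ df] x; have [d _] := df x.
exact/differentiable_continuous/derivable1_diffP.
Qed.

Lemma smooth1_poly (p : {poly R}) : smooth1 (horner p).
Proof.
exists [set h | exists q : {poly R}, h = horner q]; split; first by exists p.
by move=> _ [q ->]; exists (horner q^`()) => [|x]; [exists q^`()|exact: is_derive_poly].
Qed.

(** The factor [a] of the chain rule makes it necessary to include all multiples in the
    class closed under differentiation. *)
Lemma smooth1_affine f (a b : R) : smooth1 f -> smooth1 (fun x => f (a * x + b)).
Proof.
move=> [K [Kf H]].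
exists [set h | exists c g, K g /\ h = fun x => c * g (a * x + b)]; split.
  by exists 1, f; split=> //; apply/funext => x; rewrite mul1r.
move=> _ [c [g [Kg ->]]]; have [g' Kg' dg] := H _ Kg.
exists (fun x => (c * a) * g' (a * x + b)); first by exists (c * a), g'.
move=> x.
have d1 : is_derive x (1 : R) (fun x => a * x + b) a.
  have := is_derive_poly (a *: 'X + b%:P) x.
  have -> : horner (a *: 'X + b%:P) = (fun x => a * x + b).
    by apply/funext => y; rewrite !hornerE.
  by rewrite derivD derivZ derivX derivC addr0 alg_polyC hornerC.
have := is_deriveZ c (@is_derive1_comp _ g (fun x => a * x + b) x _ _ (dg _) d1).
suff -> : c *: (g' (a * x + b) * a) = c * a * g' (a * x + b) by [].
by rewrite /GRing.scale /=; ring.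
Qed.

(** Finite sums of products of smooth functions are closed under differentiation. *)
Lemma smooth1M f g : smooth1 f -> smooth1 g -> smooth1 (fun x => f x * g x).
Proof.
move=> sf sg.
exists [set h | exists s : seq ((R -> R) * (R -> R)),
   (forall u, List.In u s -> smooth1 u.1 /\ smooth1 u.2) /\
   h = fun x => \sum_(u <- s) u.1 x * u.2 x]; split.
  exists [:: (f, g)]; split; last by apply/funext => x; rewrite big_seq1.
  by move=> u [<-|[]].
move=> _ [s [Hs ->]].
suff [s' [Hs' D]] : exists s' : seq ((R -> R) * (R -> R)),
   (forall u, List.In u s' -> smooth1 u.1 /\ smooth1 u.2) /\
   forall x : R, is_derive x (1 : R) (fun x => \sum_(u <- s) u.1 x * u.2 x)
      (\sum_(u <- s') u.1 x * u.2 x).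
  by exists (fun x => \sum_(u <- s') u.1 x * u.2 x) => //; exists s'.
elim: s Hs => [|u s IH] Hs.
  exists [::]; split=> // x; rewrite big_nil.
  have -> : (fun x : R => \sum_(u <- [::]) u.1 x * u.2 x) = cst (0 : R).
    by apply/funext => y; rewrite big_nil.
  exact: is_derive_cst.
have [|s' [Hs' D]] := IH; first by move=> v vs; apply: Hs; right.
have [/smooth1_derive[a' sa' da] /smooth1_derive[b' sb' db]] := Hs u (or_introl erefl).
have [su1 su2] := Hs u (or_introl erefl).
exists [:: (a', u.2), (u.1, b') & s']; split.
  by move=> v [<-|[<-|]]//; apply: Hs'.
move=> x; rewrite !big_cons /=.
have -> : (fun x0 => \sum_(u <- u :: s) u.1 x0 * u.2 x0) =
    (fun x => u.1 x * u.2 x) \+ (fun x => \sum_(u <- s) u.1 x * u.2 x).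
  by apply/funext => y; rewrite big_cons.
rewrite addrA; apply: is_deriveD.
have := is_deriveM (da x) (db x).
by rewrite /GRing.scale /= addrC (mulrC (u.2 x)).
Qed.

(** [flat p] is [p (1/x) exp (-1/x)] on the positive axis and zero elsewhere.
    These functions are closed under differentiation, so that in particular
    [exp (-1/x)] extends smoothly by zero. *)
Definition flat (p : {poly R}) (x : R) : R :=
  if 0 < x then p.[x^-1] * expR (- x^-1) else 0.

(** One term of the exponential series. *)
Lemma expR_monomial_le (n : nat) (t : R) : 0 <= t -> t ^+ n * expR (- t) <= n`!%:R.
Proof.
move=> t0; rewrite expRN ler_pdivrMr ?expR_gt0//.
case: n => [|n]; first by rewrite expr0 mul1r; apply: le_trans (expR_ge1Dx t); rewrite lerDl.
have f0 : 0 < (n.+1)`!%:R :> R by rewrite ltr0n fact_gt0.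
rewrite mulrC -ler_pdivrMr//; apply: le_trans (expR_ge1Dxn n t0).
by rewrite lerDr.
Qed.

Lemma flat_bounded p : exists2 C : R, 0 <= C & forall x, `|flat p x| <= C.
Proof.
exists (\sum_(i < size p) `|p`_i| * i`!%:R).
  by apply: sumr_ge0 => i _; rewrite mulr_ge0.
move=> x; rewrite /flat; case: ifP => x0; last first.
  by rewrite normr0; apply: sumr_ge0 => i _; rewrite mulr_ge0.
have t0 : 0 <= x^-1 by rewrite invr_ge0 ltW.
rewrite horner_coef mulr_suml; apply: le_trans (ler_norm_sum _ _ _) _.
apply: ler_sum => i _; rewrite -mulrA normrM ler_wpM2l//.
by rewrite ger0_norm ?mulr_ge0 ?exprn_ge0 ?expR_ge0// expR_monomial_le.
Qed.

(** At the origin the difference quotient of [flat p] is h times a function of the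
    same kind, which is bounded. *)
Lemma flat_derive p (x : R) :
  is_derive x (1 : R) (flat p) (flat ('X^2 * (p - p^`())) x).
Proof.
have [x0|x0|x0] := ltgtP x 0.
- have -> : flat ('X^2 * (p - p^`())) x = 0 by rewrite /flat ltNge (ltW x0).
  have D0 : is_derive x (1 : R) (cst (0 : R)) 0 by exact: is_derive_cst.
  apply: near_eq_is_derive D0.
  have : \forall y \near x, y < 0 by apply: lt_nbhsl.
  by apply: filterS => y y0; rewrite /flat ltNge (ltW y0).
- rewrite {2}/flat x0.
  have xn : id x != 0 by rewrite gt_eqF.
  have dV := is_deriveV xn (is_derive_id x (1 : R)).
  have d1 := is_derive1_comp (is_derive_poly p x^-1) dV.
  have d2 := @is_derive1_comp _ expR (fun y => - y^-1) x _ _ (is_derive_expR (- x^-1)) (is_deriveN dV).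
  have D0 := is_deriveM d1 d2.
  set v := (X in is_derive _ _ _ X).
  have -> : v = p.[x^-1] * (expR (- x^-1) * - (- x ^- 2 * 1)) +
     expR (- x^-1) * (p^`().[x^-1] * (- x ^- 2 * 1)).
    by rewrite /v !hornerE /= -exprVn; ring.
  apply: near_eq_is_derive D0.
  have : \forall y \near x, 0 < y by apply: lt_nbhsr.
  by apply: filterS => y y0; rewrite /flat y0.
- have -> : flat ('X^2 * (p - p^`())) x = 0 by rewrite /flat x0 ltxx.
  have [C C0 HC] := flat_bounded ('X^2 * p).
  have H : (fun h : R => h^-1 *: ((flat p (h *: 1 + x) : R^o) - flat p x)) @ 0^' --> (0 : R^o).
    apply/cvgr0Pnorm_lt => e e0.
    have d0 : 0 < e / (C + 1) by rewrite divr_gt0// ltr_wpDl.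
    near=> h.
    have h0 : h != 0 by near: h; exact: nbhs_dnbhs_neq.
    have he : `|h| < e / (C + 1).
      by near: h; apply: dnbhs0_lt.
    have fp0 : flat p 0 = 0 by rewrite /flat ltxx.
    have -> : h^-1 *: ((flat p (h *: 1 + x) : R^o) - flat p x) = h * flat ('X^2 * p) h.
      rewrite x0 addr0 -[h *: 1]/(h * 1) mulr1 fp0 subr0 -[LHS]/(h^-1 * flat p h).
      rewrite /flat; case: ifP => _; last by rewrite !mulr0.
      by rewrite !hornerE /=; field.
    rewrite normrM; apply: le_lt_trans (ler_wpM2l (normr_ge0 _) (HC h)) _.
    have C1 : 0 < C + 1 by rewrite ltr_wpDl.
    move: he; rewrite ltr_pdivlMr// => he.
    apply: le_lt_trans he; rewrite ler_wpM2l// lerDl ler01//.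
  split; first by apply/cvg_ex; exists 0.
  exact/cvg_lim.
Unshelve. all: by end_near. Qed.

Lemma smooth1_flat p : smooth1 (flat p).
Proof.
exists [set h | exists q, h = flat q]; split; first by exists p.
move=> _ [q ->]; exists (flat ('X^2 * (q - q^`()))); first by eexists.
exact: flat_derive.
Qed.

(** Smooth approximations of the indicator function of the interval from [a] to [b]:
    they vanish outside, lie between zero and one, and tend to one inside. *)
Definition bump1 (k : nat) (a b t : R) : R :=
  flat 1 (k.+1%:R * t + - (k.+1%:R * a)) * flat 1 (- k.+1%:R * t + k.+1%:R * b).

Lemma smooth1_bump1 k a b : smooth1 (bump1 k a b).
Proof. by apply: smooth1M; apply: smooth1_affine; exact: smooth1_flat. Qed.

Lemma flat1E x : flat 1 x = if 0 < x then expR (- x^-1) else 0.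
Proof. by rewrite /flat hornerC mul1r. Qed.

Lemma flat1_itv x : 0 <= flat 1 x <= 1.
Proof.
rewrite flat1E; case: ifP => x0; last by rewrite lexx ler01.
rewrite expR_ge0 /= -expR0 ler_expR oppr_le0 invr_ge0 ltW//.
Qed.

Lemma bump1_itv k a b t : 0 <= bump1 k a b t <= 1.
Proof.
rewrite /bump1; have /andP[h1 h2] := flat1_itv (k.+1%:R * t + - (k.+1%:R * a)).
have /andP[h3 h4] := flat1_itv (- k.+1%:R * t + k.+1%:R * b).
by rewrite mulr_ge0//= mulr_ile1.
Qed.

Lemma bump1_out k a b t : ~~ (a < t < b) -> bump1 k a b t = 0.
Proof.
have k0 : 0 < k.+1%:R :> R by rewrite ltr0n.
rewrite negb_and -!leNgt /bump1 !flat1E => /orP[h|h].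
  rewrite [X in X * _](_ : _ = 0) ?mul0r//; case: ifP => //.
  by rewrite -mulrBr pmulr_rgt0// subr_gt0 ltNge h.
rewrite [X in _ * X](_ : _ = 0) ?mulr0//; case: ifP => //.
by rewrite mulNr addrC -mulrBr pmulr_rgt0// subr_gt0 ltNge h.
Qed.

Lemma flat1_cvg c : 0 < c -> flat 1 (k.+1%:R * c) @[k --> \oo] --> (1 : R).
Proof.
move=> c0.
have -> : (fun k : nat => flat 1 (k.+1%:R * c)) =
    (fun k : nat => expR (- (c^-1 * harmonic k))).
  apply/funext => k; rewrite flat1E pmulr_rgt0 ?ltr0n// c0 /harmonic.
  by rewrite invfM mulrC.
rewrite -[X in _ --> X]expR0; apply: continuous_cvg; first exact: continuous_expR.
rewrite -oppr0; apply: cvgN; rewrite -(mulr0 c^-1); apply: cvgMr.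
exact: cvg_harmonic.
Qed.

Lemma bump1_cvg a b t : a < t < b -> bump1 k a b t @[k --> \oo] --> (1 : R).
Proof.
move=> /andP[h1 h2]; rewrite -[X in _ --> X]mulr1; apply: cvgM.
  under eq_fun do rewrite -mulrBr.
  by apply: flat1_cvg; rewrite subr_gt0.
under eq_fun do rewrite mulNr addrC -mulrBr.
by apply: flat1_cvg; rewrite subr_gt0.
Qed.

End SmoothLine.

Section SmoothSpace.
Context {R : realType} {d : nat}.
Implicit Types (f g h : 'rV[R]_d.+1 -> R).

(** The coinduction principle corresponding to the definition of [smooth1]. *)
Lemma smooth_coind (K : set ('rV[R]_d.+1 -> R)) f : K f ->
  (forall h, K h -> continuous (h : 'rV[R]_d.+1 -> R^o) /\ forall i,
     (forall x, derivable (h : 'rV[R]_d.+1 -> R^o) x (delta_mx 0 i)) /\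
     K (partial i h)) ->
  smooth f.
Proof.
move=> Kf H a; suff : K (pderiv a f).
  by move=> /H[c Hi]; split=> // i; have [] := Hi i.
by elim: a => //= i a IH; have [_ Hi] := H _ IH; have [] := Hi i.
Qed.

Lemma smooth_partial f i : smooth f -> smooth (partial i f).
Proof. by move=> sf a; have := sf (rcons a i); rewrite /pderiv foldr_rcons. Qed.

Lemma smooth_pderiv f a : smooth f -> smooth (pderiv a f).
Proof. by elim: a => [//|i a IH] sf; apply: smooth_partial; apply: IH. Qed.

Lemma smooth_continuous f : smooth f -> continuous f.
Proof. by move=> sf; have [] := sf [::]. Qed.

Lemma smooth_derivable f i x : smooth f -> derivable (f : 'rV[R]_d.+1 -> R^o) x (delta_mx 0 i).
Proof. by move=> sf; have [_] := sf [::]; apply. Qed.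

Lemma partial_lin (a b : R) f g i x :
  derivable (f : 'rV[R]_d.+1 -> R^o) x (delta_mx 0 i) ->
  derivable (g : 'rV[R]_d.+1 -> R^o) x (delta_mx 0 i) ->
  derivable (fun y => a * f y + b * g y : R^o) x (delta_mx 0 i) /\
  partial i (fun y => a * f y + b * g y) x = a * partial i f x + b * partial i g x.
Proof.
move=> df dg.
have da := @derivableZ _ _ _ (f : 'rV[R]_d.+1 -> R^o) a _ _ df.
have db := @derivableZ _ _ _ (g : 'rV[R]_d.+1 -> R^o) b _ _ dg.
split; first exact: (derivableD da db).
by rewrite /partial; have := deriveD da db; rewrite !deriveZ.
Qed.

Lemma smooth_lin (a b : R) f g : smooth f -> smooth g ->
  smooth (fun x => a * f x + b * g x).
Proof.
move=> sf sg.
apply: (@smooth_coind [set h | exists u v, [/\ smooth u, smooth v &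
    h = fun x => a * u x + b * v x]]); first by exists f, g.
move=> _ [u [v [su sv ->]]]; split.
  have cu := smooth_continuous su; have cv := smooth_continuous sv.
  move=> x; have Hu : {for x, continuous (fun y => a * u y)}.
    by apply: continuousM; [exact: cst_continuous|exact: cu].
  have Hv : {for x, continuous (fun y => b * v y)}.
    by apply: continuousM; [exact: cst_continuous|exact: cv].
  exact: (continuousD Hu Hv).
move=> i; have H x := partial_lin a b (smooth_derivable (i := i) (x := x) su) (smooth_derivable sv).
split; first by move=> x; have [] := H x.
exists (partial i u), (partial i v); split; try exact: smooth_partial.
by apply/funext => x; have [] := H x.
Qed.

Lemma partialM f g i x : smooth f -> smooth g ->
  derivable (fun y => f y * g y : R^o) x (delta_mx 0 i) /\
  partial i (fun y => f y * g y) x = f x * partial i g x + g x * partial i f x.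
Proof.
move=> sf sg; have df := smooth_derivable (i := i) (x := x) sf.
have dg := smooth_derivable (i := i) (x := x) sg.
split; first exact: (derivableM df dg).
by rewrite /partial; have := deriveM df dg.
Qed.

Lemma smoothM f g : smooth f -> smooth g -> smooth (fun x => f x * g x).
Proof.
move=> sf sg.
apply: (@smooth_coind [set h | exists s : seq (('rV[R]_d.+1 -> R) * ('rV[R]_d.+1 -> R)),
   (forall u, List.In u s -> smooth u.1 /\ smooth u.2) /\
   h = fun x => \sum_(u <- s) u.1 x * u.2 x]).
  exists [:: (f, g)]; split; last by apply/funext => x; rewrite big_seq1.
  by move=> u [<-|[]].
move=> _ [s [Hs ->]].
suff H : forall i, exists s' : seq (('rV[R]_d.+1 -> R) * ('rV[R]_d.+1 -> R)),
   (forall u, List.In u s' -> smooth u.1 /\ smooth u.2) /\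
   (forall x, derivable (fun x => \sum_(u <- s) u.1 x * u.2 x : R^o) x (delta_mx 0 i)) /\
   partial i (fun x => \sum_(u <- s) u.1 x * u.2 x) =
     fun x => \sum_(u <- s') u.1 x * u.2 x.
  split; last by move=> i; have [s' [h1 [h2 h3]]] := H i; split=> //; exists s'.
  elim: s Hs {H} => [|u s IH] Hs x.
    have -> : (fun x => \sum_(u <- [::]) u.1 x * u.2 x) = (fun=> 0) :> ('rV[R]_d.+1 -> R).
      by apply/funext => y; rewrite big_nil.
    exact: (@cst_continuous _ _ (0 : R)).
  have -> : (fun x => \sum_(v <- u :: s) v.1 x * v.2 x) =
      (fun x => u.1 x * u.2 x + \sum_(v <- s) v.1 x * v.2 x).
    by apply/funext => y; rewrite big_cons.
  have [s1 s2] := Hs u (or_introl erefl).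
  have c1 : {for x, continuous (fun x => u.1 x * u.2 x)}.
    by apply: continuousM; [exact: smooth_continuous s1 x|exact: smooth_continuous s2 x].
  have c2 := IH (fun v vs => Hs v (or_intror vs)) x.
  exact: (continuousD c1 c2).
move=> i; elim: s Hs => [|u s IH] Hs.
  exists [::]; split=> //.
  have -> : (fun x => \sum_(u <- [::]) u.1 x * u.2 x) = (fun=> 0) :> ('rV[R]_d.+1 -> R).
    by apply/funext => y; rewrite big_nil.
  split; first by move=> x; exact: derivable_cst.
  by apply/funext => x; rewrite /partial; exact: derive_cst.
have [|s' [Hs' [D P]]] := IH; first by move=> v vs; apply: Hs; right.
have [s1 s2] := Hs u (or_introl erefl).
exists [:: (u.1, partial i u.2), (u.2, partial i u.1) & s']; split.
  move=> v [e|[e|vs]]; last exact: Hs' vs.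
    by rewrite -e; exact: (conj s1 (smooth_partial i s2)).
  by rewrite -e; exact: (conj s2 (smooth_partial i s1)).
have E : (fun x => \sum_(v <- u :: s) v.1 x * v.2 x) =
    (fun x => 1 * (u.1 x * u.2 x) + 1 * \sum_(v <- s) v.1 x * v.2 x).
  by apply/funext => y; rewrite big_cons !mul1r.
have H x := partial_lin 1 1 (@partialM u.1 u.2 i x s1 s2).1 (D x).
rewrite E; split; first by move=> x; have [] := H x.
apply/funext => x; have [_ ->] := H x; rewrite !big_cons /= addrA !mul1r.
by have [_ ->] := @partialM u.1 u.2 i x s1 s2; rewrite P.
Qed.

(** Monomials and the bumps on boxes have this form, for which derivatives are
    computed factor by factor and visibly commute. *)
Definition tensor (F : 'I_d.+1 -> R -> R) : 'rV[R]_d.+1 -> R :=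
  fun x => \prod_i F i (x 0 i).

Lemma continuous_prod_seq (I : Type) (s : seq I) (F : I -> 'rV[R]_d.+1 -> R) :
  (forall i, continuous (F i)) -> continuous (fun x => \prod_(i <- s) F i x).
Proof.
move=> cF x; elim: s => [|i s IH].
  have -> : (fun x => \prod_(i <- [::]) F i x) = (fun=> 1) :> ('rV[R]_d.+1 -> R).
    by apply/funext => y; rewrite big_nil.
  exact: (@cst_continuous _ _ (1 : R)).
have -> : (fun x => \prod_(j <- i :: s) F j x) = (fun x => F i x * \prod_(j <- s) F j x).
  by apply/funext => y; rewrite big_cons.
by apply: continuousM; [exact: cF|].
Qed.

Lemma tensor_partial (F : 'I_d.+1 -> R -> R) i (F' : R -> R) :
  (forall t : R, is_derive t (1 : R) (F i) (F' t)) ->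
  (forall x, derivable (tensor F : 'rV[R]_d.+1 -> R^o) x (delta_mx 0 i)) /\
  partial i (tensor F) = tensor (fun j => if j == i then F' else F j).
Proof.
move=> dF.
have H x : is_derive 0 (1 : R) (fun s : R => tensor F (x + s *: delta_mx 0 i) : R^o)
    (tensor (fun j => if j == i then F' else F j) x).
  have -> : (fun s : R => tensor F (x + s *: delta_mx 0 i) : R^o) =
      (fun s => (\prod_(j | j != i) F j (x 0 j)) *: F i (1 * s + x 0 i)).
    apply/funext => s; rewrite /tensor (bigD1 i)//= !mxE !eqxx mulr1 mul1r mulrC.
    rewrite (addrC (x 0 i)); congr (_ * _); apply: eq_bigr => j ji.
    by rewrite !mxE (negbTE ji) andbF mulr0 addr0.
  have -> : tensor (fun j => if j == i then F' else F j) x =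
      (\prod_(j | j != i) F j (x 0 j)) *: F' (x 0 i).
    rewrite /tensor (bigD1 i)//= eqxx mulrC; congr (_ * _).
    by apply: eq_bigr => j /negbTE ->.
  apply: is_deriveZ.
  have d1 : is_derive (0 : R) (1 : R) (fun s : R => 1 * s + x 0 i) 1.
    have := is_derive_poly (1 *: 'X + (x 0 i)%:P) (0 : R).
    have -> : horner (1 *: 'X + (x 0 i)%:P) = (fun s => 1 * s + x 0 i).
      by apply/funext => y; rewrite !hornerE.
    by rewrite derivD derivZ derivX derivC addr0 scale1r hornerC.
  have := @is_derive1_comp _ (F i) (fun s : R => 1 * s + x 0 i) 0 _ _ (dF _) d1.
  by rewrite mulr1 mulr0 add0r.
split=> [x|]; first by have [dd _] := H x; have [] := derivable_line dd.
apply/funext => x; have [dd v] := H x; have [_ e] := derivable_line dd.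
by rewrite /partial e v.
Qed.

Lemma smooth_tensor F : (forall i, smooth1 (F i)) -> smooth (tensor F).
Proof.
move=> sF.
apply: (@smooth_coind [set h | exists2 G, (forall i, smooth1 (G i)) & h = tensor G]).
  by exists F.
move=> _ [G sG ->]; split.
  apply: continuous_prod_seq => i x; apply: continuous_comp; first exact: coord_continuous.
  exact: smooth1_continuous.
move=> i; have [G' sG' dG] := smooth1_derive (sG i).
have [dT ->] := tensor_partial dG; split=> //.
by exists (fun j => if j == i then G' else G j) => // j; case: ifP.
Qed.

Lemma partial_coord i x : smooth (fun x : 'rV[R]_d.+1 => x 0 i) /\
  partial i (fun x : 'rV[R]_d.+1 => x 0 i) x = 1.
Proof.
have H y : is_derive (0 : R) (1 : R) (fun s : R => (y + s *: delta_mx 0 i : 'rV[R]_d.+1) 0 i : R^o) 1.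
  have := is_derive_poly ('X + (y 0 i)%:P) (0 : R).
  rewrite derivD derivX derivC addr0 hornerC.
  have -> // : horner ('X + (y 0 i)%:P) = (fun s : R => (y + s *: delta_mx 0 i) 0 i).
  by apply/funext => s; rewrite !hornerE !mxE !eqxx mulr1 addrC.
have P y : derivable (fun x : 'rV[R]_d.+1 => x 0 i : R^o) y (delta_mx 0 i) /\
    partial i (fun x : 'rV[R]_d.+1 => x 0 i) y = 1.
  have [dd v] := H y.
  by have [h1 h2] := @derivable_line _ _ (fun x : 'rV[R]_d.+1 => x 0 i) y _ dd;
     split=> //; rewrite /partial h2 v.
split; last by have [] := P x.
have -> : (fun x : 'rV[R]_d.+1 => x 0 i) =
    tensor (fun j => if j == i then horner 'X else horner 1).
  apply/funext => y; rewrite /tensor (bigD1 i)//= eqxx hornerX big1 ?mulr1// => j /negbTE ->.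
  by rewrite hornerC.
by apply: smooth_tensor => j; case: ifP => _; exact: smooth1_poly.
Qed.

Lemma smooth_cst (c : R) : smooth (fun _ : 'rV[R]_d.+1 => c).
Proof.
have -> : (fun _ : 'rV[R]_d.+1 => c) = (fun x => c * tensor (fun=> horner 1) x + 0 * tensor (fun=> horner 1) x).
  apply/funext => x; rewrite /tensor big1 ?mulr1 ?mul0r ?addr0// => i _.
  by rewrite hornerC.
by apply: smooth_lin; apply: smooth_tensor => i; exact: smooth1_poly.
Qed.

Lemma smooth_sum (I : Type) (s : seq I) (c : I -> R) (F : I -> 'rV[R]_d.+1 -> R) :
  (forall i, smooth (F i)) -> smooth (fun x => \sum_(i <- s) c i * F i x).
Proof.
move=> sF; elim: s => [|i s IH].
  have -> : (fun x => \sum_(i <- [::]) c i * F i x) = (fun=> 0).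
    by apply/funext => x; rewrite big_nil.
  exact: smooth_cst.
have -> : (fun x => \sum_(i <- i :: s) c i * F i x) =
   (fun x => c i * F i x + 1 * \sum_(i <- s) c i * F i x).
  by apply/funext => x; rewrite big_cons mul1r.
exact: smooth_lin.
Qed.

Lemma smooth_polynomial (p : 'rV[R]_d.+1 -> R) : is_polynomial p -> smooth p.
Proof.
move=> [N [c pE]].
have -> : p = (fun x => \sum_(a : {ffun 'I_d.+1 -> 'I_N}) c a * tensor (fun i => horner 'X^(a i)) x).
  apply/funext => x; rewrite pE; apply: eq_bigr => a _; congr (_ * _).
  by apply: eq_bigr => i _; rewrite hornerXn.
by apply: smooth_sum => a; apply: smooth_tensor => i; exact: smooth1_poly.
Qed.

Definition box_bump (k : nat) (a b : 'rV[R]_d.+1) : 'rV[R]_d.+1 -> R :=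
  tensor (fun i => bump1 k (a 0 i) (b 0 i)).

Lemma box_bump_itv k a b x : 0 <= box_bump k a b x <= 1.
Proof.
rewrite /box_bump /tensor; apply/andP; split.
  by apply: prodr_ge0 => i _; have /andP[] := bump1_itv k (a 0 i) (b 0 i) (x 0 i).
by apply: prodr_ile1 => i _; exact: bump1_itv.
Qed.

Lemma box_bump_out k a b x : ~ obox a b x -> box_bump k a b x = 0.
Proof.
move=> Hx; have [i Hi] : exists i, ~~ (a 0 i < x 0 i < b 0 i).
  by apply: contrapT => H; apply: Hx => i; apply/negP => /negP Hi; apply: H; exists i.
by rewrite /box_bump /tensor (bigD1 i)//= bump1_out ?mul0r.
Qed.

Lemma box_bump_cvg a b x : obox a b x -> box_bump k a b x @[k --> \oo] --> (1 : R).
Proof.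
move=> Hx; rewrite /box_bump /tensor.
suff : forall s : seq 'I_d.+1,
    (\prod_(i <- s) bump1 k (a 0 i) (b 0 i) (x 0 i)) @[k --> \oo] --> (1 : R).
  exact.
elim=> [|i s IH].
  by under eq_fun do rewrite big_nil; exact: cvg_cst.
under eq_fun do rewrite big_cons.
have H := cvgM (bump1_cvg (Hx i)) IH; rewrite mulr1 in H; exact: H.
Qed.

Lemma smooth_box_bump k a b : smooth (box_bump k a b).
Proof. by apply: smooth_tensor => i; exact: smooth1_bump1. Qed.

Lemma test_fun_box_bump G k a b : cbox a b `<=` G -> test_fun G (box_bump k a b).
Proof.
move=> sG; split; first exact: smooth_box_bump.
exists (cbox a b); split=> //; first exact: cbox_compact.
by move=> x Hx; apply: box_bump_out => /sub_obox_cbox.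
Qed.

Lemma box_bump_partialC k a b i j : i != j ->
  partial i (partial j (box_bump k a b)) = partial j (partial i (box_bump k a b)).
Proof.
move=> ij.
have [Fi _ dFi] := smooth1_derive (smooth1_bump1 k (a 0 i) (b 0 i)).
have [Fj _ dFj] := smooth1_derive (smooth1_bump1 k (a 0 j) (b 0 j)).
pose F l := bump1 k (a 0 l) (b 0 l).
have [_ ei] := @tensor_partial F i Fi dFi.
have [_ ej] := @tensor_partial F j Fj dFj.
have [|_ eij] := @tensor_partial (fun l => if l == j then Fj else F l) i Fi.
  by rewrite (negbTE ij).
have [|_ eji] := @tensor_partial (fun l => if l == i then Fi else F l) j Fj.
  by rewrite eq_sym (negbTE ij).
apply: etrans (congr1 (partial i) ej) _; apply: etrans eij _.
apply: esym; apply: etrans (congr1 (partial j) ei) _; apply: etrans eji _.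
congr tensor; apply/funext => l.
by case: (eqVneq l i) => [->|//]; rewrite (negbTE ij).
Qed.

End SmoothSpace.
(** * Weak derivatives *)

Section FundamentalLemma.
Context {R : realType} {n : nat} {E : euclid R n.+1}.
Hypothesis LL : lebesgue_like E.
Implicit Types (G : set 'rV[R]_n.+1) (f g : 'rV[R]_n.+1 -> R).

Lemma mdom_open G : open G -> mdom E G.
Proof. by move=> oG; apply: mset_open_coord => //; exact: ll_coord LL. Qed.

Lemma mdom_obox (a b : 'rV[R]_n.+1) : mdom E (obox a b).
Proof. by apply: mset_obox_coord; exact: ll_coord LL. Qed.

Lemma mdomI G G' : mdom E G -> mdom E G' -> mdom E (G `&` G').
Proof. by move=> mG mG'; rewrite /mdom preimage_setI; apply: measurableI. Qed.

Lemma mdomD G G' : mdom E G -> mdom E G' -> mdom E (G `\` G').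
Proof. by move=> mG mG'; rewrite /mdom setDE preimage_setI preimage_setC -setDE; apply: measurableD. Qed.

Lemma mdomT : mdom E setT.
Proof. by rewrite /mdom preimage_setT. Qed.

Lemma mdom_closed G : closed G -> mdom E G.
Proof.
by move=> cG; rewrite -[G]setCK -setTD; apply: mdomD; [exact: mdomT|
  apply: mdom_open; exact: closed_openC].
Qed.

Lemma continuous_measurable_on G f : continuous f -> mdom E G -> meas_on E G f.
Proof.
move=> cf mG; have := continuous_measurable_coord (ll_coord LL) cf.
by apply: measurable_funS.
Qed.

Definition cube_bounded G : Prop := exists M : R, G `<=` cubeR M.

Lemma cube_bounded_fin G : mdom E G -> cube_bounded G ->
  (emu E (@ept _ _ E @^-1` G) < +oo)%E.
Proof.
move=> mG [M GM]; apply: le_lt_trans (ll_cube LL M).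
by apply: le_measure; rewrite ?inE//; [exact: mdom_obox|move=> p; apply: GM].
Qed.

Lemma continuous_cbox_bounded f (M : R) : continuous f ->
  exists2 C, 0 <= C & forall x, cubeR M x -> `|f x| <= C.
Proof.
move=> cf.
have : bounded_set (f @` cbox (const_mx (- M)) (const_mx M)).
  apply: compact_bounded; apply: continuous_compact; last exact: cbox_compact.
  exact: continuous_subspaceT.
move=> [N [Nr HN]]; exists (`|N| + 1); first by rewrite addr_ge0.
move=> x Hx; apply: HN; first by rewrite ltr_pwDr// ler_norm.
by exists x => //; apply: sub_obox_cbox.
Qed.

Lemma L2_bounded G f (C : R) : mdom E G -> cube_bounded G -> meas_on E G f ->
  (forall x, G x -> `|f x| <= C) -> L2 E G f.
Proof.
move=> mG bG mf fC; split=> //; rewrite /eint.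
apply: le_lt_trans (_ : (_ <= \int[emu E]_(p in @ept _ _ E @^-1` G) (C ^+ 2)%:E)%E) _.
  apply: ge0_le_integral => //.
  - by move=> p _; rewrite lee_fin sqr_ge0.
  - by apply/measurable_EFinP; exact: measurable_funX.
  - by move=> p Gp; rewrite lee_fin -(real_normK (num_real _)) ler_sqr ?nnegrE//;
      [exact: fC|exact: le_trans (fC _ Gp)].
rewrite integral_cst//; have := cube_bounded_fin mG bG.
have := measure_ge0 (emu E) (@ept _ _ E @^-1` G).
by rewrite muleC => *; apply: lty_mul_fin.
Qed.

Lemma L2_continuous G f : mdom E G -> cube_bounded G -> continuous f -> L2 E G f.
Proof.
move=> mG [M GM] cf; have [C C0 HC] := continuous_cbox_bounded M cf.
apply: (@L2_bounded _ _ C) => //; [by exists M|exact: continuous_measurable_on|].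
by move=> x /GM; apply: HC.
Qed.

Lemma sqi_continuous G f : mdom E G -> cube_bounded G -> continuous f -> sqi E G f.
Proof. by move=> mG bG cf; apply: L2_sqi => //; apply: L2_continuous. Qed.

Lemma compact_cube (K : set 'rV[R]_n.+1) : compact K -> cube_bounded K.
Proof.
move=> cK; have [M [Mr HM]] := compact_bounded cK; exists (`|M| + 2).
move=> x /(HM (`|M| + 1)) H i; rewrite !mxE -ltr_norml.
have Hx : `|x| <= `|M| + 1 by apply: H; rewrite ltr_pwDr// ler_norm.
apply: le_lt_trans (_ : _ <= `|x|) _; last by apply: le_lt_trans Hx _; lra.
rewrite /Num.norm /= mx_normrE.
by apply: (le_bigmax _ (fun ij : 'I_1 * 'I_n.+1 => `|x ij.1 ij.2|) (0, i)).
Qed.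

(** A test function is square-integrable even on an unbounded domain. *)
Lemma sqi_test G phi : mdom E G -> test_fun G phi -> sqi E G phi.
Proof.
move=> mG [sphi [K [cK KG phi0]]].
have [M KM] := compact_cube cK.
have mI : mdom E (G `&` cubeR M) by apply: mdomI => //; exact: mdom_obox.
have : sqi E (G `&` cubeR M) phi.
  apply: sqi_continuous => //; last exact: smooth_continuous.
  by exists M => x [].
move=> sI; apply: sqi_ae (sqi_restrict mI mG sI).
apply: ae_onT => x Gx; case: asboolP => // nx; rewrite phi0// => /KM Mx.
by apply: nx.
Qed.

(** The bumps tend boundedly to the indicators of the boxes, so that the integral of [f]
    over every box vanishes; boxes generate the Borel sets. *)
Lemma ae_zero_box (a b : 'rV[R]_n.+1) f :
  sqi E (obox a b) f ->
  (forall a' b' k, cbox a' b' `<=` cbox a b ->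
     rint E (obox a b) (fun x => f x * box_bump k a' b' x) = 0) ->
  ae_on E (obox a b) (fun x => f x = 0).
Proof.
move=> sf H; pose B := obox a b; pose pB := @ept _ _ E @^-1` B.
have mB : mdom E B by exact: mdom_obox.
have bB : cube_bounded B.
  exists (\sum_i (`|a 0 i| + `|b 0 i|)) => x Hx i; rewrite !mxE -ltr_norml.
  apply: lt_le_trans (_ : `|a 0 i| + `|b 0 i| <= _); last first.
    by rewrite (bigD1 i)//= lerDl; apply: sumr_ge0 => j _; rewrite addr_ge0.
  have /andP[h1 h2] := Hx i; rewrite ltr_norml; apply/andP; split.
    have := ler_norm (- a 0 i); have := normr_ge0 (b 0 i); rewrite normrN; lra.
  have := ler_norm (b 0 i); have := normr_ge0 (a 0 i); lra.
have s1 : sqi E B (fun=> 1) by apply: sqi_continuous => //; exact: cst_continuous.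
have [h ih fh] : intg E B f.
  by have := sqi_intgM mB sf s1; apply: intg_ae; apply: ae_onT => x _; rewrite mulr1.
have mh : measurable_fun pB h by apply/measurable_EFinP; exact: measurable_int ih.
(* by dominated convergence, the integral of f over every box vanishes *)
have Hbox a' b' : (\int[emu E]_(p in @ept _ _ E @^-1` obox a' b' `&` pB) (h p)%:E = 0)%E.
  pose a2 : 'rV[R]_n.+1 := \row_i Num.max (a' 0 i) (a 0 i).
  pose b2 : 'rV[R]_n.+1 := \row_i Num.min (b' 0 i) (b 0 i).
  have -> : @ept _ _ E @^-1` obox a' b' `&` pB = @ept _ _ E @^-1` obox a2 b2 `&` pB.
    apply/seteqP; split => p [h1 h2]; split=> // i.
      have /andP[u1 u2] := h1 i; have /andP[v1 v2] := h2 i.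
      by rewrite !mxE gt_max lt_min u1 u2 v1 v2.
    have := h1 i; rewrite !mxE gt_max lt_min.
    by move=> /andP[/andP[-> _] /andP[-> _]].
  have sub2 : cbox a2 b2 `<=` cbox a b.
    move=> x Hx i; have := Hx i; rewrite !mxE ge_max le_min.
    by move=> /andP[/andP[_ ->] /andP[_ ->]].
  have [] := @dominated_convergence _ _ _ (emu E) pB mB
     (fun k p => (h p * box_bump k a2 b2 (ept p))%:E)
     (fun p => (h p * \1_(@ept _ _ E @^-1` obox a2 b2) p)%:E) (fun p => `|h p|%:E).
  - move=> k; apply/measurable_EFinP; apply: measurable_funM => //.
    apply: measurable_funS (continuous_measurable_coord (ll_coord LL)
      (smooth_continuous (smooth_box_bump k a2 b2))) => //.
  - apply/measurable_EFinP; apply: measurable_funM => //.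
    by apply: measurable_indic; exact: mdom_obox.
  - apply: aeW => p _; apply: cvg_EFin; first by apply: nearW.
    apply: cvgMr; rewrite indicE.
    have [Hp|Hp] := pselect (obox a2 b2 (ept p)).
      by rewrite mem_set//; exact: box_bump_cvg.
    rewrite memNset// (_ : (fun k => _) = (fun=> 0)); first exact: cvg_cst.
    by apply/funext => k; rewrite box_bump_out.
  - exact: integrable_norm.
  - apply: aeW => p k _; rewrite lee_fin normrM.
    have /andP[h1 h2] := box_bump_itv k a2 b2 (ept p).
    by rewrite [X in _ * X]ger0_norm// ler_piMr.
  move=> _ _; set I := (X in _ --> X) => Hcvg.
  have -> : (\int[emu E]_(p in @ept _ _ E @^-1` obox a2 b2 `&` pB) (h p)%:E)%E = I.
    rewrite setIC integral_mkcondr /I; apply: eq_integral => p _.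
    by rewrite patchE indicE; case: ifP; rewrite ?mulr1 ?mulr0.
  suff e0 k : (\int[emu E]_(p in pB) (h p * box_bump k a2 b2 (ept p))%:E = 0)%E.
    move: Hcvg; under eq_fun do rewrite e0.
    by move=> /cvg_lim <-//; rewrite lim_cst.
  have := H a2 b2 k sub2.
  rewrite (@rint_intg _ _ _ _ _ (fun p => h p * box_bump k a2 b2 (ept p))); last first.
    by apply: (ae1 fh) => p e Bp; rewrite e.
  rewrite /Rintegral => e0; rewrite -[LHS]fineK ?e0//.
  apply: integrable_fin_num => //.
  apply: (le_integrable mB _ _ ih).
    apply/measurable_EFinP; apply: measurable_funM => //.
    apply: measurable_funS (continuous_measurable_coord (ll_coord LL)
      (smooth_continuous (smooth_box_bump k a2 b2))) => //.
  move=> p _ /=; rewrite lee_fin normrM.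
  have /andP[h1 h2] := box_bump_itv k a2 b2 (ept p).
  by rewrite [X in _ * X]ger0_norm// ler_piMr.
(* boxes are stable under intersection, so the sets over which the integral vanishes,
   a Dynkin class, comprise all measurable ones *)
pose Bx := [set A | exists a' b', A = @ept _ _ E @^-1` obox a' b'].
pose S := [set A | measurable A /\ (\int[emu E]_(p in A `&` pB) (h p)%:E = 0)%E].
have HB : (\int[emu E]_(p in pB) (h p)%:E = 0)%E.
  by have := Hbox a b; rewrite setIid.
have iS A : measurable A -> (emu E).-integrable (A `&` pB) (EFin \o h).
  by move=> mA; apply: integrableS ih => //; exact: measurableI.
have dS : dynkin S.
  split.
  - by split=> //; rewrite setTI.
  - move=> A [mA A0]; split; first exact: measurableC.
    have := @integral_setU _ _ _ (emu E) (A `&` pB) (~` A `&` pB) (EFin \o h).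
    rewrite -setIUl setUCr setTI HB A0 add0e => <- //.
    + exact: measurableI.
    + by apply: measurableI => //; exact: measurableC.
    + exact: measurable_int ih.
    + apply/eqP/seteqP; split=> // p [[Ap _] [nAp _]]; exact: nAp.
  - move=> F tF SF; split; first by apply: bigcup_measurable => k _; have [] := SF k.
    rewrite setI_bigcupl integral_bigcup//.
    + by rewrite eseries0// => k _ _; have [_ ->] := SF k.
    + by apply: trivIset_setIr.
    + by move=> k; apply: measurableI => //; have [] := SF k.
    + apply: integrableS ih => //; last by move=> p [k _ []].
      by apply: bigcup_measurable => k _; apply: measurableI => //; have [] := SF k.
have BS A : measurable A -> (\int[emu E]_(p in A `&` pB) (h p)%:E = 0)%E.
  move=> mA; suff : S A by case.
  have : <<s Bx >> A.
    apply: (ll_gen LL (S := <<s Bx >>) (smallest_sigma_algebra _ _) _ mA).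
    by move=> a' b'; apply: sub_sigma_algebra; exists a', b'.
  rewrite -setI_closed_g_dynkin_g_sigma_algebra; last first.
    move=> _ _ [a1 [b1 ->]] [a2 [b2 ->]]; rewrite -preimage_setI oboxI.
    by eexists; eexists; reflexivity.
  apply; split=> // _ [a1 [b1 ->]]; split; first exact: mdom_obox.
  exact: Hbox.
have Hae : ae_eq (emu E) pB (EFin \o h) (cst 0%E).
  apply: integral_ae_eq => // A AB mA; rewrite integral0.
  by have := BS A mA; rewrite setIidl.
by apply: (ae2 fh Hae) => p e1 e2 Bp; rewrite e1//; have [] := e2 Bp.
Qed.

(** The fundamental lemma of the calculus of variations: localised to the countably
    many rational boxes inside [G], it follows from the case of a box. *)
Lemma ae_zero G f : open G -> sqi E G f ->
  (forall a b k, cbox a b `<=` G ->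
     rint E G (fun x => f x * box_bump k a b x) = 0) ->
  ae_on E G (fun x => f x = 0).
Proof.
move=> oG sf H.
have Hq (q : 'rV[rat]_n.+1 * 'rV[rat]_n.+1) : cbox (rat_vec q.1) (rat_vec q.2) `<=` G ->
    ae_on E (obox (rat_vec q.1) (rat_vec q.2)) (fun x => f x = 0).
  move=> qG.
  have oG' : obox (rat_vec q.1) (rat_vec q.2) `<=` G.
    exact: subset_trans (@sub_obox_cbox _ _ _ _) qG.
  apply: ae_zero_box; first by apply: sqi_sub sf => //; [exact: mdom_open|exact: mdom_obox].
  move=> a' b' k sub; rewrite -(H a' b' k); last exact: subset_trans qG.
  have [ab|nab] := pselect (obox a' b' `<=` obox (rat_vec q.1) (rat_vec q.2)).
    rewrite /rint; congr fine; rewrite integral_mkcond [RHS]integral_mkcond.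
    apply: eq_integral => p _; rewrite !patchE.
    have [Hp|Hp] := pselect (obox (rat_vec q.1) (rat_vec q.2) (ept p)).
      by rewrite !mem_set//=; exact: oG'.
    rewrite memNset//; case: ifP => // _.
    by rewrite box_bump_out ?mulr0// => /ab.
  exfalso; apply: nab => x Hx i.
  (* a nonempty open box whose closure lies in a closed box lies inside its interior *)
  have /andP[h1 h2] := Hx i.
  have ca : cbox (rat_vec q.1) (rat_vec q.2) (\row_j if j == i then a' 0 i else x 0 j).
    apply: sub => j; rewrite mxE; case: eqP => [->|_]; first by rewrite lexx ltW// (lt_trans h1).
    by have /andP[? ?] := Hx j; rewrite !ltW.
  have cb : cbox (rat_vec q.1) (rat_vec q.2) (\row_j if j == i then b' 0 i else x 0 j).
    apply: sub => j; rewrite mxE; case: eqP => [->|_]; first by rewrite lexx ltW// (lt_trans h1).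
    by have /andP[? ?] := Hx j; rewrite !ltW.
  have := ca i; have := cb i; rewrite !mxE eqxx => /andP[_ u] /andP[v _].
  by rewrite (le_lt_trans v h1) (lt_le_trans h2 u).
pose Q k (p : esort E) := if @unpickle ('rV[rat]_n.+1 * 'rV[rat]_n.+1)%type k is Some q then
  (cbox (rat_vec q.1) (rat_vec q.2) `<=` G -> obox (rat_vec q.1) (rat_vec q.2) (ept p) -> f (ept p) = 0)
  else True.
have HQ k : {ae emu E, forall p, Q k p}.
  rewrite /Q; case: unpickle => [q|]; last exact: aeW.
  have [sub|nsub] := pselect (cbox (rat_vec q.1) (rat_vec q.2) `<=` G).
    by apply: (ae1 (Hq q sub)) => p Hp _.
  by apply: aeW.
apply: (ae1 (ae_foralln HQ)) => p Hp Gp.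
have [a [b [h1 h2]]] := open_rat_box oG Gp.
by have := Hp (pickle (a, b)); rewrite /Q pickleK; apply.
Qed.

Lemma rint_supp G G' f : G' `<=` G -> (forall x, G x -> ~ G' x -> f x = 0) ->
  rint E G f = rint E G' f.
Proof.
move=> sG f0; rewrite /rint; congr fine; rewrite integral_mkcond [RHS]integral_mkcond.
apply: eq_integral => p _; rewrite !patchE.
have [Hp|Hp] := pselect (G' (ept p)); first by rewrite !mem_set//=; exact: sG.
by rewrite [in RHS]memNset//; case: ifP => // /set_mem /= Gp; rewrite f0.
Qed.

Lemma partial_supp (K : set 'rV[R]_n.+1) f i : closed K ->
  (forall x, ~ K x -> f x = 0) -> forall x, ~ K x -> partial i f x = 0.
Proof.
move=> cK f0 x Kx; rewrite /partial.
have H : \forall y \near x, (f : 'rV[R]_n.+1 -> R^o) y = cst 0 y.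
  have : \forall y \near x, (~` K) y.
    by apply: open_nbhs_nbhs; split=> //; exact: closed_openC.
  by apply: filterS => y; exact: f0.
by rewrite (near_eq_derive _ H) ?derive_cst.
Qed.

(* From here on derivatives are only handled through the lemmas above; keeping them
   folded prevents unification from computing limits. *)
#[global] Opaque partial.

Lemma compact_closed_rV (K : set 'rV[R]_n.+1) : compact K -> closed K.
Proof. by apply: compact_closed; exact: norm_hausdorff. Qed.

Lemma test_fun_partial G phi i : test_fun G phi -> test_fun G (partial i phi).
Proof.
move=> [sphi [K [cK KG phi0]]]; split; first exact: smooth_partial.
exists K; split=> //; exact: partial_supp (compact_closed_rV cK) phi0.
Qed.

Lemma test_fun_pderiv G phi a : test_fun G phi -> test_fun G (pderiv a phi).
Proof. by elim: a => [//|i a IH] H; apply: test_fun_partial; exact: IH. Qed.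

Lemma test_fun_sub G G' phi : G' `<=` G -> test_fun G' phi -> test_fun G phi.
Proof.
by move=> sG [sphi [K [cK KG phi0]]]; split=> //; exists K; split=> //; exact: subset_trans sG.
Qed.

(** The product of [p] and [psi] vanishes off a compact set, hence the integral of its
    derivative vanishes; all integrals are taken over that compact set, on which
    everything is continuous and thus integrable. *)
Lemma rint_by_parts G p psi i : mdom E G -> smooth p -> test_fun G psi ->
  rint E G (fun x => p x * partial i psi x) = - rint E G (fun x => partial i p x * psi x).
Proof.
move=> mG sp tpsi; have [spsi [K [cK KG psi0]]] := tpsi.
have cK' := compact_closed_rV cK.
have mK : mdom E K by apply: mdom_closed.
have bK := compact_cube cK.
have cp := smooth_continuous sp; have cpsi := smooth_continuous spsi.
have cdp := smooth_continuous (smooth_partial i sp).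
have cdpsi := smooth_continuous (smooth_partial i spsi).
have I1 : intg E K (fun x => p x * partial i psi x).
  exact: (sqi_intgM mK (sqi_continuous mK bK cp) (sqi_continuous mK bK cdpsi)).
have I2 : intg E K (fun x => partial i p x * psi x).
  exact: (sqi_intgM mK (sqi_continuous mK bK cdp) (sqi_continuous mK bK cpsi)).
have dpsi0 := partial_supp i cK' psi0.
rewrite (rint_supp (G' := K))//; last by move=> x _ Kx; rewrite dpsi0 ?mulr0.
rewrite [X in _ = - X](rint_supp (G' := K))//; last by move=> x _ Kx; rewrite psi0 ?mulr0.
apply/eqP; rewrite -subr_eq0 opprK -rintD//; apply/eqP.
have [M KM] := bK.
have [H1 H2] : (forall x, derivable (fun y => p y * psi y : R^o) x (delta_mx 0 i)) /\
    partial i (fun y => p y * psi y) = (fun x => p x * partial i psi x + partial i p x * psi x).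
  split; first by move=> x; have [] := @partialM _ _ p psi i x sp spsi.
  by apply/funext => x; have [_ ->] := @partialM _ _ p psi i x sp spsi; rewrite (mulrC (psi x)).
have c1 : continuous (fun y => p y * psi y).
  by move=> x; apply: continuousM; [exact: cp|exact: cpsi].
have c2 : continuous (partial i (fun y => p y * psi y)).
  rewrite H2 => x.
  have u1 : {for x, continuous (fun y => p y * partial i psi y)}.
    by apply: continuousM; [exact: cp|exact: cdpsi].
  have u2 : {for x, continuous (fun y => partial i p y * psi y)}.
    by apply: continuousM; [exact: cdp|exact: cpsi].
  exact: (continuousD u1 u2).
have := ll_ibp LL c1 H1 c2 (M := M).
rewrite H2 (rint_supp (G' := K))//; first apply.
- by move=> x Mx; rewrite psi0 ?mulr0// => /KM.
- by move=> x _ Kx; rewrite dpsi0// psi0// !mulr0 addr0.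
Qed.

(** Moving the derivatives to [p] one by one reverses their order. *)
Lemma weak_deriv_smooth G p a : mdom E G -> smooth p ->
  weak_deriv E G a p (pderiv (rev a) p).
Proof.
move=> mG; elim: a p => [|i a IH] p sp phi tphi.
  by rewrite expr0 mul1r.
rewrite (rint_by_parts i mG sp (test_fun_pderiv a tphi)).
rewrite (IH _ (smooth_partial i sp) phi tphi) exprS mulN1r mulNr.
by rewrite rev_cons /pderiv foldr_rcons.
Qed.

Lemma sqi_L2 G f : meas_on E G f -> sqi E G f -> L2 E G f.
Proof.
move=> mf [h [mh /integrableP[_ ih]] fh]; split=> //.
apply: le_lt_trans ih; rewrite le_eqVlt; apply/orP; left; apply/eqP.
apply: integral_ae; apply: (ae1 fh) => p H; rewrite !patchE.
by case: ifPn => // /set_mem Gp; rewrite H//= ger0_norm// sqr_ge0.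
Qed.

Lemma L2_lin G (a b : R) f g : mdom E G -> L2 E G f -> L2 E G g ->
  L2 E G (fun x => a * f x + b * g x).
Proof.
move=> mG Lf Lg; apply: sqi_L2; last by apply: sqi_lin => //; exact: L2_sqi.
case: Lf => mf _; case: Lg => mg _.
by apply: measurable_funD; apply: measurable_funM.
Qed.

Lemma L2_0 G : L2 E G (fun=> 0).
Proof.
split; first exact: measurable_cst.
by rewrite /eint integral0_eq// => p _; rewrite expr0n.
Qed.

Section WeakDerivatives.
Variable G : set 'rV[R]_n.+1.
Hypothesis oG : open G.
Let mG : mdom E G := mdom_open oG.

Lemma weak_deriv_lin (a b : R) s u v g h :
  sqi E G u -> sqi E G v -> sqi E G g -> sqi E G h ->
  weak_deriv E G s u g -> weak_deriv E G s v h ->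
  weak_deriv E G s (fun x => a * u x + b * v x) (fun x => a * g x + b * h x).
Proof.
move=> su sv sg sh wu wv phi tphi.
have sp := sqi_test mG tphi.
have sd := sqi_test mG (test_fun_pderiv s tphi).
have := ip_linl a b mG su sv sd; rewrite /ip => ->.
have := ip_linl a b mG sg sh sp; rewrite /ip => ->.
by rewrite wu// wv//; ring.
Qed.

(** The difference of two weak derivatives is orthogonal to all test functions. *)
Lemma weak_deriv_unique s u g g' : sqi E G g -> sqi E G g' ->
  weak_deriv E G s u g -> weak_deriv E G s u g' -> ae_on E G (fun x => g x = g' x).
Proof.
move=> sg sg' wg wg'.
have : ae_on E G (fun x => 1 * g x + (-1) * g' x = 0).
  apply: ae_zero => //; first exact: sqi_lin.
  move=> a b k sub; have tb := test_fun_box_bump k sub.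
  have sb := sqi_test mG tb.
  have := ip_linl 1 (-1) mG sg sg' sb; rewrite /ip => ->.
  have := wg _ tb; rewrite (wg' _ tb) => /(congr1 (fun y => (-1) ^+ size s * y)).
  by rewrite !mulrA -expr2 sqrr_sign !mul1r => ->; rewrite mulN1r subrr.
by apply: ae_onS => x _ /eqP; rewrite mul1r mulN1r subr_eq0 => /eqP.
Qed.

Lemma wderivP s u : has_wderiv E G s u ->
  L2 E G (wderiv E G s u) /\ weak_deriv E G s u (wderiv E G s u).
Proof. by move=> H; have := xgetPex (fun=> 0) H. Qed.

Lemma wderiv_sqi s u : has_wderiv E G s u -> sqi E G (wderiv E G s u).
Proof. by move=> /wderivP[H _]; exact: L2_sqi. Qed.

Lemma wderiv_ae s u g : L2 E G g -> weak_deriv E G s u g ->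
  ae_on E G (fun x => wderiv E G s u x = g x).
Proof.
move=> Lg wg; have hw : has_wderiv E G s u by exists g.
have [L w] := wderivP hw.
by apply: weak_deriv_unique w wg; exact: L2_sqi.
Qed.

Lemma has_wderiv_lin (a b : R) s u v : sqi E G u -> sqi E G v ->
  has_wderiv E G s u -> has_wderiv E G s v ->
  has_wderiv E G s (fun x => a * u x + b * v x) /\
  ae_on E G (fun x => wderiv E G s (fun x => a * u x + b * v x) x =
                      a * wderiv E G s u x + b * wderiv E G s v x).
Proof.
move=> su sv hu hv; have [Lu wu] := wderivP hu; have [Lv wv] := wderivP hv.
have L := L2_lin a b mG Lu Lv.
have w : weak_deriv E G s (fun x => a * u x + b * v x)
    (fun x => a * wderiv E G s u x + b * wderiv E G s v x).
  by apply: weak_deriv_lin => //; exact: L2_sqi.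
by split; [eexists; split; [exact: L|exact: w]|exact: wderiv_ae].
Qed.

Lemma weak_deriv_ae s u u' g : ae_on E G (fun x => u x = u' x) ->
  weak_deriv E G s u g -> weak_deriv E G s u' g.
Proof.
move=> uu w phi tphi; rewrite -w//; apply: rint_ae.
by apply: ae_onS uu => x _ ->.
Qed.

Lemma weak_deriv0 s u : ae_on E G (fun x => u x = 0) -> weak_deriv E G s u (fun=> 0).
Proof.
move=> u0 phi tphi; rewrite rint0_ae; last by apply: ae_onS u0 => x _ ->; rewrite mul0r.
by rewrite rint0_ae ?mulr0//; apply: ae_onT => x _; rewrite mul0r.
Qed.

Lemma has_wderiv0 s u : ae_on E G (fun x => u x = 0) -> has_wderiv E G s u.
Proof. by move=> u0; exists (fun=> 0); split; [exact: L2_0|exact: weak_deriv0]. Qed.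

Lemma wderiv0_ae s u : ae_on E G (fun x => u x = 0) ->
  ae_on E G (fun x => wderiv E G s u x = 0).
Proof. by move=> u0; apply: wderiv_ae; [exact: L2_0|exact: weak_deriv0]. Qed.

Lemma weak_deriv_sub (G' : set 'rV[R]_n.+1) s u g : G' `<=` G ->
  weak_deriv E G s u g -> weak_deriv E G' s u g.
Proof.
move=> sG w phi tphi; have [_ [K [_ KG' p0]]] := test_fun_pderiv s tphi.
have [_ [K' [_ KG2 p1]]] := tphi.
have := w phi (test_fun_sub sG tphi).
rewrite (rint_supp sG); last by move=> x _ nG; rewrite p0 ?mulr0// => /KG'.
by rewrite (rint_supp sG)// => x _ nG; rewrite p1 ?mulr0// => /KG2.
Qed.

(** Functions that agree everywhere in [G] have the same class of weak derivatives, so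
    the choice operator selects the same representative; no null set is involved. *)
Lemma wderiv_eq s u u' : (forall x, G x -> u x = u' x) ->
  wderiv E G s u = wderiv E G s u'.
Proof.
move=> uu; rewrite /wderiv; congr xget; apply/seteqP; split=> g /= [Lg wg]; split=> //.
  by apply: weak_deriv_ae wg; apply: ae_onT.
by apply: weak_deriv_ae wg; apply: ae_onT => x Gx; rewrite uu.
Qed.

Lemma has_wderiv_eq s u u' : (forall x, G x -> u x = u' x) ->
  has_wderiv E G s u -> has_wderiv E G s u'.
Proof.
move=> uu [g [Lg wg]]; exists g; split=> //.
by apply: weak_deriv_ae wg; apply: ae_onT.
Qed.

Lemma L2_sub (G' : set 'rV[R]_n.+1) f : mdom E G' -> G' `<=` G -> L2 E G f -> L2 E G' f.
Proof.
move=> mG' sG Lf; apply: sqi_L2; last by apply: (sqi_sub mG) => //; exact: L2_sqi.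
by case: Lf => mf _; apply: measurable_funS mf => // p; apply: sG.
Qed.

Lemma has_wderiv_sub (G' : set 'rV[R]_n.+1) s u : open G' -> G' `<=` G ->
  has_wderiv E G s u -> has_wderiv E G' s u.
Proof.
move=> oG' sG [g [Lg wg]]; exists g; split; last exact: weak_deriv_sub wg.
by apply: L2_sub Lg => //; exact: mdom_open.
Qed.

End WeakDerivatives.

Lemma wderiv_sub G G' s u : open G -> open G' -> G' `<=` G -> has_wderiv E G s u ->
  ae_on E G' (fun x => wderiv E G' s u x = wderiv E G s u x).
Proof.
move=> oG oG' sG hu; have [Lu wu] := wderivP hu.
apply: wderiv_ae => //; last exact: weak_deriv_sub wu.
by apply: (L2_sub oG) => //; exact: mdom_open.
Qed.

(** Second derivatives of a test function commute almost everywhere: both orders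
    give the same integral against tensor products, whose derivatives visibly
    commute. *)
Lemma partialC_ae G phi i j : open G -> test_fun G phi ->
  ae_on E G (fun x => partial i (partial j phi) x = partial j (partial i phi) x).
Proof.
move=> oG tphi; have [->|ij] := eqVneq i j; first exact: ae_onT.
have mG := mdom_open oG.
have sij := sqi_test mG (test_fun_partial i (test_fun_partial j tphi)).
have sji := sqi_test mG (test_fun_partial j (test_fun_partial i tphi)).
have Hint k l a b m : cbox a b `<=` G ->
    rint E G (fun x => partial k (partial l phi) x * box_bump m a b x) =
    rint E G (fun x => phi x * partial l (partial k (box_bump m a b)) x).
  move=> sub; have tb := test_fun_box_bump m sub; have [sphi _] := tphi.
  have e1 := rint_by_parts k mG (smooth_partial l sphi) tb.
  have e2 := rint_by_parts l mG sphi (test_fun_partial k tb).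
  by rewrite e2 e1 opprK.
have : ae_on E G (fun x => 1 * partial i (partial j phi) x +
    (-1) * partial j (partial i phi) x = 0).
  apply: ae_zero => //; first exact: sqi_lin.
  move=> a b k sub; have sb := sqi_test mG (test_fun_box_bump k sub).
  have := ip_linl 1 (-1) mG sij sji sb; rewrite /ip => ->.
  have aux (A B : R) : A = B -> 1 * A + (-1) * B = 0.
    by move=> ->; rewrite mul1r mulN1r subrr.
  apply: aux; apply: etrans (Hint i j a b k sub) _.
  apply: esym; apply: etrans (Hint j i a b k sub) _.
  have e := box_bump_partialC k a b ij.
  exact: (congr1 (fun h => rint E G (fun x => phi x * h x)) e).
by apply: ae_onS => x _ /eqP; rewrite mul1r mulN1r subr_eq0 => /eqP.
Qed.

End FundamentalLemma.

(* Same reason as above: integrals and weak derivatives stay folded. *)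
#[global] Opaque rint wderiv eint.
(** * Sobolev functions with zero trace: Poincare and Korn inequalities *)

Section L2Norm.
Context {R : realType} {n : nat} {E : euclid R n}.
Variable G : set 'rV[R]_n.
Hypothesis mG : mdom E G.
Implicit Types f g : 'rV[R]_n -> R.

Definition nrm f : R := Num.sqrt (ip E G f f).

Lemma nrm_ge0 f : 0 <= nrm f. Proof. exact: sqrtr_ge0. Qed.

Lemma nrm_sqr f : nrm f ^+ 2 = ip E G f f.
Proof. by rewrite sqr_sqrtr// ip_ge0. Qed.

Lemma ip_sqr_lin (a b : R) f g : sqi E G f -> sqi E G g ->
  ip E G (fun x => a * f x + b * g x) (fun x => a * f x + b * g x) =
  a ^+ 2 * ip E G f f + 2 * (a * b) * ip E G f g + b ^+ 2 * ip E G g g.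
Proof.
move=> sf sg; rewrite ip_linl//; last exact: sqi_lin.
by rewrite !ip_linr// [ip E G g f]ipC; ring.
Qed.

Lemma ip_cauchy f g : sqi E G f -> sqi E G g -> `|ip E G f g| <= nrm f * nrm g.
Proof.
move=> sf sg; apply: ler_norm_sqrtM; first exact: ip_ge0.
apply: discriminant_le => t; have := ip_ge0 E G (fun x => 1 * f x + t * g x).
by rewrite ip_sqr_lin// expr1n !mul1r.
Qed.

Lemma nrm_lin (a b : R) f g : sqi E G f -> sqi E G g ->
  nrm (fun x => a * f x + b * g x) <= `|a| * nrm f + `|b| * nrm g.
Proof.
move=> sf sg; rewrite -ler_sqr ?nnegrE ?nrm_ge0//; last first.
  by rewrite addr_ge0// mulr_ge0// nrm_ge0.
rewrite nrm_sqr ip_sqr_lin// sqrrD !exprMn !nrm_sqr !real_normK ?num_real//.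
have -> : `|a| * nrm f * (`|b| * nrm g) *+ 2 = 2 * (`|a * b| * (nrm f * nrm g)).
  by rewrite normrM -mulr_natl; ring.
rewrite lerD2r lerD2l -mulrA ler_pM2l//.
apply: le_trans (ler_norm _) _; rewrite normrM ler_wpM2l//.
exact: ip_cauchy.
Qed.

Lemma nrm_sub f g : sqi E G f -> sqi E G g -> nrm f <= nrm (fun x => g x - f x) + nrm g.
Proof.
move=> sf sg; have -> : nrm f = nrm (fun x => (-1) * (g x - f x) + 1 * g x).
  by congr nrm; apply/funext => x; ring.
have sd : sqi E G (fun x => g x - f x).
  by apply: sqi_ae (sqi_lin 1 (-1) mG sg sf); apply: ae_onT => x _; rewrite mul1r mulN1r.
by apply: le_trans (nrm_lin (-1) 1 sd sg) _; rewrite normrN normr1 !mul1r.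
Qed.

Lemma nrm_ae f g : ae_on E G (fun x => f x = g x) -> nrm f = nrm g.
Proof. by move=> fg; rewrite /nrm (ip_ae fg fg). Qed.

Lemma nrm0_ae f : sqi E G f -> nrm f = 0 -> ae_on E G (fun x => f x = 0).
Proof.
move=> [h [mh ih] fh] f0.
have : ip E G f f = 0 by rewrite -nrm_sqr f0 expr0n.
rewrite /ip (@rint_intg _ _ _ _ _ (fun p => h p ^+ 2)); last first.
  by apply: (ae1 fh) => p e Gp; rewrite e.
rewrite /Rintegral => h0.
have hn : (\int[emu E]_(p in @ept _ _ E @^-1` G) `|(h p ^+ 2)%:E| = 0)%E.
  rewrite -[LHS]fineK.
    by rewrite (eq_integral (fun p => (h p ^+ 2)%:E)) ?h0// => p _; rewrite gee0_abs// lee_fin sqr_ge0.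
  rewrite (eq_integral (fun p => (h p ^+ 2)%:E)); last first.
    by move=> p _; rewrite gee0_abs// lee_fin sqr_ge0.
  exact: integrable_fin_num.
have mh2 : measurable_fun (@ept _ _ E @^-1` G) (fun p => (h p ^+ 2)%:E).
  exact: measurable_int ih.
have := (ae_eq_integral_abs (emu E) mG mh2).1 hn => H.
apply: (ae2 fh H) => p e1 e2 Gp; rewrite e1//.
by have [/eqP] := e2 Gp; rewrite sqrf_eq0 => /eqP.
Qed.

End L2Norm.

Section Sobolev1.
Context {R : realType} {n : nat} {E : euclid R n.+1}.
Hypothesis LL : lebesgue_like E.
Implicit Types (u v w phi : 'rV[R]_n.+1 -> R).

Section OnDomain.
Variable G : set 'rV[R]_n.+1.
Hypothesis oG : open G.
Let mG : mdom E G := mdom_open LL oG.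

Lemma big_tuple1 (I : finType) (F : 1.-tuple I -> R) :
  \sum_(a : 1.-tuple I) F a = \sum_i F [tuple i].
Proof.
rewrite (reindex (fun i => [tuple i]))//=.
exists (fun a : 1.-tuple I => thead a) => [i _|a _]; first by rewrite theadE.
by case/tupleP: a => x a; apply: val_inj; rewrite /= tuple0.
Qed.

Lemma big_tuple2 (I : finType) (F : 2.-tuple I -> R) :
  \sum_(a : 2.-tuple I) F a = \sum_i \sum_j F [tuple i; j].
Proof.
rewrite pair_big (reindex (fun p : I * I => [tuple p.1; p.2]))//=.
exists (fun a : 2.-tuple I => (thead a, thead (behead_tuple a))) => [[i j] _|a _] //=.
by case/tupleP: a => x a; case/tupleP: a => y a; apply: val_inj; rewrite /= tuple0.
Qed.

Lemma semi2_1 u : semi2 E G 1 u = \sum_i ip E G (wderiv E G [:: i] u) (wderiv E G [:: i] u).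
Proof. by rewrite /semi2 big_tuple1; apply: eq_bigr => i _; rewrite /ip. Qed.

Lemma semi2_2 u : semi2 E G 2 u =
  \sum_i \sum_j ip E G (wderiv E G [:: i; j] u) (wderiv E G [:: i; j] u).
Proof. by rewrite /semi2 big_tuple2; apply: eq_bigr => i _; rewrite /ip. Qed.

Lemma semi2_ge0 k u : 0 <= semi2 E G k u.
Proof.
by apply: sumr_ge0 => a _; apply: rint_ge0 => x _; rewrite sqr_ge0.
Qed.

Lemma semi2_0 u : L2 E G u -> semi2 E G 0 u = ip E G u u.
Proof.
move=> Lu; rewrite /semi2 (bigD1 [tuple])//= big1 ?addr0; last first.
  by move=> a; rewrite tuple0.
have : ae_on E G (fun x => wderiv E G [::] u x = u x).
  by apply: (wderiv_ae LL oG) => // phi _; rewrite expr0 mul1r.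
by move=> H; apply: rint_ae; apply: ae_onS H => x _ ->.
Qed.

Lemma norm2_1 u : L2 E G u -> norm2 E G 1 u =
  ip E G u u + \sum_i ip E G (wderiv E G [:: i] u) (wderiv E G [:: i] u).
Proof.
by move=> Lu; rewrite /norm2 big_ord_recl big_ord1 semi2_0// semi2_1.
Qed.

Lemma Hm1_L2 m u : Hm E G m u -> L2 E G u.
Proof. by case. Qed.

Lemma Hm_wderiv m u a : Hm E G m u -> (size a <= m)%N -> has_wderiv E G a u.
Proof. by case=> _; apply. Qed.

Lemma L2_test phi : test_fun G phi -> L2 E G phi.
Proof.
move=> tphi; apply: (sqi_L2 (E := E)); last exact: (sqi_test LL).
by apply: (continuous_measurable_on LL) => //; apply: smooth_continuous; case: tphi.
Qed.

Lemma wderiv_test phi i : test_fun G phi ->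
  has_wderiv E G [:: i] phi /\
  ae_on E G (fun x => wderiv E G [:: i] phi x = partial i phi x).
Proof.
move=> tphi.
have w : weak_deriv E G [:: i] phi (partial i phi).
  by have := weak_deriv_smooth LL [:: i] mG tphi.1.
have L := L2_test (test_fun_partial i tphi).
by split; [exists (partial i phi)|exact: (wderiv_ae LL oG)].
Qed.

(** The convergence of test functions in the norm of H^1, unfolded into the two bounds
    that the density arguments below use. *)
Lemma H10_approx u (e : R) : H10 E G u -> 0 < e -> exists2 phi, test_fun G phi &
  nrm (E := E) G (fun x => phi x - u x) <= e /\
  forall i, nrm (E := E) G (fun x => partial i phi x - wderiv E G [:: i] u x) <= e.
Proof.
move=> [Hu [phi [tphi cphi]]] e0.
have e20 : 0 < e ^+ 2 by rewrite exprn_gt0.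
have /cvgr_lt/(_ _ e20) := cphi.
move=> [k _ /(_ k (leqnn k)) /= Hk].
exists (phi k) => //.
have Lp := L2_test (tphi k).
have Lu := Hm1_L2 Hu.
have fE : (fun x => phi k x - u x) = (fun x => 1 * phi k x + (-1) * u x).
  by apply/funext => x; rewrite mul1r mulN1r.
have Ld : L2 E G (fun x => phi k x - u x) by rewrite fE; exact: L2_lin.
have ge1 : ip E G (fun x => phi k x - u x) (fun x => phi k x - u x) <= e ^+ 2.
  apply: le_trans (ltW Hk); rewrite norm2_1// lerDl.
  by apply: sumr_ge0 => i _; exact: ip_ge0.
split.
  by rewrite -ler_sqr ?nnegrE ?nrm_ge0 ?(ltW e0)// nrm_sqr.
move=> i; rewrite -ler_sqr ?nnegrE ?nrm_ge0 ?(ltW e0)// nrm_sqr.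
apply: le_trans (ltW Hk); rewrite norm2_1// (bigD1 i)//= addrCA.
have -> : ip E G (fun x => partial i (phi k) x - wderiv E G [:: i] u x)
    (fun x => partial i (phi k) x - wderiv E G [:: i] u x) =
    ip E G (wderiv E G [:: i] (fun x => phi k x - u x)) (wderiv E G [:: i] (fun x => phi k x - u x)).
  have [hp ap] := wderiv_test i (tphi k).
  have hu := Hm_wderiv (a := [:: i]) Hu isT.
  have [_ ad] := has_wderiv_lin LL oG 1 (-1) (L2_sqi mG Lp) (L2_sqi mG Lu) hp hu.
  have H : ae_on E G (fun x => partial i (phi k) x - wderiv E G [:: i] u x =
      wderiv E G [:: i] (fun x => phi k x - u x) x).
    by rewrite fE; apply: ae_onS (ae_onI ap ad) => x _ [e1 ->]; rewrite e1 mul1r mulN1r.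
  exact: (ip_ae H H).
by rewrite lerDl addr_ge0 ?ip_ge0//; apply: sumr_ge0 => j _; exact: ip_ge0.
Qed.

(** Integrating by parts, (phi, phi) = - 2 (x_i phi, d_i phi), where |x_i| < M; conclude
    by the Cauchy-Schwarz inequality and divide by the norm of phi. *)
Lemma poincare_test (M : R) phi i : 0 <= M -> G `<=` cubeR M -> test_fun G phi ->
  nrm (E := E) G phi <= 2 * M * nrm (E := E) G (partial i phi).
Proof.
move=> M0 GM tphi; have [sphi [K [cK KG p0]]] := tphi.
have [sx dx] := partial_coord i (0 : 'rV[R]_n.+1).
have tp2 : test_fun G (fun x => phi x * phi x).
  split; first exact: smoothM.
  by exists K; split=> // x Kx; rewrite p0// mulr0.
have := rint_by_parts LL i mG sx tp2.
have -> : rint E G (fun x : 'rV[R]_n.+1 => partial i (fun y : 'rV[R]_n.+1 => y 0 i) x * (phi x * phi x)) = ip E G phi phi.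
  apply: rint_ae; apply: ae_onT => x _.
  by have [_ ->] := partial_coord i x; rewrite mul1r.
move=> ibp.
have sp := sqi_test LL mG tphi.
have sd := sqi_test LL mG (test_fun_partial i tphi).
have bG : cube_bounded G by exists M.
have sxp : sqi E G (fun x => x 0 i * phi x).
  have tx : test_fun G (fun x => x 0 i * phi x).
    split; first exact: smoothM.
    by exists K; split=> // x Kx; rewrite p0// mulr0.
  exact: sqi_test tx.
have ibp2 : ip E G phi phi = - (2 * ip E G (fun x => x 0 i * phi x) (partial i phi)).
  rewrite -[LHS]opprK -ibp; congr (- _).
  rewrite -rintZ//; last exact: sqi_intgM.
  apply: rint_ae; apply: ae_onT => x _.
  by have [_ ->] := @partialM _ _ phi phi i x sphi sphi; ring.
have hx : nrm (E := E) G (fun x => x 0 i * phi x) <= M * nrm (E := E) G phi.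
  rewrite -ler_sqr ?nnegrE ?mulr_ge0 ?nrm_ge0// exprMn !nrm_sqr -rintZ//; last exact: sqi_intgM.
  apply: rint_le => //; [exact: sqi_intgM|by apply: intgZ => //; exact: sqi_intgM|].
  move=> x Gx; have := cube_finite_sum i (GM _ Gx) => hM.
  rewrite -!expr2 exprMn ler_wpM2r ?sqr_ge0//.
  by rewrite -[x 0 i ^+ 2]real_normK ?num_real// ler_sqr ?nnegrE// ltW.
have [->|ph0] := eqVneq (nrm (E := E) G phi) 0.
  by rewrite !mulr_ge0// nrm_ge0.
have php : 0 < nrm (E := E) G phi by rewrite lt0r ph0 nrm_ge0.
rewrite -(ler_pM2r php) -expr2 nrm_sqr ibp2.
apply: le_trans (ler_norm _) _; rewrite normrN normrM ger0_norm//.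
rewrite -!mulrA ler_pM2l//.
apply: le_trans (ip_cauchy mG sxp sd) _.
apply: le_trans (ler_wpM2r (nrm_ge0 _ _) hx) _.
by rewrite -!mulrA ler_wpM2l// mulrC.
Qed.

(** Poincare's inequality, from that for test functions by density. *)
Lemma poincare (M : R) u i : 0 <= M -> G `<=` cubeR M -> H10 E G u ->
  nrm (E := E) G u <= 2 * M * nrm (E := E) G (wderiv E G [:: i] u).
Proof.
move=> M0 GM Hu; have [Hu1 _] := Hu.
have su := L2_sqi mG (Hm1_L2 Hu1).
have sw := wderiv_sqi LL oG (Hm_wderiv (a := [:: i]) Hu1 isT).
apply/ler_addgt0Pr => e e0.
have M1 : 0 < 1 + 2 * M by rewrite ltr_wpDr// mulr_ge0.
have d0 : 0 < e / (1 + 2 * M) by rewrite divr_gt0.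
have [phi tphi [h1 h2]] := H10_approx Hu d0.
have sp := sqi_test LL mG tphi.
have sd := sqi_test LL mG (test_fun_partial i tphi).
have a1 := nrm_sub mG su sp.
have a2 : nrm (E := E) G (partial i phi) <= nrm (E := E) G (wderiv E G [:: i] u) + e / (1 + 2 * M).
  have := nrm_sub mG sd sw.
  have -> : nrm (E := E) G (fun x => wderiv E G [:: i] u x - partial i phi x) =
     nrm (E := E) G (fun x => partial i phi x - wderiv E G [:: i] u x).
    by congr Num.sqrt; apply: rint_ae; apply: ae_onT => x _; ring.
  move=> H; apply: le_trans H _; rewrite addrC lerD2l; exact: h2.
have a3 := poincare_test i M0 GM tphi.
have ee : e = e / (1 + 2 * M) * (1 + 2 * M) by rewrite divfK// gt_eqF.
have a4 : 2 * M * nrm (E := E) G (partial i phi) <=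
    2 * M * (nrm (E := E) G (wderiv E G [:: i] u) + e / (1 + 2 * M)).
  by rewrite ler_wpM2l// mulr_ge0.
rewrite [X in _ + X]ee; move: (e / (1 + 2 * M)) h1 a2 a4 => d h1 a2 a4.
nra.
Qed.

(** The weak form of the equality of mixed derivatives. For a test function [u], both
    sides are the pairing of [w] with a second derivative of [u], and second
    derivatives commute; the general case follows by density. *)
Lemma H10_swap u w i j : H10 E G u -> Hm E G 1 w ->
  ip E G (wderiv E G [:: i] u) (wderiv E G [:: j] w) =
  ip E G (wderiv E G [:: j] u) (wderiv E G [:: i] w).
Proof.
move=> Hu Hw; have [Hu1 _] := Hu.
have hw k := Hm_wderiv (a := [:: k]) Hw isT.
have sw k := wderiv_sqi LL oG (hw k).
have su k := wderiv_sqi LL oG (Hm_wderiv (a := [:: k]) Hu1 isT).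
have tst phi k l : test_fun G phi ->
    ip E G (partial k phi) (wderiv E G [:: l] w) = - rint E G (fun x => w x * partial l (partial k phi) x).
  move=> tphi; have [_ wl] := wderivP (hw l).
  have := wl _ (test_fun_partial k tphi); rewrite /= expr1 mulN1r => ->.
  by rewrite opprK ipC.
have eqt phi : test_fun G phi -> ip E G (partial i phi) (wderiv E G [:: j] w) =
    ip E G (partial j phi) (wderiv E G [:: i] w).
  move=> tphi; rewrite (tst phi i j tphi).
  apply: etrans (esym (tst phi j i tphi)); apply: (congr1 -%R).
  apply: rint_ae; apply: ae_onS (partialC_ae LL j i oG tphi) => x _ e.
  exact: (congr1 (fun y => w x * y) e).
apply/eqP; rewrite -subr_eq0 -normr_le0; apply/ler_addgt0Pr => e e0; rewrite add0r.
pose W := nrm (E := E) G (wderiv E G [:: j] w) + nrm (E := E) G (wderiv E G [:: i] w).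
have W0 : 0 <= W by rewrite addr_ge0 ?nrm_ge0.
have W1 : 0 < W + 1 by rewrite ltr_wpDl.
have d0 : 0 < e / (W + 1) by rewrite divr_gt0.
have [phi tphi [_ h2]] := H10_approx Hu d0.
have sd k := sqi_test LL mG (test_fun_partial k tphi).
have dif k l : `|ip E G (wderiv E G [:: k] u) (wderiv E G [:: l] w) -
    ip E G (partial k phi) (wderiv E G [:: l] w)| <= e / (W + 1) * nrm (E := E) G (wderiv E G [:: l] w).
  have -> : ip E G (wderiv E G [:: k] u) (wderiv E G [:: l] w) -
      ip E G (partial k phi) (wderiv E G [:: l] w) =
      - ip E G (fun x => 1 * partial k phi x + (-1) * wderiv E G [:: k] u x) (wderiv E G [:: l] w).
    by rewrite ip_linl//; ring.
  rewrite normrN; apply: le_trans (ip_cauchy mG _ (sw l)) _; first exact: sqi_lin.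
  rewrite ler_wpM2r ?nrm_ge0//.
  rewrite (_ : nrm G _ = nrm (E := E) G (fun x => partial k phi x - wderiv E G [:: k] u x)) ?h2//.
  by congr Num.sqrt; apply: rint_ae; apply: ae_onT => x _; ring.
have d1 := dif i j; have d2 := dif j i; rewrite (eqt _ tphi) in d1.
have aux (a b c x y : R) : `|a - c| <= x -> `|b - c| <= y -> `|a - b| <= x + y.
  move=> h3 h4; have -> : a - b = (a - c) - (b - c) by ring.
  by apply: le_trans (ler_normB _ _) _; exact: lerD.
apply: le_trans (aux _ _ _ _ _ d1 d2) _.
by rewrite -mulrDr -/W -[leRHS](@divfK _ (W + 1)) ?gt_eqF// ler_wpM2l ?(ltW d0)// lerDl.
Qed.

End OnDomain.

End Sobolev1.
(** * Saddle point problems on finitely generated spaces *)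

Section Spans.
Context {R : realType}.

(** The generators may be dependent, as those of the discrete spaces; the linear algebra
    below therefore works with Gram matrices that may be singular. *)
Definition fin_span {U : lmodType R} (S : set U) : Prop :=
  exists m (b : 'I_m -> U), S = [set u | exists c : 'I_m -> R, u = \sum_i c i *: b i].

(** Linearity is only required on [S]: the forms below are linear on the discrete
    functions, for which the derivatives and traces they contain exist. *)
Definition lin_on {U : lmodType R} (S : set U) (f : U -> R) : Prop :=
  forall a b u v, S u -> S v -> f (a *: u + b *: v) = a * f u + b * f v.

Definition bil_on {U V : lmodType R} (S : set U) (W : set V) (f : U -> V -> R) : Prop :=
  (forall v, W v -> lin_on S (f^~ v)) /\ (forall u, S u -> lin_on W (f u)).

Lemma fin_span_lin (U : lmodType R) (S : set U) (a b : R) u v : fin_span S ->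
  S u -> S v -> S (a *: u + b *: v).
Proof.
move=> [m [e ->]] [c ->] [d ->]; exists (fun i => a * c i + b * d i).
rewrite !scaler_sumr -big_split; apply: eq_bigr => i _.
by rewrite scalerDl !scalerA.
Qed.

Lemma fin_span0 (U : lmodType R) (S : set U) : fin_span S -> S 0.
Proof.
by move=> [m [e ->]]; exists (fun=> 0); rewrite big1// => i _; rewrite scale0r.
Qed.

Lemma lin_on0 (U : lmodType R) (S : set U) f : fin_span S -> lin_on S f -> f 0 = 0.
Proof.
move=> sS lf; have S0 := fin_span0 sS.
by have := lf 0 0 0 0 S0 S0; rewrite !scale0r addr0 !mul0r addr0.
Qed.

Lemma lin_onD (U : lmodType R) (S : set U) f u v : lin_on S f -> S u -> S v ->
  f (u + v) = f u + f v.
Proof. by move=> lf Su Sv; have := lf 1 1 u v Su Sv; rewrite !scale1r !mul1r. Qed.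

Lemma lin_onB (U : lmodType R) (S : set U) f u v : lin_on S f -> S u -> S v ->
  f (u - v) = f u - f v.
Proof.
by move=> lf Su Sv; have := lf 1 (-1) u v Su Sv; rewrite scale1r scaleN1r mul1r mulN1r.
Qed.

Lemma lin_on_sum (U : lmodType R) (S : set U) f m (b : 'I_m -> U) (c : 'I_m -> R) :
  fin_span S -> lin_on S f -> (forall i, S (b i)) ->
  f (\sum_i c i *: b i) = \sum_i c i * f (b i).
Proof.
move=> sS lf Sb.
suff [_ ->] : S (\sum_i c i *: b i) /\ f (\sum_i c i *: b i) = \sum_i c i * f (b i) by [].
apply: (big_ind2 (fun x y => S x /\ f x = y)).
- by split; [exact: fin_span0|exact: lin_on0 lf].
- move=> x _ x' _ [Sx <-] [Sx' <-]; split.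
    by have := fin_span_lin 1 1 sS Sx Sx'; rewrite !scale1r.
  exact: (lin_onD lf Sx Sx').
- move=> i _; have := lf (c i) 0 (b i) (b i) (Sb i) (Sb i).
  rewrite scale0r addr0 mul0r addr0 => ->; split=> //.
  by have := fin_span_lin (c i) 0 sS (Sb i) (Sb i); rewrite scale0r addr0.
Qed.

Lemma span_basis_in (U : lmodType R) m (b : 'I_m -> U) i :
  [set u | exists c : 'I_m -> R, u = \sum_i c i *: b i] (b i).
Proof.
exists (fun j => (j == i)%:R); rewrite (bigD1 i)//= eqxx scale1r big1 ?addr0//.
by move=> j /negbTE->; rewrite scale0r.
Qed.

Lemma fin_span_prod (U V : lmodType R) (S : set U) (W : set V) :
  fin_span S -> fin_span W -> fin_span [set p : U * V | S p.1 /\ W p.2].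
Proof.
move=> [m [b ->]] [n [e ->]].
exists (m + n)%N, (fun k : 'I_(m + n) => match fintype.split k with inl i => (b i, 0) | inr j => (0, e j) end).
have E (c : 'I_(m + n) -> R) : \sum_k c k *:
    match fintype.split k with inl i => (b i, 0) | inr j => (0, e j) end =
    (\sum_i c (lshift n i) *: b i, \sum_j c (rshift m j) *: e j).
  rewrite big_split_ord /=.
  under eq_bigr => i _ do rewrite (unsplitK (inl i)).
  under [X in _ + X]eq_bigr => i _ do rewrite (unsplitK (inr i)).
  have e1 : \sum_i c (lshift n i) *: ((b i, 0) : U * V) = (\sum_i c (lshift n i) *: b i, 0).
    apply: (big_ind2 (fun (x : U * V) y => x = (y, 0))) => //.
      by move=> x y x' y' -> ->; congr pair; rewrite addr0.
    by move=> i _; congr pair; rewrite scaler0.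
  have e2 : \sum_j c (rshift m j) *: ((0, e j) : U * V) = (0, \sum_j c (rshift m j) *: e j).
    apply: (big_ind2 (fun (x : U * V) y => x = (0, y))) => //.
      by move=> x y x' y' -> ->; congr pair; rewrite addr0.
    by move=> i _; congr pair; rewrite scaler0.
  by rewrite e1 e2; congr pair; rewrite ?addr0 ?add0r.
apply/seteqP; split=> [[u v] /= [[c ->] [d ->]]|_ [c ->]].
  exists (fun k => match fintype.split k with inl i => c i | inr j => d j end).
  rewrite E; congr pair; apply: eq_bigr => i _.
    by rewrite (unsplitK (inl i)).
  by rewrite (unsplitK (inr i)).
by rewrite E /=; split; [exists (fun i => c (lshift n i))|exists (fun i => c (rshift m i))].
Qed.

(** The Fredholm alternative. In terms of the Gram matrix of the generators, the
    right-hand side lies in the row space as soon as the cokernel annihilates it. The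
    matrix may be singular, since the generators may be dependent. *)
Lemma span_solve (U : lmodType R) (S : set U) (B : U -> U -> R) (L : U -> R) :
  fin_span S -> bil_on S S B -> lin_on S L ->
  (forall v, S v -> (forall u, S u -> B u v = 0) -> L v = 0) ->
  exists2 u, S u & forall v, S v -> B u v = L v.
Proof.
move=> sS [B1 B2] lL H; have [m [b Sb]] := sS.
have Sbi i : S (b i) by rewrite Sb; exact: span_basis_in.
pose M : 'M[R]_m := \matrix_(i, j) B (b i) (b j).
pose l : 'rV[R]_m := \row_j L (b j).
have sub : (l <= M)%MS.
  rewrite submxE; apply/eqP/matrixP => i0 j; rewrite [i0]ord1 {i0} !mxE.
  pose v := \sum_k (cokermx M) k j *: b k.
  have Sv : S v by rewrite Sb; exists (fun k => cokermx M k j).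
  have Bv i : B (b i) v = 0.
    rewrite /v (lin_on_sum _ sS (B2 _ (Sbi i)) Sbi).
    have h : (M *m cokermx M) i j = 0 by rewrite mulmx_coker mxE.
    rewrite mxE in h; apply: etrans h.
    by apply: eq_bigr => k _; rewrite [M i k]mxE mulrC.
  have h : L v = 0; last first.
    apply: etrans (h); rewrite /v (lin_on_sum _ sS lL Sbi).
    by apply: eq_bigr => k _; rewrite mxE mulrC.
  apply: (H v Sv) => u; rewrite {1}Sb => -[c ->].
  rewrite (lin_on_sum _ sS (B1 _ Sv) Sbi) big1// => i _.
  by rewrite Bv mulr0.
have /submxP[x xM] := sub.
exists (\sum_i x 0 i *: b i); first by rewrite Sb; exists (fun i => x 0 i).
move=> v Sv; have Su : S (\sum_i x 0 i *: b i) by rewrite Sb; exists (fun i => x 0 i).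
move: (Sv); rewrite {1}Sb => -[c ->].
rewrite (lin_on_sum _ sS (B2 _ Su) Sbi) (lin_on_sum _ sS lL Sbi).
apply: eq_bigr => j _; congr (_ * _).
rewrite (lin_on_sum _ sS (B1 _ (Sbi j)) Sbi).
have := congr1 (fun w : 'rV[R]_m => w 0 j) xM; rewrite !mxE => ->.
by apply: eq_bigr => i _; rewrite mxE.
Qed.

Lemma bil_cauchy (U : lmodType R) (S : set U) (q : U -> U -> R) u v :
  bil_on S S q -> (forall u, S u -> 0 <= q u u) -> fin_span S ->
  (forall u v, S u -> S v -> q u v = q v u) -> S u -> S v ->
  `|q u v| <= Num.sqrt (q u u) * Num.sqrt (q v v).
Proof.
move=> [q1 q2] q0 sS qC Su Sv; apply: ler_norm_sqrtM; first exact: q0.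
apply: discriminant_le => t.
have St := fin_span_lin 1 t sS Su Sv; have := q0 _ St.
rewrite (q1 _ St)// (q2 _ Su)// (q2 _ Sv)// (qC v u)//.
by congr (_ <= _); ring.
Qed.

(** On a finitely generated space a seminorm is controlled by every semidefinite form
    on whose kernel it vanishes. The pseudo-inverse of the Gram matrix [M] turns the
    numbers [N u (b j)] into coefficients of a vector [u'] that differs from [u] by an
    element of the kernel; these numbers are bounded by the Cauchy-Schwarz
    inequality. *)
Lemma span_kernel_bound (U : lmodType R) (S : set U) (N : U -> U -> R) (q : U -> R) :
  fin_span S -> bil_on S S N -> (forall u, S u -> 0 <= N u u) ->
  (forall u v, S u -> S v -> N u v = N v u) ->
  (forall u, 0 <= q u) ->
  (forall a b u v, S u -> S v -> q (a *: u + b *: v) <= `|a| * q u + `|b| * q v) ->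
  (forall u, S u -> N u u = 0 -> q u = 0) ->
  exists2 C, 0 <= C & forall u, S u -> q u <= C * Num.sqrt (N u u).
Proof.
move=> sS [N1 N2] N0 NC q0 qlin ker; have [m [b Sb]] := sS.
have Sbi i : S (b i) by rewrite Sb; exact: span_basis_in.
pose M : 'M[R]_m := \matrix_(i, j) N (b i) (b j).
have qz : q 0 = 0.
  apply: ker; first exact: fin_span0.
  exact: (lin_on0 sS (N2 _ (fin_span0 sS))).
have qsum (c : 'I_m -> R) : q (\sum_i c i *: b i) <= \sum_i `|c i| * q (b i).
  suff [] : S (\sum_i c i *: b i) /\ q (\sum_i c i *: b i) <= \sum_i `|c i| * q (b i) by [].
  apply: (big_ind2 (fun x y => S x /\ q x <= y)).
  - by split; [exact: fin_span0|rewrite qz].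
  - move=> x y x' y' [Sx hx] [Sx' hx']; split.
      by have := fin_span_lin 1 1 sS Sx Sx'; rewrite !scale1r.
    have := qlin 1 1 x x' Sx Sx'; rewrite !scale1r normr1 !mul1r => h.
    exact: le_trans h (lerD hx hx').
  - move=> i _; have := qlin (c i) 0 (b i) (b i) (Sbi i) (Sbi i).
    rewrite scale0r addr0 normr0 mul0r addr0 => ->; split=> //.
    by have := fin_span_lin (c i) 0 sS (Sbi i) (Sbi i); rewrite scale0r addr0.
exists (\sum_i (\sum_j Num.sqrt (N (b j) (b j)) * `|pinvmx M j i|) * q (b i)).
  by apply: sumr_ge0 => i _; rewrite mulr_ge0//; apply: sumr_ge0 => j _; rewrite mulr_ge0 ?sqrtr_ge0.
move=> u Su; move: (Su); rewrite {1}Sb => -[c uE].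
pose cv : 'rV[R]_m := \row_i c i.
pose r := cv *m M; pose c' := r *m pinvmx M.
have rE j : r 0 j = N u (b j).
  rewrite uE (lin_on_sum _ sS (N1 _ (Sbi j)) Sbi) mxE.
  by apply: eq_bigr => i _; rewrite !mxE.
have c'M : c' *m M = r by rewrite /c' mulmxKpV// submxMl.
pose u' := \sum_i c' 0 i *: b i.
have Su' : S u' by rewrite Sb; exists (fun i => c' 0 i).
have Nz j : N (u - u') (b j) = 0.
  rewrite (lin_onB (N1 _ (Sbi j)))// -rE /u' (lin_on_sum _ sS (N1 _ (Sbi j)) Sbi).
  apply/eqP; rewrite subr_eq0; apply/eqP.
  rewrite -c'M mxE; apply: eq_bigr => i _.
  by rewrite !mxE.
have Sd : S (u - u').
  by have := fin_span_lin 1 (-1) sS Su Su'; rewrite scale1r scaleN1r.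
have qd : q (u - u') = 0.
  apply: ker => //; move: (Sd); rewrite {1}Sb => -[d dE].
  by rewrite {2}dE (lin_on_sum _ sS (N2 _ Sd) Sbi) big1// => i _; rewrite Nz mulr0.
have qu : q u <= q u'.
  have := qlin 1 1 (u - u') u' Sd Su'.
  by rewrite !scale1r subrK normr1 !mul1r qd add0r.
apply: le_trans qu _; apply: le_trans (qsum _) _.
rewrite mulr_suml; apply: ler_sum => i _.
rewrite mulrAC ler_wpM2r// mxE; apply: le_trans (ler_norm_sum _ _ _) _.
rewrite mulr_suml; apply: ler_sum => j _.
rewrite normrM mulrAC ler_wpM2r// rE mulrC.
exact: (bil_cauchy (conj N1 N2) N0 sS NC Su (Sbi j)).
Qed.

End Spans.

(** The form [af] is the sum of the diagonal parts [dc] and [ke] and of the skew coupling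
    [gm]; [bb] is the constraint. The form [q] is the semi-inner product of the seminorm
    [nU], whereas [nY] and [nZ] enter only through the inequalities below. *)
Section SaddlePoint.
Context {R : realType} {U Y Z : lmodType R}.
Variables (S : set U) (W : set Y) (V : set Z).
Hypotheses (sS : fin_span S) (sW : fin_span W) (sV : fin_span V).
Variables (dc q : U -> U -> R) (ke : Y -> Y -> R) (gm : U -> Y -> R) (bb : Z -> U -> R).
Variables (nY : Y -> R) (nZ : Z -> R).
Hypotheses (bdc : bil_on S S dc) (bq : bil_on S S q) (bke : bil_on W W ke)
  (bgm : bil_on S W gm) (bbb : bil_on V S bb).
Hypotheses (qC : forall u v, S u -> S v -> q u v = q v u)
  (q0 : forall u, S u -> 0 <= q u u) (nY0 : nY 0 = 0) (nZ0 : forall z, 0 <= nZ z).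

Definition nU u := Num.sqrt (q u u).
Definition tn u y := Num.sqrt (nU u ^+ 2 + nY y ^+ 2).
Definition af u y u' y' := dc u u' + ke y y' + gm u y' - gm u' y.

Lemma af_sub u y u1 y1 u' y' :
  dc (u - u1) u' = dc u u' - dc u1 u' -> ke (y - y1) y' = ke y y' - ke y1 y' ->
  gm (u - u1) y' = gm u y' - gm u1 y' -> gm u' (y - y1) = gm u' y - gm u' y1 ->
  af (u - u1) (y - y1) u' y' = af u y u' y' - af u1 y1 u' y'.
Proof. by rewrite /af => -> -> -> ->; ring. Qed.

Variables (CA c3 c4 ck : R).
Hypotheses (CA0 : 0 < CA) (c30 : 0 < c3) (c40 : 0 < c4) (ck0 : 0 < ck).
Hypothesis hA : forall u y u' y', S u -> W y -> S u' -> W y' ->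
  `|af u y u' y'| <= CA * tn u y * tn u' y'.
Hypothesis hker : forall u, S u -> (forall z, V z -> bb z u = 0) ->
  c3 * nU u ^+ 2 <= dc u u.
Hypothesis hinf : forall z F, V z -> 0 <= F ->
  (forall u, S u -> `|bb z u| <= F * nU u) -> c4 * nZ z <= F.
Hypothesis hke : forall y, W y -> ck * nY y ^+ 2 <= ke y y.

Let S0 := fin_span0 sS.
Let W0 := fin_span0 sW.
Let V0 := fin_span0 sV.

Lemma nU_sqr u : S u -> nU u ^+ 2 = q u u.
Proof. by move=> Su; rewrite sqr_sqrtr// q0. Qed.

Lemma nU_ge0 u : 0 <= nU u. Proof. exact: sqrtr_ge0. Qed.

Lemma tn_ge0 u y : 0 <= tn u y. Proof. exact: sqrtr_ge0. Qed.

Lemma tn_sqr u y : tn u y ^+ 2 = nU u ^+ 2 + nY y ^+ 2.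
Proof. by rewrite sqr_sqrtr// addr_ge0 ?sqr_ge0. Qed.

Lemma tn_Y0 u : tn u 0 = nU u.
Proof. by rewrite /tn nY0 expr0n addr0 sqrtr_sqr ger0_norm ?nU_ge0. Qed.

Lemma nU0 : nU 0 = 0.
Proof. by rewrite /nU (lin_on0 sS (bq.2 _ S0)) sqrtr0. Qed.

Lemma af_diag u y : af u y u y = dc u u + ke y y.
Proof. by rewrite /af addrK. Qed.

(** Only the first component is constrained, since the energy of the second one
    controls its seminorm without constraint. *)
Lemma coercive u y : S u -> W y -> (forall z, V z -> bb z u = 0) ->
  Num.min c3 ck * tn u y ^+ 2 <= dc u u + ke y y.
Proof.
move=> Su Wy hb; rewrite tn_sqr mulrDr; apply: lerD.
  by apply: le_trans (hker Su hb); rewrite ler_wpM2r ?sqr_ge0// ge_min lexx.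
by apply: le_trans (hke Wy); rewrite ler_wpM2r ?sqr_ge0// ge_min lexx orbT.
Qed.

Let c := Num.min c3 ck.
Let c_gt0 : 0 < c. Proof. by rewrite lt_min c30. Qed.

(** A solution (t, v, w) of the homogeneous adjoint problem satisfies the constraint, so
    that (t, v) has norm zero by coercivity and w has norm zero by the inf-sup
    condition. The data annihilate such triples by hypothesis, hence the problem is
    solvable. *)
Lemma saddle_exists (Fn : U -> Y -> R) (G : Z -> R) :
  lin_on [set p : U * Y | S p.1 /\ W p.2] (fun p => Fn p.1 p.2) -> lin_on V G ->
  (forall u y, S u -> W y -> tn u y = 0 -> Fn u y = 0) ->
  (forall z, V z -> nZ z = 0 -> G z = 0) ->
  exists u y z, [/\ S u, W y, V z,
    forall u' y', S u' -> W y' -> af u y u' y' + bb z u' = Fn u' y' &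
    forall z', V z' -> bb z' u = G z'].
Proof.
move=> lF lG F0 G0.
pose SW := [set p : U * Y | S p.1 /\ W p.2].
have sSW : fin_span SW := fin_span_prod sS sW.
pose X := [set p : (U * Y) * Z | SW p.1 /\ V p.2].
have sX : fin_span X := fin_span_prod sSW sV.
pose B (p p' : (U * Y) * Z) := af p.1.1 p.1.2 p'.1.1 p'.1.2 + bb p.2 p'.1.1 + bb p'.2 p.1.1.
pose L (p : (U * Y) * Z) := Fn p.1.1 p.1.2 + G p.2.
have bB : bil_on X X B.
  split.
    move=> [[u y] z] [[/= Su Wy] Vz] a b [[u1 y1] z1] [[u2 y2] z2]
      [[/= Su1 Wy1] Vz1] [[/= Su2 Wy2] Vz2]; rewrite /B /af /=.
    rewrite (bdc.1 _ Su)// (bke.1 _ Wy)// (bgm.1 _ Wy)// (bgm.2 _ Su)//.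
    by rewrite (bbb.1 _ Su)// (bbb.2 _ Vz)//; ring.
  move=> [[u y] z] [[/= Su Wy] Vz] a b [[u1 y1] z1] [[u2 y2] z2]
    [[/= Su1 Wy1] Vz1] [[/= Su2 Wy2] Vz2]; rewrite /B /af /=.
  rewrite (bdc.2 _ Su)// (bke.2 _ Wy)// (bgm.2 _ Su)// (bgm.1 _ Wy)//.
  by rewrite (bbb.2 _ Vz)// (bbb.1 _ Su)//; ring.
have lL : lin_on X L.
  move=> a b [[u1 y1] z1] [[u2 y2] z2] [[/= Su1 Wy1] Vz1] [[/= Su2 Wy2] Vz2].
  rewrite /L /= (lG a b)//.
  have := lF a b (u1, y1) (u2, y2) (conj Su1 Wy1) (conj Su2 Wy2); rewrite /= => ->.
  ring.
have B00 u y z u' y' : S u -> W y -> V z -> S u' -> W y' ->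
    [/\ af 0 0 u' y' = 0, af u y 0 0 = 0, bb 0 u' = 0 & bb z 0 = 0].
  move=> Su Wy Vz Su' Wy'; rewrite /af.
  rewrite (lin_on0 sS (bdc.1 _ Su')) (lin_on0 sW (bke.1 _ Wy')) (lin_on0 sS (bgm.1 _ Wy')).
  rewrite (lin_on0 sW (bgm.2 _ Su')) (lin_on0 sS (bdc.2 _ Su)) (lin_on0 sW (bke.2 _ Wy)).
  rewrite (lin_on0 sW (bgm.2 _ Su)) (lin_on0 sS (bgm.1 _ Wy)).
  rewrite (lin_on0 sV (bbb.1 _ Su')) (lin_on0 sS (bbb.2 _ Vz)).
  by split=> //; ring.
have [] := span_solve sX bB lL.
  move=> [[t v] w] [[/= St Wv] Vw] H.
  have bt z : V z -> bb z t = 0.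
    move=> Vz; have := H ((0, 0), z) (conj (conj S0 W0) Vz); rewrite /B /=.
    have [-> _ _ _] := B00 0 0 z t v S0 W0 Vz St Wv.
    by have [_ _ _ ->] := B00 0 0 w t v S0 W0 Vw St Wv; rewrite add0r addr0.
  have tv0 : tn t v = 0.
    have := H ((t, v), 0) (conj (conj St Wv) V0); rewrite /B /= af_diag (bt w Vw).
    have [_ _ -> _] := B00 0 0 0 t v S0 W0 V0 St Wv; rewrite !addr0 => e.
    have := coercive St Wv bt; rewrite e pmulr_rle0// => h.
    by apply/eqP; rewrite -sqrf_eq0; apply/eqP/le_anti; rewrite h sqr_ge0.
  have w0 : nZ w = 0.
    have := @hinf w 0 Vw (lexx _).
    have bw u : S u -> `|bb w u| <= 0 * nU u.
      move=> Su; rewrite mul0r normr_le0.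
      have := H ((u, 0), 0) (conj (conj Su W0) V0); rewrite /B /=.
      have [_ _ -> _] := B00 0 0 0 t v S0 W0 V0 St Wv; rewrite addr0.
      have := hA Su W0 St Wv; rewrite tv0 mulr0 normr_le0 => /eqP ->.
      by rewrite add0r => ->.
    move=> /(_ bw); rewrite pmulr_rle0// => h.
    by apply/le_anti; rewrite h nZ0.
  by rewrite /L /= F0// G0// addr0.
move=> [[u y] z] [[/= Su Wy] Vz] H; exists u, y, z; split=> //.
  move=> u' y' Su' Wy'; have := H ((u', y'), 0) (conj (conj Su' Wy') V0).
  rewrite /B /L /= (lin_on0 sV lG); have [_ _ -> _] := B00 0 0 0 u y S0 W0 V0 Su Wy.
  by rewrite !addr0.
move=> z' Vz'; have := H ((0, 0), z') (conj (conj S0 W0) Vz').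
rewrite /B /L /=; have [_ -> _ _] := B00 u y z u y Su Wy Vz Su Wy.
have [_ _ _ ->] := B00 u y z u y Su Wy Vz Su Wy; rewrite !add0r => ->.
by rewrite F0 ?add0r// tn_Y0 nU0.
Qed.

(** The bound of [saddle_stable] for data of norm one: [k1] bounds the lifting of the
    constraint data and [k3] the primal unknown; the last summand bounds the
    multiplier. *)
Definition saddle_const : R :=
  let k1 := c4^-1 in
  let k3 := (1 + CA * k1) / Num.min c3 ck + k1 in
  k3 + (1 + CA * k3) / c4.

Lemma saddle_const_gt0 : 0 < saddle_const.
Proof.
have k1 : 0 < c4^-1 by rewrite invr_gt0.
have k3 : 0 < (1 + CA * c4^-1) / Num.min c3 ck + c4^-1.
  by rewrite addr_gt0// divr_gt0// addr_gt0// mulr_gt0.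
by rewrite /saddle_const addr_gt0// divr_gt0// addr_gt0// mulr_gt0.
Qed.

(** A right inverse of the constraint whose norm is at most the inverse of the inf-sup
    constant, obtained by solving the mixed problem with the inner product [q] in place
    of [dc], that is, by selecting the solution of least norm. *)
Lemma constraint_lift (G : Z -> R) (G0 : R) : lin_on V G -> 0 <= G0 ->
  (forall z, V z -> `|G z| <= G0 * nZ z) ->
  exists u, [/\ S u, forall z, V z -> bb z u = G z & c4 * nU u <= G0].
Proof.
move=> lG G00 HG.
pose X := [set p : U * Z | S p.1 /\ V p.2].
have sX : fin_span X := fin_span_prod sS sV.
pose B (p p' : U * Z) := q p.1 p'.1 + bb p.2 p'.1 + bb p'.2 p.1.
pose L (p : U * Z) := G p.2.
have bB : bil_on X X B.
  split; move=> [u z] [/= Su Vz] a b [u1 z1] [u2 z2] [/= Su1 Vz1] [/= Su2 Vz2]; rewrite /B /=.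
    by rewrite (bq.1 _ Su)// (bbb.1 _ Su)// (bbb.2 _ Vz)//; ring.
  by rewrite (bq.2 _ Su)// (bbb.2 _ Vz)// (bbb.1 _ Su)//; ring.
have lL : lin_on X L.
  by move=> a b [u1 z1] [u2 z2] [/= Su1 Vz1] [/= Su2 Vz2]; rewrite /L /= (lG a b).
have b0 z : V z -> bb z 0 = 0 by move=> Vz; exact: (lin_on0 sS (bbb.2 _ Vz)).
have b0' u : S u -> bb 0 u = 0 by move=> Su; exact: (lin_on0 sV (bbb.1 _ Su)).
have q0' u : S u -> q u 0 = 0 by move=> Su; exact: (lin_on0 sS (bq.2 _ Su)).
have q0l u : S u -> q 0 u = 0 by move=> Su; exact: (lin_on0 sS (bq.1 _ Su)).
have [] := span_solve sX bB lL.
  move=> [t w] [/= St Vw] H.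
  have bt z : V z -> bb z t = 0.
    move=> Vz; have := H (0, z) (conj S0 Vz).
    by rewrite /B /= q0l// (b0 w)// add0r addr0.
  have t0 : nU t = 0.
    have := H (t, 0) (conj St V0); rewrite /B /= b0'// bt// !addr0 => e.
    by rewrite /nU e sqrtr0.
  have w0 : nZ w = 0.
    have := @hinf w 0 Vw (lexx _).
    have bw u : S u -> `|bb w u| <= 0 * nU u.
      move=> Su; rewrite mul0r normr_le0.
      have := H (u, 0) (conj Su V0); rewrite /B /= b0'// addr0.
      have := bil_cauchy bq q0 sS qC Su St; rewrite -/(nU t) t0 mulr0 normr_le0 => /eqP->.
      by rewrite add0r => ->.
    move=> /(_ bw); rewrite pmulr_rle0// => h.
    by apply/le_anti; rewrite h nZ0.
  by have := HG w Vw; rewrite w0 mulr0 normr_le0 => /eqP.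
move=> [u z] [/= Su Vz] H; exists u.
have e1 u' : S u' -> q u u' + bb z u' = 0.
  move=> Su'; have := H (u', 0) (conj Su' V0).
  by rewrite /B /L /= b0'// (lin_on0 sV lG) addr0.
have e2 z' : V z' -> bb z' u = G z'.
  move=> Vz'; have := H (0, z') (conj S0 Vz').
  by rewrite /B /L /= q0'// b0// !add0r.
split=> //.
have hz : c4 * nZ z <= nU u.
  apply: hinf => //; first exact: nU_ge0.
  move=> u' Su'; have /eqP := e1 u' Su'; rewrite addrC addr_eq0 => /eqP ->.
  by rewrite normrN; exact: (bil_cauchy bq q0 sS qC Su Su').
have hu : nU u ^+ 2 <= G0 * nZ z.
  rewrite nU_sqr//; have /eqP := e1 u Su; rewrite addr_eq0 e2// => /eqP ->.
  by apply: le_trans (HG z Vz); apply: le_trans (ler_norm _) _; rewrite normrN.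
have [->|u0] := eqVneq (nU u) 0; first by rewrite mulr0.
have up : 0 < nU u by rewrite lt0r u0 nU_ge0.
rewrite -(ler_pM2r up) -mulrA -expr2.
apply: le_trans (_ : c4 * (G0 * nZ z) <= _); first by rewrite ler_pM2l.
by rewrite mulrCA ler_wpM2l.
Qed.

(** Subtract from [u] the lifting [u1] of the constraint data; the remainder lies in the
    kernel of the constraint, where the form is coercive. The multiplier is then
    controlled by the first equation and the inf-sup condition. *)
Lemma saddle_stable u y z (Fn : U -> Y -> R) (G : Z -> R) (F0 G0 : R) :
  S u -> W y -> V z -> 0 <= F0 -> 0 <= G0 -> lin_on V G ->
  (forall u' y', S u' -> W y' -> af u y u' y' + bb z u' = Fn u' y') ->
  (forall z', V z' -> bb z' u = G z') ->
  (forall u' y', S u' -> W y' -> `|Fn u' y'| <= F0 * tn u' y') ->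
  (forall z', V z' -> `|G z'| <= G0 * nZ z') ->
  tn u y + nZ z <= saddle_const * (F0 + G0).
Proof.
move=> Su Wy Vz F00 G00 lG e1 e2 hF hG.
have [u1 [Su1 b1 n1]] := constraint_lift lG G00 hG.
have Sd : S (u - u1).
  by have := fin_span_lin 1 (-1) sS Su Su1; rewrite scale1r scaleN1r.
have bd z' : V z' -> bb z' (u - u1) = 0.
  by move=> Vz'; rewrite (lin_onB (bbb.2 _ Vz'))// e2// b1// subrr.
set X := F0 + G0; have X0 : 0 <= X by rewrite addr_ge0.
set k1 := c4^-1; have k10 : 0 < k1 by rewrite invr_gt0.
have h1 : nU u1 <= k1 * X.
  rewrite mulrC ler_pdivlMr// mulrC; apply: le_trans n1 _; by rewrite lerDr.
have t0 := tn_ge0 (u - u1) y.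
have h2 : c * tn (u - u1) y <= (1 + CA * k1) * X.
  have h : c * tn (u - u1) y ^+ 2 <= (F0 + CA * nU u1) * tn (u - u1) y.
    apply: le_trans (coercive Sd Wy bd) _; rewrite -af_diag.
    have -> : af (u - u1) y (u - u1) y = Fn (u - u1) y - af u1 0 (u - u1) y.
      rewrite -e1// bd// addr0 /af.
      rewrite (lin_onB (bdc.1 _ Sd))// (lin_onB (bgm.1 _ Wy))//.
      rewrite (lin_on0 sW (bke.1 _ Wy)) (lin_on0 sW (bgm.2 _ Sd)).
      ring.
    apply: le_trans (ler_norm _) _; apply: le_trans (ler_normB _ _) _.
    rewrite mulrDl; apply: lerD; first exact: hF.
    by have := hA Su1 W0 Sd Wy; rewrite tn_Y0.
  have [->|tp] := eqVneq (tn (u - u1) y) 0.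
    by rewrite mulr0 mulr_ge0// addr_ge0// mulr_ge0// ltW.
  have tp' : 0 < tn (u - u1) y by rewrite lt0r tp.
  move: h; rewrite expr2 mulrA ler_pM2r// => h; apply: le_trans h _.
  rewrite mulrDl mul1r; apply: lerD; first by rewrite lerDl.
  by rewrite -mulrA ler_pM2l.
have h3 : tn u y <= ((1 + CA * k1) / c + k1) * X.
  apply: le_trans (_ : tn (u - u1) y + nU u1 <= _).
    rewrite -ler_sqr ?nnegrE ?tn_ge0//; last by rewrite addr_ge0// nU_ge0.
    rewrite tn_sqr.
    have hq : nU u ^+ 2 <= (nU (u - u1) + nU u1) ^+ 2.
      have St := Sd.
      rewrite sqrrD !nU_sqr//.
      have -> : q u u = q (u - u1) (u - u1) + 2 * q (u - u1) u1 + q u1 u1.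
        rewrite -{1 2}(subrK u1 u).
        have Sds : S (u - u1 + u1) by rewrite subrK.
        rewrite (lin_onD (bq.1 _ Sds) Sd Su1) (lin_onD (bq.2 _ Sd) Sd Su1).
        rewrite (lin_onD (bq.2 _ Su1) Sd Su1).
        by rewrite (qC Su1 Sd); ring.
      rewrite lerD2r lerD2l mulr_natl ler_wMn2r//.
      by apply: le_trans (ler_norm _) _; exact: (bil_cauchy bq q0 sS qC Sd Su1).
    have ht : nU (u - u1) <= tn (u - u1) y.
      rewrite -ler_sqr ?nnegrE ?nU_ge0// tn_sqr lerDl sqr_ge0//.
    have := tn_sqr (u - u1) y; move: hq ht (nU_ge0 u1) (nU_ge0 (u - u1)) t0.
    move: (nU u) (nU u1) (nU (u - u1)) (tn (u - u1) y) (nY y) => a b d e f; nra.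
  rewrite mulrDl; apply: lerD => //.
  by rewrite mulrAC ler_pdivlMr// mulrC.
have h4 : c4 * nZ z <= F0 + CA * tn u y.
  apply: hinf => //; first by rewrite addr_ge0// mulr_ge0 ?tn_ge0// ltW.
  move=> u' Su'; have -> : bb z u' = Fn u' 0 - af u y u' 0 by rewrite -e1// addrAC subrr add0r.
  apply: le_trans (ler_normB _ _) _; rewrite mulrDl.
  have g1 := hF u' 0 Su' W0; have g2 := hA Su Wy Su' W0.
  by rewrite !tn_Y0 in g1 g2; exact: lerD.
rewrite /saddle_const -/k1 -/c; set k3 := (1 + CA * k1) / c + k1.
rewrite mulrDl; apply: lerD => //.
rewrite mulrAC ler_pdivlMr// mulrC; apply: le_trans h4 _.
rewrite mulrDl mul1r; apply: lerD; first by rewrite lerDl.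
by rewrite -mulrA ler_pM2l.
Qed.

End SaddlePoint.
(** * Simplices and meshes *)

Section Barycentric.
Context {R : realType} {d : nat}.
Implicit Types (K : 'M[R]_(d.+2, d.+1)) (x : 'rV[R]_d.+1).

(** The vertices in homogeneous coordinates. The matrix is invertible exactly when the
    vertices are affinely independent, and its inverse yields the barycentric
    coordinates. *)
Definition homog K : 'M[R]_(d.+2) := row_mx (const_mx 1 : 'cV[R]_(d.+2)) K.

Definition bary K x : 'rV[R]_d.+2 :=
  (row_mx (const_mx 1 : 'M[R]_1) x : 'rV[R]_(d.+2)) *m invmx (homog K).

Lemma mulmx_const1 k (c : 'rV[R]_k) :
  c *m (const_mx 1 : 'cV[R]_k) = const_mx (\sum_i c 0 i).
Proof.
apply/matrixP => i j; rewrite !mxE !ord1.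
by apply: eq_bigr => k0 _; rewrite mxE mulr1.
Qed.

Lemma mul_homog K (c : 'rV[R]_d.+2) :
  c *m homog K = row_mx (const_mx (\sum_i c 0 i) : 'M[R]_1) (c *m K).
Proof.
have := @mul_mx_row R 1 d.+2 1 d.+1 c (const_mx 1) K.
by rewrite mulmx_const1.
Qed.

Lemma homog_unit K : aff_indep K -> homog K \in unitmx.
Proof.
move=> aK; rewrite -row_free_unit; apply: inj_row_free => c.
rewrite mul_homog => e.
have [c1 c2] := @eq_row_mx _ 1 1 d.+1 _ _ 0 0 (etrans e (esym (row_mx0 R 1 1 d.+1))).
by apply: aK => //; have := congr1 (fun M : 'M[R]_1 => M 0 0) c1; rewrite !mxE.
Qed.

Lemma hull_bary K x : aff_indep K -> hull K x <-> forall i, 0 <= bary K x 0 i.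
Proof.
move=> aK; have uK := homog_unit aK; split.
  move=> [c [c0 c1] <-] i; rewrite /bary.
  suff -> : row_mx (const_mx 1 : 'M[R]_1) (c *m K) = c *m homog K by rewrite mulmxK.
  by rewrite mul_homog c1.
move=> b0; exists (bary K x).
  split=> //; have : bary K x *m homog K = row_mx (const_mx 1 : 'M[R]_1) x by rewrite mulmxKV.
  rewrite mul_homog => /(@eq_row_mx _ 1 1 d.+1)[h _].
  by have := congr1 (fun M : 'M[R]_1 => M 0 0) h; rewrite !mxE.
have : bary K x *m homog K = row_mx (const_mx 1 : 'M[R]_1) x by rewrite mulmxKV.
by rewrite mul_homog => /(@eq_row_mx _ 1 1 d.+1)[_].
Qed.

(** The gradient of the i-th barycentric coordinate. *)
Definition slope K i : 'rV[R]_d.+1 := \row_j invmx (homog K) (rshift 1 j) i.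

Lemma bary_affine K x i :
  bary K x 0 i = \sum_j slope K i 0 j * x 0 j + invmx (homog K) (lshift d.+1 (0 : 'I_1)) i.
Proof.
rewrite /bary mxE (@big_split_ord _ _ _ 1 d.+1) /= big_ord1 addrC; congr (_ + _).
  by apply: eq_bigr => j _; rewrite (@row_mxEr _ 1 1 d.+1 (const_mx 1) x 0 j) !mxE mulrC.
by rewrite (@row_mxEl _ 1 1 d.+1 (const_mx 1) x 0 ord0) mxE mul1r.
Qed.

(** Otherwise the i-th barycentric coordinate would be constant, but it is 1 at the
    i-th vertex and 0 at the others. *)
Lemma slope_neq0 K i : aff_indep K -> slope K i != 0.
Proof.
move=> aK; have uK := homog_unit aK.
have bv k : bary K (row k K) 0 i = (k == i)%:R.
  rewrite /bary; suff -> : row_mx (const_mx 1 : 'M[R]_1) (row k K) = row k (homog K).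
    by rewrite -row_mul mulmxV// !mxE.
  rewrite [RHS](@row_row_mx _ d.+2 1 d.+1 k (const_mx 1) K); congr row_mx.
  by apply/matrixP => a b; rewrite !mxE.
apply/eqP => s0; have := bv i; have := bv (lift i ord0).
rewrite !bary_affine s0.
have z y : \sum_j (0 : 'rV[R]_d.+1) 0 j * (y : 'rV[R]_d.+1) 0 j = 0.
  by rewrite big1// => j _; rewrite mxE mul0r.
rewrite !z eqxx eq_sym (negbTE (neq_lift i ord0)) => -> /eqP.
by rewrite eq_sym oner_eq0.
Qed.

Lemma bary_pos_elt K x : aff_indep K -> (forall i, 0 < bary K x 0 i) -> elt K x.
Proof.
move=> aK bx; suff : [set y | forall i, 0 < bary K y 0 i] `<=` elt K by apply.
rewrite /elt -open_subsetE.
  by move=> y by0; apply/hull_bary => // i; exact/ltW.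
rewrite openE => y H.
have ff := @filter_forall _ _ (fun (i : 'I_d.+2) (y : 'rV[R]_d.+1) => 0 < bary K y 0 i) (nbhs y) _.
apply: ff => i.
have cb : continuous (fun x => bary K x 0 i : R).
  have -> : (fun x => bary K x 0 i) = (fun x => 1 * (\sum_j slope K i 0 j * x 0 j) +
      1 * invmx (homog K) (lshift d.+1 (0 : 'I_1)) i).
    by apply/funext => z; rewrite bary_affine !mul1r.
  apply: smooth_continuous; apply: smooth_lin; last exact: smooth_cst.
  by apply: smooth_sum => j; have [] := partial_coord j (0 : 'rV[R]_d.+1).
have : nbhs y ((fun x => bary K x 0 i) @^-1` [set t | 0 < t]).
  by apply: cb; apply: open_nbhs_nbhs; split; [exact: open_gt|exact: H].
exact.
Qed.

End Barycentric.

Section Hulls.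
Context {R : realType}.

Lemma continuous_mulmx k n (A : 'M[R]_(k, n.+1)) :
  continuous (fun c : 'rV[R]_k => c *m A).
Proof.
have -> : (fun c : 'rV[R]_k => c *m A) = (fun c => \sum_i c 0 i *: row i A).
  by apply/funext => c; rewrite mulmx_sum_row.
have ce i : continuous (fun c : 'rV[R]_k => c 0 i *: row i A).
  by move=> c; apply: continuousZr_tmp; exact: coord_continuous.
move=> c; elim: (index_enum _) => [|i s IH].
  rewrite (_ : (fun _ => _) = (fun=> 0)); first exact: cst_continuous.
  by apply/funext => x; rewrite big_nil.
rewrite (_ : (fun _ => _) = (fun x : 'rV[R]_k => x 0 i *: row i A + \sum_(j <- s) x 0 j *: row j A)).
  exact: (cvgD (ce i c) IH).
by apply/funext => x; rewrite big_cons.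
Qed.

(** The image of the standard simplex, a closed subset of the unit cube. *)
Lemma hull_compact k n (A : 'M[R]_(k, n.+1)) : compact (hull A).
Proof.
apply: continuous_compact; first by apply: continuous_subspaceT; exact: continuous_mulmx.
apply: (subclosed_compact _ (@cbox_compact R k 0 (const_mx 1))).
  have -> : [set c : 'rV[R]_k | (forall i, 0 <= c 0 i) /\ \sum_i c 0 i = 1] =
     (\bigcap_i ((fun c : 'rV[R]_k => c 0 i) @^-1` [set t | 0 <= t])) `&`
     ((fun c : 'rV[R]_k => (c *m (const_mx 1 : 'cV[R]_k)) 0 0) @^-1` [set t | t = 1]).
    apply/seteqP; split => c /=.
      by move=> [c0 c1]; split=> [i _|]; [exact: c0|rewrite mulmx_const1 mxE].
    by move=> [c0]; rewrite mulmx_const1 mxE => c1; split=> // i; exact: c0.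
  apply: closedI.
    apply: closed_bigI => i _; apply: preimage_closed; last exact: closed_ge.
    by move=> c _; exact: coord_continuous.
  apply: preimage_closed; last exact: closed_eq.
  move=> c _; apply: (@continuous_comp _ _ _ (fun c : 'rV[R]_k => c *m (const_mx 1 : 'cV[R]_k)) (fun M : 'M[R]_1 => M 0 0)).
    exact: continuous_mulmx.
  exact: coord_continuous.
move=> c [c0 c1] i; rewrite !mxE c0 /= -c1 (bigD1 i)//= lerDl.
by apply: sumr_ge0 => j _; exact: c0.
Qed.

Lemma hull_closed k n (A : 'M[R]_(k, n.+1)) : closed (hull A).
Proof. by apply: compact_closed_rV; exact: hull_compact. Qed.

Lemma cubeR_le n (M M' : R) : M <= M' -> @cubeR R n M `<=` cubeR M'.
Proof.
move=> MM x Hx i; have := Hx i; rewrite !mxE => /andP[a b].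
by rewrite (le_lt_trans _ a) ?lerN2//= (lt_le_trans b).
Qed.

Lemma hulls_cube_bounded k n (T : seq 'M[R]_(k, n.+1)) :
  cube_bounded [set x | exists2 A, A \in T & hull A x].
Proof.
elim: T => [|A T [M HM]]; first by exists 0 => x [].
have [M' HM'] := compact_cube (@hull_compact _ _ A).
exists (Num.max M M') => x [B]; rewrite inE => /predU1P[->|BT] hx.
  by apply: (cubeR_le (M := M')); [rewrite le_max lexx orbT|exact: HM'].
by apply: (cubeR_le (M := M)); [rewrite le_max lexx|apply: HM; exists B].
Qed.

(** The supremum of a set that is empty or unbounded is zero by convention. *)
Lemma diam_ge0 n (G : set 'rV[R]_n) : 0 <= diam G.
Proof.
rewrite /diam; set S := [set _ | _].
have [hS|/sup_out->//] := pselect (has_sup S).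
have [r [x [y [Gx Gy re]]]] := hS.1.
apply: le_trans (_ : r <= _); first by rewrite re /enorm sqrtr_ge0.
by apply: ub_le_sup; [exact: hS.2|exists x, y].
Qed.

End Hulls.

Section NullBoundaries.
Context {R : realType} {d : nat} {E : euclid R d.+1}.
Hypothesis LL : lebesgue_like E.
Implicit Types (K : 'M[R]_(d.+2, d.+1)) (G : set 'rV[R]_d.+1).

Lemma ae_hyper (m : 'rV[R]_d.+1) (c : R) : m != 0 ->
  ae_on E setT (fun x => \sum_i m 0 i * x 0 i != c).
Proof.
move=> m0; exists (@ept _ _ E @^-1` [set x | \sum_i m 0 i * x 0 i = c]); split.
- have cf : continuous (fun x : 'rV[R]_d.+1 => \sum_i m 0 i * x 0 i).
    apply: smooth_continuous; apply: smooth_sum => j.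
    by have [] := partial_coord j (0 : 'rV[R]_d.+1).
  apply: (mdom_closed LL); apply: (@preimage_closed _ _ _ [set t | t = c]); last exact: closed_eq.
  by move=> x _; exact: cf.
- exact: (ll_hyper LL).
- by move=> p /= h; apply: contrapT => np; apply: h => _; apply/eqP.
Qed.

(** The points of a simplex outside its interior have a vanishing barycentric
    coordinate, hence lie in finitely many hyperplanes. *)
Lemma ae_hull_elt K : aff_indep K -> ae_on E setT (fun x => hull K x -> elt K x).
Proof.
move=> aK; have : ae_on E setT (fun x => forall i, bary K x 0 i != 0).
  apply: ae_on_fin => i.
  apply: ae_onS (ae_hyper (- invmx (homog K) (lshift d.+1 (0 : 'I_1)) i) (slope_neq0 i aK)).
  by move=> x _; rewrite bary_affine addr_eq0.
apply: ae_onS => x _ b0 /(hull_bary _ aK) h; apply: bary_pos_elt => // i.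
by rewrite lt0r b0 h.
Qed.

Lemma ae_hulls_elt (T : seq 'M[R]_(d.+2, d.+1)) : (forall K, K \in T -> aff_indep K) ->
  ae_on E setT (fun x => (exists2 K, K \in T & hull K x) -> exists2 K, K \in T & elt K x).
Proof.
elim: T => [|K T IH] aT; first by apply: ae_onT => x _ [].
have {}IH := IH (fun A h => aT A (@mem_behead _ (K :: T) A h)).
apply: ae_onS (ae_onI IH (ae_hull_elt (aT K (mem_head _ _)))) => x _ [H1 H2] [A].
rewrite inE => /predU1P[->|AT] hx; first by exists K; rewrite ?mem_head//; exact: H2.
have [|B BT Bx] := H1; first by exists A.
by exists B => //; rewrite inE BT orbT.
Qed.

(** The closure is a finite union of simplices, and their interiors lie in the interior
    of the closure, which is [G] for lack of slits. *)
Lemma ae_closure G : polyhedral_domain G ->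
  ae_on E setT (fun x => closure G x -> G x).
Proof.
move=> [oG _ _ iG [T [aT cT]]].
apply: ae_onS (ae_hulls_elt aT) => x _ H cx; have [|K KT Kx] := H.
  by move: cx; rewrite cT.
rewrite -iG; apply: interiorS Kx => y hy.
by rewrite cT; exists K.
Qed.

Lemma closure_cube_bounded G : polyhedral_domain G -> cube_bounded (closure G).
Proof. by move=> [_ _ _ _ [T [_ ->]]]; exact: hulls_cube_bounded. Qed.

Lemma domain_cube_bounded G : polyhedral_domain G -> cube_bounded G.
Proof.
move=> /closure_cube_bounded[M HM]; exists M.
by apply: subset_trans HM; exact: subset_closure.
Qed.

Section Mesh.
Variables (G : set 'rV[R]_d.+1) (T : seq 'M[R]_(d.+2, d.+1)).
Hypotheses (pG : polyhedral_domain G) (tG : triangulation G T).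

Lemma domain_open : open G. Proof. by case: pG. Qed.

Lemma domain_mdom : mdom E G. Proof. by apply: mdom_open => //; exact: domain_open. Qed.

Lemma elt_mdom K : mdom E (elt K).
Proof. by apply: mdom_open => //; exact: open_interior. Qed.

Lemma elt_sub K : K \in T -> elt K `<=` G.
Proof.
move=> KT; have [_ _ _ iG _] := pG; rewrite -iG; apply: interiorS => x hx.
by have [_ _ -> _] := tG; exists K.
Qed.

Lemma elt_cube_bounded K : K \in T -> cube_bounded (elt K).
Proof.
move=> KT; have [M HM] := domain_cube_bounded pG; exists M.
by apply: subset_trans HM; exact: elt_sub.
Qed.

Lemma ae_mesh : ae_on E G (fun x => exists2 K, K \in T & elt K x).
Proof.
have [_ aT cT _] := tG.
apply: (ae1 (ae_hulls_elt aT)) => p H Gp; apply: H => //.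
by have := subset_closure Gp; rewrite cT.
Qed.

(** The open elements are disjoint and fill the domain up to a null set, so that almost
    everywhere exactly one summand is nonzero. *)
Lemma ae_mesh_sum (f : 'rV[R]_d.+1 -> R) :
  ae_on E G (fun x => \sum_(K <- T | K \in T) (if `[< elt K x >] then f x else 0) = f x).
Proof.
have [uT _ _ dT] := tG.
apply: ae_onS ae_mesh => x _ [K KT Kx].
rewrite -big_seq (bigD1_seq K)//= asboolT// big_seq_cond big1 ?addr0// => A /andP[AT AK].
rewrite asboolF// => Ax; have [d0 _] := dT _ _ AT KT AK.
by have : (interior (hull A) `&` interior (hull K)) x by []; rewrite d0.
Qed.

Lemma rint_mesh f : intg E G f -> rint E G f = \sum_(K <- T) rint E (elt K) f.
Proof.
move=> If; rewrite -(rint_ae (ae_mesh_sum f)) rint_sum; first last.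
- move=> K KT; apply: intg_restrict; [exact: elt_mdom|exact: domain_mdom|].
  have [h ih fh] := If; exists h; last by apply: (ae1 fh) => p H /(elt_sub KT).
  apply: integrableS ih; [exact: domain_mdom|exact: elt_mdom|].
  by move=> p; exact: elt_sub.
- exact: domain_mdom.
rewrite -big_seq big_seq [RHS]big_seq; apply: eq_bigr => K KT.
rewrite (rint_supp (elt_sub KT)); last by move=> x _ nx; rewrite asboolF.
by apply: rint_ae; apply: ae_onT => x Kx; rewrite asboolT.
Qed.

Lemma sqi_mesh f : (forall K, K \in T -> sqi E (elt K) f) -> sqi E G f.
Proof.
move=> sf; apply: sqi_ae (ae_mesh_sum f) _.
apply: sqi_sum; first exact: domain_mdom.
by move=> K KT; apply: sqi_restrict; [exact: elt_mdom|exact: domain_mdom|exact: sf].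
Qed.

(** Used in place of [pw_poly] because its closure under linear combinations is
    immediate. *)
Definition pw_smooth (f : 'rV[R]_d.+1 -> R) : Prop :=
  meas_on E G f /\
  forall K, K \in T -> exists p, smooth p /\ forall x, elt K x -> f x = p x.

Lemma pw_poly_smooth f : pw_poly E G T f -> pw_smooth f.
Proof.
move=> [mf pf]; split=> // K /pf[p [pp fp]].
by exists p; split=> //; exact: smooth_polynomial.
Qed.

Lemma pw_smooth0 : pw_smooth (fun=> 0).
Proof.
split; first exact: measurable_cst.
by move=> K _; exists (fun=> 0); split=> //; exact: smooth_cst.
Qed.

Lemma pw_smooth_lin (a b : R) f h : pw_smooth f -> pw_smooth h ->
  pw_smooth (fun x => a * f x + b * h x).
Proof.
move=> [mf pf] [mh ph]; split.
  by apply: measurable_funD; apply: measurable_funM.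
move=> K KT; have [p [sp fp]] := pf K KT; have [q [sq hq]] := ph K KT.
exists (fun x => a * p x + b * q x); split; first exact: smooth_lin.
by move=> x Kx; rewrite fp ?hq.
Qed.

Lemma smooth_sqi_elt K (p : 'rV[R]_d.+1 -> R) : K \in T -> smooth p -> sqi E (elt K) p.
Proof.
move=> KT sp; apply: sqi_continuous => //; [exact: elt_mdom|exact: elt_cube_bounded|].
exact: smooth_continuous.
Qed.

Lemma pw_smooth_L2 f : pw_smooth f -> L2 E G f.
Proof.
move=> [mf pf]; apply: sqi_L2 => //; apply: sqi_mesh => K KT.
have [p [sp fp]] := pf K KT.
apply: sqi_ae (smooth_sqi_elt KT sp).
by apply: ae_onT => x /fp.
Qed.

End Mesh.
End NullBoundaries.
(** * Fractional Sobolev spaces on subdomains *)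

Section SlobodeckijSpaces.
Context {R : realType} {n : nat} {E : euclid R n.+1}.
Hypothesis LL : lebesgue_like E.
Implicit Types (G : set 'rV[R]_n.+1) (u : 'rV[R]_n.+1 -> R).

Transparent eint.

(** Like [integral_ae], for arbitrary functions: the inner integrals of the double
    integrals below are compared without proving that they depend measurably on the
    outer variable. *)
Lemma eint_le_sub G G' (f h : 'rV[R]_n.+1 -> \bar R) :
  (forall x, (0 <= f x)%E) -> (forall x, (0 <= h x)%E) -> G' `<=` G ->
  (forall x, G' x -> (f x <= h x)%E) -> (eint E G' f <= eint E G h)%E.
Proof.
move=> f0 h0 sG fh; rewrite /eint integral_mkcond [leRHS]integral_mkcond.
have pos (D : set (esort E)) (k : esort E -> \bar R) : (forall x, (0 <= k x)%E) ->
    forall x, (0 <= (k \_ D) x)%E.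
  by move=> k0 x; rewrite patchE; case: ifP.
rewrite !ge0_integralTE; try by apply: pos.
apply: ereal_sup_le => _ [k /= kf <-].
exists k => // p.
apply: le_trans (kf p) _; rewrite !patchE.
case: ifP => [/set_mem /= Gp|_]; first by rewrite mem_set ?fh//=; exact: sG.
by case: ifP.
Qed.

Lemma slobodeckij_le G G' theta u u' : G' `<=` G ->
  ae_on E G' (fun x => u' x = u x) ->
  (slobodeckij E G' theta u' <= slobodeckij E G theta u)%E.
Proof.
move=> sG uu.
have pos (w : 'rV[R]_n.+1 -> R) x y :
    (0 <= ((w x - w y) ^+ 2 / (enorm (x - y) `^ (n.+1%:R + 2 * theta)))%:E)%E.
  by rewrite lee_fin divr_ge0 ?sqr_ge0 ?powR_ge0.
have pos' D (w : 'rV[R]_n.+1 -> R) x : (0 <= eint E D (fun y =>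
    ((w x - w y) ^+ 2 / (enorm (x - y) `^ (n.+1%:R + 2 * theta)))%:E))%E.
  by apply: integral_ge0 => p _; exact: pos.
rewrite /slobodeckij (_ : eint E G' _ = eint E G' (fun x => eint E G' (fun y =>
    ((u x - u y) ^+ 2 / (enorm (x - y) `^ (n.+1%:R + 2 * theta)))%:E))).
  apply: eint_le_sub => // x _; exact: eint_le_sub.
apply: eint_ae; apply: ae_onS (uu) => x _ ux; apply: eint_ae.
by apply: ae_onS uu => y _ uy; rewrite ux uy.
Qed.

Lemma slobodeckij0 G theta u : ae_on E G (fun x => u x = 0) ->
  slobodeckij E G theta u = 0%E.
Proof.
move=> u0; rewrite /slobodeckij (@eint_ae _ _ _ _ _ (fun=> 0%E)).
  by rewrite /eint integral0.
apply: ae_onS (u0) => x _ ux; rewrite (@eint_ae _ _ _ _ _ (fun=> 0%E)).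
  by rewrite /eint integral0.
by apply: ae_onS u0 => y _ uy; rewrite ux uy subrr expr0n mul0r.
Qed.

Opaque eint.

Lemma L2_eq G u u' : (forall x, G x -> u x = u' x) -> L2 E G u -> L2 E G u'.
Proof.
move=> uu [mu u2]; split.
  by apply: eq_measurable_fun mu => p /set_mem /= /uu.
by rewrite -(@eint_ae _ _ _ _ (fun x => (u x ^+ 2)%:E))//; apply: ae_onT => x /uu ->.
Qed.

Lemma Hs_eq G s u u' : (forall x, G x -> u x = u' x) ->
  Hs E G s u -> Hs E G s u'.
Proof.
move=> uu [[Lu du] su]; split; last first.
  by move=> h a; rewrite -(wderiv_eq a uu); exact: su.
split; first exact: L2_eq uu Lu.
by move=> a ha; apply: (has_wderiv_eq uu); exact: du.
Qed.

Lemma Hs_sub G G' s u : open G -> open G' -> G' `<=` G -> Hs E G s u -> Hs E G' s u.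
Proof.
move=> oG oG' sG [[Lu du] su]; split.
  split; first exact: (L2_sub LL oG (mdom_open LL oG') sG).
  by move=> a ha; apply: (has_wderiv_sub LL oG oG' sG); exact: du.
move=> h a; apply: le_lt_trans (su h a); apply: slobodeckij_le => //.
by apply: (wderiv_sub LL oG oG' sG); apply: du; rewrite size_tuple.
Qed.

Lemma Hs_zero G s u : open G -> (forall x, G x -> u x = 0) ->
  Hs E G s u /\ Hs_norm2 E G s u = 0.
Proof.
move=> oG u0; have w0 a := wderiv0_ae LL oG a (ae_onT E u0).
split.
  split; last by move=> _ a; rewrite slobodeckij0.
  split; first by apply: (L2_eq (u := fun=> 0) _ (L2_0 G)) => x /u0.
  by move=> a _; apply: has_wderiv0; exact: ae_onT.
rewrite /Hs_norm2 /norm2 /semi2 big1 => [|k _]; last first.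
  rewrite big1// => a _; apply: rint0_ae; apply: ae_onS (w0 a) => x _ ->.
  by rewrite expr0n.
by rewrite add0r; case: ifP => // _; rewrite big1// => a _; rewrite slobodeckij0.
Qed.

End SlobodeckijSpaces.

(** * Weak divergence *)

Section WeakDivergence.
Context {R : realType}.
Let LL := @lebesgue_like_E3 R.
Local Notation E := (E3 R).
Implicit Types (t s : 'rV[R]_3 -> 'M[R]_3) (w : 'rV[R]_3 -> 'rV[R]_3).

Definition has_wdiv (G : set 'rV[R]_3) t := exists w, L2v E G w /\ weak_div G t w.

Section OnDomain.
Variable G : set 'rV[R]_3.
Hypothesis oG : open G.
Let mG : mdom E G := mdom_open LL oG.

Lemma wdivP t : has_wdiv G t -> L2v E G (wdiv G t) /\ weak_div G t (wdiv G t).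
Proof. by move=> H; have := xgetPex (fun=> 0) H. Qed.

Lemma wdiv_sqi t i : has_wdiv G t -> sqi E G (cmp (wdiv G t) i).
Proof. by move=> /wdivP[H _]; apply: L2_sqi. Qed.

(** Each component of the difference is orthogonal to the bumps. *)
Lemma weak_div_unique t w w' : L2v E G w -> L2v E G w' ->
  weak_div G t w -> weak_div G t w' -> ae_on E G (fun x => w x = w' x).
Proof.
move=> Lw Lw' dw dw'.
have H i : ae_on E G (fun x => w x 0 i = w' x 0 i).
  have sw := L2_sqi mG (Lw i); have sw' := L2_sqi mG (Lw' i).
  have : ae_on E G (fun x => 1 * cmp w i x + (-1) * cmp w' i x = 0).
    apply: (ae_zero LL oG); first exact: sqi_lin.
    move=> a b k sub; have tb := test_fun_box_bump k sub.
    have sb := sqi_test LL mG tb.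
    have := ip_linl 1 (-1) mG sw sw' sb; rewrite /ip => ->.
    have := dw i _ tb; rewrite (dw' i _ tb) => /oppr_inj.
    by rewrite /cmp => ->; rewrite mul1r mulN1r subrr.
  by apply: ae_onS => x _ /eqP; rewrite mul1r mulN1r subr_eq0 => /eqP.
by apply: ae_onS (ae_on_fin H) => x _ h; apply/rowP.
Qed.

Lemma wdiv_ae t w : L2v E G w -> weak_div G t w -> ae_on E G (fun x => wdiv G t x = w x).
Proof.
move=> Lw dw; have [|L d] := @wdivP t; first by exists w.
exact: weak_div_unique L Lw d dw.
Qed.

Definition mat_sqi t := forall i j, sqi E G (mcmp t i j).

Lemma weak_div_sum t i phi : mat_sqi t -> test_fun G phi ->
  rint E G (fun x => \sum_j t x i j * partial j phi x) =
  \sum_j ip E G (mcmp t i j) (partial j phi).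
Proof.
move=> st tp; rewrite rint_sum//; last first.
  move=> j _; apply: (@sqi_intgM _ _ _ G (mcmp t i j)) => //.
  by apply: (sqi_test LL mG); exact: test_fun_partial.
Qed.

(** The integrability of the entries of [s] and [t] is what allows to split the integral
    of the product with the gradient of a test function. *)
Lemma has_wdiv_lin (a b : R) s t : mat_sqi s -> mat_sqi t ->
  has_wdiv G s -> has_wdiv G t ->
  has_wdiv G (fun x => a *: s x + b *: t x) /\
  ae_on E G (fun x => wdiv G (fun x => a *: s x + b *: t x) x =
                      a *: wdiv G s x + b *: wdiv G t x).
Proof.
move=> ss st hs ht; have [Ls ds] := wdivP hs; have [Lt dt] := wdivP ht.
have LL2 : L2v E G (fun x => a *: wdiv G s x + b *: wdiv G t x).
  move=> i; apply: (L2_eq (u := fun x => a * cmp (wdiv G s) i x + b * cmp (wdiv G t) i x)).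
    by move=> x _; rewrite /cmp !mxE.
  exact: L2_lin (Ls i) (Lt i).
have wd : weak_div G (fun x => a *: s x + b *: t x) (fun x => a *: wdiv G s x + b *: wdiv G t x).
  move=> i phi tp.
  have sp := sqi_test LL mG tp.
  have := ip_linl a b mG (L2_sqi mG (Ls i)) (L2_sqi mG (Lt i)) sp.
  rewrite /ip => e1.
  have -> : rint E G (fun x => (a *: wdiv G s x + b *: wdiv G t x) 0 i * phi x) =
      a * rint E G (fun x => wdiv G s x 0 i * phi x) + b * rint E G (fun x => wdiv G t x 0 i * phi x).
    rewrite -e1; apply: rint_ae; apply: ae_onT => x _.
    by rewrite /cmp !mxE.
  have stl : mat_sqi (fun x => a *: s x + b *: t x).
    move=> k j; apply: sqi_ae (sqi_lin a b mG (ss k j) (st k j)).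
    by apply: ae_onT => x _; rewrite /mcmp !mxE.
  have es := etrans (esym (weak_div_sum i ss tp)) (ds i _ tp).
  have et := etrans (esym (weak_div_sum i st tp)) (dt i _ tp).
  have aux (A B : R) : - (a * A + b * B) = a * - A + b * - B by ring.
  have es' := etrans (aux _ _) (congr2 (fun x y => a * x + b * y) (esym es) (esym et)).
  refine (etrans (weak_div_sum i stl tp) (etrans _ (esym es'))).
  rewrite !mulr_sumr -big_split; apply: eq_bigr => j _.
  have sd : sqi E G (partial j phi).
    by apply: (sqi_test LL mG); exact: test_fun_partial.
  apply: etrans (ip_linl a b mG (ss i j) (st i j) sd).
  by apply: ip_ae; apply: ae_onT => x _; rewrite /mcmp ?mxE.
by split; [eexists; split; [exact: LL2|exact: wd]|exact: wdiv_ae].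
Qed.

Lemma wdiv_ae0 t : ae_on E G (fun x => t x = 0) ->
  has_wdiv G t /\ ae_on E G (fun x => wdiv G t x = 0).
Proof.
move=> t0; have L0 : L2v E G (fun=> 0 : 'rV[R]_3).
  by move=> i; apply: (L2_eq (u := fun=> 0) _ (L2_0 G)) => x _; rewrite /cmp mxE.
have d0 : weak_div G t (fun=> 0 : 'rV[R]_3).
  move=> i phi _; rewrite [X in - X]rint0_ae ?oppr0; last first.
    by apply: ae_onT => x _; rewrite mxE mul0r.
  apply: rint0_ae; apply: ae_onS t0 => x _ ->.
  by rewrite big1// => j _; rewrite mxE mul0r.
by split; [exists (fun=> 0)|exact: wdiv_ae].
Qed.

(** On an element, a finite element stress has a classical divergence. *)
Lemma has_wdiv_smooth t : cube_bounded G ->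
  (forall i j, exists p, smooth p /\ forall x, G x -> t x i j = p x) -> has_wdiv G t.
Proof.
move=> bG pt.
have /choice[p Hp] : forall ij : 'I_3 * 'I_3, exists p : 'rV[R]_3 -> R, smooth p /\ forall x, G x -> t x ij.1 ij.2 = p x.
  by move=> [i j]; exact: pt.
have sp i j : smooth (p (i, j)) by case: (Hp (i, j)).
have sd i j : smooth (partial j (p (i, j))) by exact: smooth_partial.
have st : mat_sqi t.
  move=> i j; apply: (@sqi_ae _ _ _ _ (p (i, j))).
    by apply: ae_onT => x Gx; rewrite /mcmp; have [_ /= ->] := Hp (i, j).
  by apply: (sqi_continuous LL) => //; exact: smooth_continuous.
exists (fun x => \row_i \sum_j partial j (p (i, j)) x); split.
  move=> i; apply: (L2_eq (u := fun x => \sum_j 1 * partial j (p (i, j)) x)).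
    by move=> x _; rewrite /cmp mxE; apply: eq_bigr => j _; rewrite mul1r.
  apply: (L2_continuous LL) => //; apply: smooth_continuous.
  by apply: smooth_sum => j; exact: sd.
move=> i phi tp; rewrite weak_div_sum//.
rewrite (_ : rint E G _ = \sum_j rint E G (fun x => partial j (p (i, j)) x * phi x)).
  rewrite -sumrN; apply: eq_bigr => j _.
  rewrite -(rint_by_parts LL)//; apply: rint_ae; apply: ae_onT => x Gx.
  by rewrite /mcmp; have [_ ->] := Hp (i, j).
rewrite -rint_sum//.
  by apply: rint_ae; apply: ae_onT => x _; rewrite mxE mulr_suml.
move=> j _; apply: sqi_intgM => //; last exact: (sqi_test LL mG).
by apply: (sqi_continuous LL) => //; exact: smooth_continuous.
Qed.

Lemma weak_div_sub (G' : set 'rV[R]_3) t w : G' `<=` G ->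
  weak_div G t w -> weak_div G' t w.
Proof.
move=> sG d i phi tphi; have [_ [K [cK KG p0]]] := tphi.
have := d i phi (test_fun_sub sG tphi).
rewrite (rint_supp sG); last first.
  move=> x _ nG; rewrite big1// => j _.
  rewrite (partial_supp j (compact_closed_rV cK) p0) ?mulr0//.
  by move=> /KG.
by rewrite (rint_supp sG)// => x _ nG; rewrite p0 ?mulr0// => /KG.
Qed.

Lemma wdiv_sub (G' : set 'rV[R]_3) t : open G' -> G' `<=` G -> has_wdiv G t ->
  has_wdiv G' t.
Proof.
move=> oG' sG /wdivP[L d]; exists (wdiv G t); split; last exact: weak_div_sub d.
by move=> i; apply: (L2_sub LL oG (mdom_open LL oG') sG); exact: L.
Qed.

End OnDomain.

Lemma wdiv_sub_ae G (G' : set 'rV[R]_3) t : open G -> open G' -> G' `<=` G ->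
  has_wdiv G t -> ae_on E G' (fun x => wdiv G' t x = wdiv G t x).
Proof.
move=> oG oG' sG /wdivP[L d]; apply: wdiv_ae => //; last exact: weak_div_sub d.
by move=> i; apply: (L2_sub LL oG (mdom_open LL oG') sG); exact: L.
Qed.

End WeakDivergence.

(** * Traces on faces *)

Section FaceTraces.
Context {R : realType}.
Let LL2 := @lebesgue_like_E2 R.
Let LL3 := @lebesgue_like_E3 R.

Lemma embed_continuous : continuous (@embed R).
Proof.
have -> : @embed R = lift_z 0 by apply/funext => x; apply/rowP => i; rewrite !mxE.
exact: lift_z_continuous.
Qed.

Lemma embed_inj : injective (@embed R).
Proof.
move=> x y e; apply/rowP => -[[|[|]]]// i.
  have := congr1 (fun v : 'rV[R]_3 => v 0 0) e; rewrite !mxE /=.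
  by rewrite (_ : Ordinal i = 0)//; apply: val_inj.
have := congr1 (fun v : 'rV[R]_3 => v 0 1) e; rewrite !mxE /=.
by rewrite (_ : Ordinal i = 1)//; apply: val_inj.
Qed.

Lemma embed_out (x : 'rV[R]_2) : embed x 0 out = 0.
Proof. by rewrite mxE. Qed.

Lemma face2_mdom (K : 'M[R]_(4, 3)) i : mdom (E2 R) (face2 K i).
Proof.
apply: (mdom_closed LL2); apply: preimage_closed; last exact: hull_closed.
by move=> x _; exact: embed_continuous.
Qed.

Lemma row_hull k d (A : 'M[R]_(k, d)) i : hull A (row i A).
Proof.
exists (delta_mx 0 i); last by rewrite -rowE.
split=> [j|]; first by rewrite mxE ler0n.
rewrite (bigD1 i)//= mxE !eqxx big1 ?addr0// => j ji.
by rewrite mxE (negbTE ji).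
Qed.

Section InterfaceFaces.
Variables (P : problem R) (K : 'M[R]_(4, 3)) (i : 'I_4).
Hypotheses (hP : problem_ok P) (hi : in_Gam P K i).

(** The vertices of a face in the interface have height zero, as required for the
    existence of the trace operator of the face. *)
Lemma in_Gam_plane j : j != i -> K j out = 0.
Proof.
rewrite eq_sym => ji; have [k -> _] := unlift_some ji.
have /asboolP h := hi; have [y _ e] := h _ (row_hull (face K i) k).
have := congr1 (fun v : 'rV[R]_3 => v 0 out) e.
by rewrite embed_out !mxE => <-.
Qed.

Lemma face2_sub : face2 K i `<=` closure (Gam P).
Proof.
move=> x hx; have /asboolP h := hi; have [y cy e] := h _ hx.
by rewrite -(embed_inj e).
Qed.

Lemma face2_bounded : cube_bounded (face2 K i).
Proof.
have [[_ _ pG] _] := hP; have [M HM] := closure_cube_bounded pG.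
by exists M; apply: subset_trans HM; exact: face2_sub.
Qed.

(** The face lies in the closure of the interface, which exceeds the interface, a part of
    the plate, by a null set only. *)
Lemma face2_beta : ae_on (E2 R) setT (fun x => face2 K i x -> beta P x).
Proof.
have [[_ _ pG] [[Gb _] _]] := hP.
apply: ae_onS (ae_closure LL2 pG) => x _ h hx; apply: Gb; apply: h.
exact: face2_sub.
Qed.

End InterfaceFaces.

Section TraceOperator.
Variables (s : R) (K : 'M[R]_(4, 3)) (i : 'I_4).
Variable g : ('rV[R]_3 -> R) -> 'rV[R]_2 -> R.
Hypothesis tg : trace_operator s K i g.
Let oK : open (elt K). Proof. exact: open_interior. Qed.

(** A function vanishing in the open element has norm zero in H^s, whatever its values on
    the skeleton; since the trace is bounded, it depends only on the values in the
    element. *)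
Lemma trace_zero u : (forall x, elt K x -> u x = 0) ->
  ae_on (E2 R) (face2 K i) (fun x => g u x = 0).
Proof.
move=> u0; have [Hu n0] := Hs_zero LL3 s oK u0.
have [t1 _ [C C0 t3] _] := tg.
apply: nrm0_ae; first exact: face2_mdom.
  by apply: L2_sqi; [exact: face2_mdom|exact: t1].
apply/le_anti; rewrite nrm_ge0 andbT.
have := t3 u Hu; rewrite n0 sqrtr0 mulr0 => h; apply: le_trans h.
by rewrite /nrm /ip; under eq_fun do rewrite -expr2.
Qed.

(** The extension property of the trace concerns a sum [u + p] of functions on the whole
    space, while [f] equals [u + p] in the element only. It is applied to [f - p] in
    place of [u], which has the same trace by [trace_zero]. *)
Lemma trace_affine f u p : Hs (E3 R) (elt K) s u -> smooth p ->
  (forall x, elt K x -> f x = u x + p x) ->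
  ae_on (E2 R) (face2 K i) (fun x => g f x = g u x + p (embed x)).
Proof.
move=> Hu sp fe; have [_ t2 _ t4] := tg.
pose v x := f x - p x.
have Hv : Hs (E3 R) (elt K) s v.
  by apply: (Hs_eq _ Hu) => x Kx; rewrite /v fe// addrK.
have e1 := t4 v p Hv sp.
have -> : f = (fun y => v y + p y) by apply/funext => y; rewrite /v subrK.
have e2 := t2 1 (-1) v u Hv Hu.
have e3 : ae_on (E2 R) (face2 K i) (fun x => g (fun y => 1 * v y + (-1) * u y) x = 0).
  by apply: trace_zero => x Kx; rewrite /v fe//; ring.
apply: ae_onS (ae_onI e1 (ae_onI e2 e3)) => x _ [-> [h2 h3]].
by move: h2; rewrite h3 mul1r mulN1r => /esym/eqP; rewrite subr_eq0 => /eqP ->.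
Qed.

Lemma trace_smooth f p : smooth p -> (forall x, elt K x -> f x = p x) ->
  ae_on (E2 R) (face2 K i) (fun x => g f x = p (embed x)).
Proof.
move=> sp fe; have [H0 _] := @Hs_zero _ _ _ LL3 (elt K) s (fun=> 0) oK (fun _ _ => erefl).
have e1 : ae_on (E2 R) (face2 K i) (fun x => g f x = g (fun=> 0) x + p (embed x)).
  by apply: trace_affine => // x /fe ->; rewrite add0r.
have e2 : ae_on (E2 R) (face2 K i) (fun x => g (fun=> 0) x = 0) by exact: trace_zero.
by apply: ae_onS (ae_onI e1 e2) => x _ [-> ->]; rewrite add0r.
Qed.

End TraceOperator.
End FaceTraces.
(** * Bilinear forms assembled from integrals *)

Section FiniteDimensional.
Context {R : realType}.

Lemma fin_dim_span (X : Type) (U : lmodType R) Q (S : set (X -> U)) :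
  fin_dim_space Q S -> fin_span S.
Proof.
move=> [m [b [_ ->]]]; exists m, b; congr mkset; apply/funext => f.
apply/propext; split=> -[c ->]; exists c; apply/funext => x.
  by rewrite fct_sumE.
by rewrite fct_sumE.
Qed.

(** Passes regularity from the piecewise polynomial generators to the whole space. *)
Lemma fin_dim_ind (X : Type) (U : lmodType R) Q (Q' : (X -> U) -> Prop) (S : set (X -> U)) :
  (forall f, Q f -> Q' f) -> Q' (fun=> 0) ->
  (forall (a b : R) f h, Q' f -> Q' h -> Q' (fun x => a *: f x + b *: h x)) ->
  fin_dim_space Q S -> forall f, S f -> Q' f.
Proof.
move=> QQ Q0 Ql [m [e [Qe ->]]] _ [c ->].
elim: (index_enum _) => [|i r IH].
  by rewrite (_ : (fun _ => _) = (fun=> 0))//; apply/funext => x; rewrite big_nil.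
rewrite (_ : (fun _ => _) = (fun x => c i *: e i x + 1 *: \sum_(j <- r) c j *: e j x)).
  by apply: Ql => //; apply: QQ.
by apply/funext => x; rewrite big_cons scale1r.
Qed.

Lemma fin_span_image (U V : lmodType R) (S : set U) (J : U -> V) :
  (forall a b u v, J (a *: u + b *: v) = a *: J u + b *: J v) ->
  fin_span S -> fin_span (J @` S).
Proof.
move=> Jl [m [e ->]].
have J0 : J 0 = 0 by have := Jl 0 0 0 0; rewrite !scale0r !addr0.
have Js c : J (\sum_(i < m) c i *: e i) = \sum_i c i *: J (e i).
  elim: (index_enum _) => [|i r IH]; first by rewrite !big_nil.
  by rewrite !big_cons -IH; have := Jl (c i) 1 (e i) (\sum_(j <- r) c j *: e j); rewrite !scale1r.
exists m, (J \o e); apply/seteqP; split=> [_ [_ [c ->] <-]|_ [c ->]].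
  by exists c; rewrite Js.
by exists (\sum_i c i *: e i); [exists c|rewrite Js].
Qed.

End FiniteDimensional.

Section Observables.
Context {R : realType}.

(** The functions to which the forms are applied: the discrete functions, one exact field
    [s], and the errors [s - u]. They do not form a space, which is why linearity is
    stated on [S] and, separately, for the differences [s - u]. *)
Definition errs {U : lmodType R} (S : set U) (s : U) : set U :=
  [set u | S u \/ u = s \/ exists2 u', S u' & u = s - u'].

Definition bil_at {U V : lmodType R} (S : set U) (s : U) (W : set V) (f : U -> V -> R) :=
  bil_on S W f /\ forall u v, S u -> W v -> f (s - u) v = f s v - f u v.

Section Field.
Context {n : nat} (E : euclid R n) (D : set 'rV[R]_n).
Hypothesis mD : mdom E D.

(** An observable: a component, a derivative or a trace, whose representative is chosen
    arbitrarily for every function and hence is linear in it up to null sets only. *)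
Definition obs {U : lmodType R} (S : set U) (s : U) (O : U -> 'rV[R]_n -> R) : Prop :=
  [/\ forall u, S u -> sqi E D (O u),
      forall a b u v, S u -> S v ->
        ae_on E D (fun x => O (a *: u + b *: v) x = a * O u x + b * O v x),
      sqi E D (O s) &
      forall u, S u -> ae_on E D (fun x => O (s - u) x = O s x - O u x)].

Lemma sqiB f h : sqi E D f -> sqi E D h -> sqi E D (fun x => f x - h x).
Proof.
move=> sf sh; apply: sqi_ae (sqi_lin 1 (-1) mD sf sh).
by apply: ae_onT => x _; rewrite mul1r mulN1r.
Qed.

Lemma obs_sqi (U : lmodType R) (S : set U) s O u : obs S s O -> errs S s u -> sqi E D (O u).
Proof.
move=> [q1 _ q3 q4] [/q1//|[->//|[u' Su' ->]]].
apply: sqi_ae (sqiB q3 (q1 _ Su')).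
by apply: ae_onS (q4 _ Su') => x _ ->.
Qed.

Lemma obs_lin (U : lmodType R) (S : set U) s (a b : R) O O' : obs S s O -> obs S s O' ->
  obs S s (fun u x => a * O u x + b * O' u x).
Proof.
move=> [q1 q2 q3 q4] [p1 p2 p3 p4]; split.
- by move=> u Su; apply: sqi_lin; auto.
- move=> c d u v Su Sv; apply: ae_onS (ae_onI (q2 c d u v Su Sv) (p2 c d u v Su Sv)).
  by move=> x _ [-> ->]; ring.
- exact: sqi_lin.
- move=> u Su; apply: ae_onS (ae_onI (q4 u Su) (p4 u Su)).
  by move=> x _ [-> ->]; ring.
Qed.

Lemma obsZ (U : lmodType R) (S : set U) s (a : R) O : obs S s O ->
  obs S s (fun u x => a * O u x).
Proof.
move=> o; have := obs_lin a 0 o o.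
by congr obs; apply/funext => u; apply/funext => x; rewrite mul0r addr0.
Qed.

Lemma obs0 (U : lmodType R) (S : set U) s : obs S s (fun _ _ => 0).
Proof.
split=> *; try exact: sqi0; apply: ae_onT => x _; ring.
Qed.

Lemma obs_sum (U : lmodType R) (S : set U) s (I : Type) (r : seq I) O :
  (forall i : I, obs S s (O i)) -> obs S s (fun u x => \sum_(i <- r) O i u x).
Proof.
move=> o; elim: r => [|i r IH].
  have := obs0 S s.
  by congr obs; apply/funext => u; apply/funext => x; rewrite big_nil.
have := obs_lin 1 1 (o i) IH.
by congr obs; apply/funext => u; apply/funext => x; rewrite big_cons !mul1r.
Qed.

(** Integration erases the null sets up to which observables are linear. *)
Lemma bil_at_rint (U V : lmodType R) (S : set U) s (W : set V) w (I : Type) (r : seq I)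
    (O : I -> U -> 'rV[R]_n -> R) (O' : I -> V -> 'rV[R]_n -> R) :
  fin_span S -> fin_span W ->
  (forall i, obs S s (O i)) -> (forall i, obs W w (O' i)) ->
  bil_at S s W (fun u v => rint E D (fun x => \sum_(i <- r) O i u x * O' i v x)).
Proof.
move=> sS sW o o'.
have H u v : errs S s u -> errs W w v ->
    rint E D (fun x => \sum_(i <- r) O i u x * O' i v x) = \sum_(i <- r) ip E D (O i u) (O' i v).
  move=> Su Wv; rewrite rint_sum// => i _.
  by apply: sqi_intgM => //; [exact: obs_sqi (o i) Su|exact: obs_sqi (o' i) Wv].
have inl u : S u -> errs S s u by left.
have inl' u : W u -> errs W w u by left.
split; first split.
- move=> v Wv a b u u' Su Su'; have Sl := fin_span_lin a b sS Su Su'.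
  rewrite !H; try by auto.
  rewrite !mulr_sumr -big_split; apply: eq_bigr => i _.
  have [q1 q2 _ _] := o i; have [p1 _ _ _] := o' i.
  apply: etrans (ip_linl a b mD (q1 u Su) (q1 u' Su') (p1 v Wv)).
  by apply: ip_ae; [exact: q2|exact: ae_onT].
- move=> u Su a b v v' Wv Wv'; have Wl := fin_span_lin a b sW Wv Wv'.
  rewrite !H; try by auto.
  rewrite !mulr_sumr -big_split; apply: eq_bigr => i _.
  have [q1 _ _ _] := o i; have [p1 p2 _ _] := o' i.
  apply: etrans (ip_linr a b mD (p1 v Wv) (p1 v' Wv') (q1 u Su)).
  by apply: ip_ae; [exact: ae_onT|exact: p2].
move=> u v Su Wv; rewrite !H; try by [auto|right; left|right; right; exists u].
rewrite -sumrB; apply: eq_bigr => i _.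
have [q1 _ q3 q4] := o i; have [p1 _ _ _] := o' i.
have := ip_linl 1 (-1) mD q3 (q1 u Su) (p1 v Wv); rewrite mul1r mulN1r => <-.
apply: ip_ae; last exact: ae_onT.
by apply: ae_onS (q4 u Su) => x _ ->; rewrite mul1r mulN1r.
Qed.

End Field.

Lemma obs_null (U : lmodType R) (S : set U) s n (E : euclid R n) D D' O : mdom E D -> mdom E D' ->
  ae_on E setT (fun x => D' x -> D x) -> obs E D S s O -> obs E D' S s O.
Proof.
move=> mD mD' sD [q1 q2 q3 q4].
have ae (Q : 'rV[R]_n -> Prop) : ae_on E D Q -> ae_on E D' Q.
  by move=> h; apply: (ae2 sD h) => p a b Dp; apply: b; exact: a.
split.
- by move=> u /q1; exact: sqi_null.
- by move=> a b u v Su Sv; apply: ae; exact: q2.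
- exact: sqi_null q3.
- by move=> u Su; apply: ae; exact: q4.
Qed.

Lemma obs_subset (U : lmodType R) (S : set U) s n (E : euclid R n) D D' O : mdom E D -> mdom E D' ->
  D' `<=` D -> obs E D S s O -> obs E D' S s O.
Proof. by move=> mD mD' sD; apply: obs_null => //; apply: ae_onT => x _; exact: sD. Qed.

Section Combine.
Context {U V : lmodType R} (S : set U) (s : U) (W : set V).
Implicit Types f h : U -> V -> R.

(** The forms of the method agree with sums of integrals of products of observables only
    for the functions that occur: the compliance formula holds for symmetric stresses. *)
Lemma bil_at_eq f h :
  (forall u v, errs S s u -> W v -> f u v = h u v) ->
  fin_span S -> fin_span W -> bil_at S s W f -> bil_at S s W h.
Proof.
move=> e sS sW [[f1 f2] f3].
have eS u v : S u -> W v -> h u v = f u v by move=> Su Wv; rewrite e//; left.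
split; first split.
- move=> v Wv a b u u' Su Su'; rewrite !eS//; last exact: fin_span_lin.
  exact: f1.
- move=> u Su a b v v' Wv Wv'; rewrite !eS//; last exact: fin_span_lin.
  exact: f2.
move=> u v Su Wv; rewrite (eS u v Su Wv) -!e//; [exact: f3|by right; left|by right; right; exists u].
Qed.

Lemma bil_at_lin (a b : R) f h : bil_at S s W f -> bil_at S s W h ->
  bil_at S s W (fun u v => a * f u v + b * h u v).
Proof.
move=> [[f1 f2] f3] [[h1 h2] h3]; split; first split.
- by move=> v Wv c d u u' Su Su'; rewrite f1// h1//; ring.
- by move=> u Su c d v v' Wv Wv'; rewrite f2// h2//; ring.
by move=> u v Su Wv; rewrite f3// h3//; ring.
Qed.

Lemma bil_at0 : bil_at S s W (fun _ _ => 0).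
Proof. by split; [split=> ? ? ? ? ? ? ? ?; ring|move=> *; ring]. Qed.

Lemma bil_at_sum (I : Type) (r : seq I) (Q : pred I) (F : I -> U -> V -> R) :
  (forall i, Q i -> bil_at S s W (F i)) ->
  bil_at S s W (fun u v => \sum_(i <- r | Q i) F i u v).
Proof.
move=> h; elim: r => [|i r IH].
  have := bil_at0; congr bil_at.
  by apply/funext => u; apply/funext => v; rewrite big_nil.
case Qi : (Q i).
  have := bil_at_lin 1 1 (h i Qi) IH; congr bil_at.
  by apply/funext => u; apply/funext => v; rewrite big_cons Qi !mul1r.
have := IH; congr bil_at.
by apply/funext => u; apply/funext => v; rewrite big_cons Qi.
Qed.

Lemma bil_atZ (a : R) f : bil_at S s W f -> bil_at S s W (fun u v => a * f u v).
Proof.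
move=> hf; have := bil_at_lin a 0 hf hf; congr bil_at.
by apply/funext => u; apply/funext => v; rewrite mul0r addr0.
Qed.

Lemma bil_atD f h : bil_at S s W f -> bil_at S s W h ->
  bil_at S s W (fun u v => f u v + h u v).
Proof.
move=> hf hh; have := bil_at_lin 1 1 hf hh; congr bil_at.
by apply/funext => u; apply/funext => v; rewrite !mul1r.
Qed.

End Combine.
End Observables.
(** * Material law *)

Section MaterialLaw.
Context {R : realType}.
Variables (P : problem R) (hP : problem_ok P).

Definition shear : R := Ea P / (1 + nua P).
Definition bulk : R := Ea P * nua P / ((1 + nua P) * (1 - 2 * nua P)).

Lemma shear_gt0 : 0 < shear.
Proof.
have [_ [_ [[Ea0 _ _] [/andP[n0 n1] _ _]]]] := hP.
by rewrite divr_gt0// addr_gt0.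
Qed.

Lemma bulk_gt0 : 0 < bulk.
Proof.
have [_ [_ [[Ea0 _ _] [/andP[n0 n1] _ _]]]] := hP.
have h : 0 < 1 - 2 * nua P.
  by rewrite subr_gt0 mulrC -ltr_pdivlMr// mul1r.
by apply: divr_gt0; apply: mulr_gt0 => //; apply: addr_gt0.
Qed.

Definition trace_coef : R := bulk / (shear + 3 * bulk).

(** [C0 e = t] determines the trace of [e] and then [e] itself; as the shear and bulk
    coefficients are positive, the resulting matrix is a solution. *)
Lemma C0inv_formula (t : 'M[R]_3) : t^T = t ->
  C0inv P t = shear^-1 *: (t - (trace_coef * \tr t)%:M).
Proof.
move=> ts; have A0 := shear_gt0; have B0 := bulk_gt0.
have A1 : shear != 0 by rewrite gt_eqF.
have AB : shear + 3 * bulk != 0 by rewrite gt_eqF// addr_gt0// mulr_gt0.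
have trC e : \tr (C0 P e) = (shear + 3 * bulk) * \tr e.
  by rewrite /C0 -/shear -/bulk linearD linearZ/= mxtrace_scalar; ring.
have un e : C0 P e = t -> e = shear^-1 *: (t - (trace_coef * \tr t)%:M).
  move=> eC; have te : \tr e = \tr t / (shear + 3 * bulk).
    by rewrite -eC trC mulrAC divff// mul1r.
  rewrite -[in RHS]eC trC.
  apply/matrixP => i j; rewrite /C0 -/shear -/bulk /trace_coef !mxE te.
  by case: (i == j); rewrite ?mulr1n ?mulr0n; field; rewrite ?A1 ?AB.
have ex : exists e, [set e : 'M[R]_3 | e^T = e /\ C0 P e = t] e.
  exists (shear^-1 *: (t - (trace_coef * \tr t)%:M)); split.
    by rewrite linearZ linearB/= ts tr_scalar_mx.
  have te : \tr (shear^-1 *: (t - (trace_coef * \tr t)%:M)) =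
      shear^-1 * (\tr t - trace_coef * \tr t *+ 3).
    by rewrite linearZ/= linearB/= mxtrace_scalar.
  rewrite /C0 -/shear -/bulk te.
  apply/matrixP => i j; rewrite /trace_coef !mxE.
  by case: (i == j); rewrite ?mulr1n ?mulr0n; field; rewrite ?A1 ?AB.
by have [_ h] := xgetPex 0 ex; apply: un.
Qed.

(** The formula for [C0inv], extended linearly to all matrices, whereas [C0inv] itself
    vanishes off the symmetric ones. *)
Definition compliance (tau : 'rV[R]_3 -> 'M[R]_3) (i j : 'I_3) : 'rV[R]_3 -> R :=
  fun x => shear^-1 * mcmp tau i j x +
    - (shear^-1 * trace_coef * (i == j)%:R) * \sum_k mcmp tau k k x.

Lemma C0inv_compliance tau i j x : symv tau -> C0inv P (tau x) i j = compliance tau i j x.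
Proof.
move=> st; rewrite C0inv_formula ?st// !mxE /compliance /mcmp /mxtrace.
by case: (i == j); rewrite ?mulr1n ?mulr0n; ring.
Qed.

End MaterialLaw.

(** * Observables of the discrete spaces *)

(** The zero fields belong to the exact spaces, hence the discrete spaces are contained in
    the sum spaces on which the hypotheses of the method are stated. *)
Section ZeroFields.
Context {R : realType}.
Let LL3 := @lebesgue_like_E3 R.
Let LL2 := @lebesgue_like_E2 R.
Variables (P : problem R) (hP : problem_ok P).

(** Whatever lifting of [gg] the definition selects, if any, both terms of Green's formula
    vanish. *)
Lemma duality0 gg : duality P (fun=> 0) gg = 0.
Proof.
have [[pa _ _] _] := hP; have oa := domain_open pa.
rewrite /duality; set S := [set r | _].
have S0 r : S r -> r = 0.
  move=> [V _ ->]; rewrite rint0_ae ?add0r; last first.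
    apply: ae_onT => x _; rewrite big1// => i _; rewrite big1// => j _.
    by rewrite mxE mul0r.
  apply: rint0_ae.
  have [_ d0] := wdiv_ae0 oa (ae_onT (E3 R) (P := fun=> 0 = 0 :> 'M[R]_3) (fun _ _ => erefl)).
  apply: ae_onS d0 => x _ ->.
  by rewrite big1// => i _; rewrite mxE mul0r.
have [[r Sr]|nS] := pselect (exists r, S r); last by rewrite xgetPN// => r Sr; apply: nS; exists r.
by apply: S0; exact: xgetPex (ex_intro _ r Sr).
Qed.

Lemma Sigma_t0 : Sigma_t P (fun=> 0).
Proof.
have [[pa _ _] _] := hP; have oa := domain_open pa.
have z (i j : 'I_3) x : alpha P x -> mcmp (fun=> 0) i j x = 0 :> R by rewrite /mcmp mxE.
split; last by move=> i j; have [] := Hs_zero LL3 (sreg P) oa (z i j).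
split; last by move=> gg _; exact: duality0.
split; last by have [] := wdiv_ae0 oa (ae_onT (E3 R) (P := fun=> 0 = 0 :> 'M[R]_3) (fun _ _ => erefl)).
  by move=> x; rewrite trmx0.
by move=> i j; apply: (L2_eq (u := fun=> 0) _ (L2_0 _)) => x _; rewrite /mcmp mxE.
Qed.

Lemma norm2_ae0 (u : 'rV[R]_2 -> R) m : ae_on (E2 R) (beta P) (fun x => u x = 0) ->
  norm2 (E2 R) (beta P) m u = 0.
Proof.
have [[_ pb _] _] := hP; have ob := domain_open pb => u0.
rewrite /norm2 big1// => k _; rewrite /semi2 big1// => a _.
apply: rint0_ae; apply: ae_onS (wderiv0_ae LL2 ob a u0) => x _ ->.
by rewrite expr0n.
Qed.

Lemma zero_trace (u : 'rV[R]_2 -> R) A : ae_on (E2 R) (beta P) (fun x => u x = 0) ->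
  has_trace_on (E2 R) (E1 R) (beta P) u A (fun=> 0).
Proof.
move=> u0; exists (fun _ _ => 0); split.
- by move=> k; exact: smooth_cst.
- rewrite (_ : (fun _ => _) = fun=> 0); first exact: cvg_cst.
  apply/funext => k; apply: norm2_ae0; apply: ae_onS u0 => x _ ->.
  by rewrite subrr.
- exact: L2_0.
rewrite (_ : (fun _ => _) = fun=> 0); first exact: cvg_cst.
by apply/funext => k; apply: rint0_ae; apply: ae_onT => y _; rewrite subrr expr0n.
Qed.

Lemma H20_0 : H20 (E2 R) (E1 R) (beta P) (fun=> 0).
Proof.
have [[_ pb _] _] := hP; have ob := domain_open pb.
have a0 : ae_on (E2 R) (beta P) (fun=> 0 = 0 :> R) by exact: ae_onT.
split.
  by split; [exact: L2_0|move=> a _; exact: has_wderiv0].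
move=> A _; split; first exact: zero_trace.
move=> n _ _; apply: zero_trace.
have := ae_on_fin (fun l : 'I_2 => wderiv0_ae LL2 ob [:: l] a0).
by apply: ae_onS => x _ h; rewrite big1// => l _; rewrite h mulr0.
Qed.

Lemma H10_0 : H10 (E2 R) (beta P) (fun=> 0).
Proof.
have a0 : ae_on (E2 R) (beta P) (fun=> 0 = 0 :> R) by exact: ae_onT.
split.
  by split; [exact: L2_0|move=> a _; exact: has_wderiv0].
exists (fun _ _ => 0); split.
  move=> k; split; first exact: smooth_cst.
  by exists set0; split=> //; exact: compact0.
rewrite (_ : (fun _ => _) = fun=> 0); first exact: cvg_cst.
by apply/funext => k; apply: norm2_ae0; apply: ae_onT => x _; rewrite subrr.
Qed.

Lemma W_b0 : W_b P (fun=> 0).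
Proof.
have z i : cmp (fun _ : 'rV[R]_2 => 0 : 'rV[R]_3) i = (fun=> 0).
  by apply/funext => x; rewrite /cmp mxE.
by split=> [I|]; rewrite z; [exact: H10_0|exact: H20_0].
Qed.

End ZeroFields.

Section DiscreteObservables.
Context {R : realType}.
Let LL3 := @lebesgue_like_E3 R.
Let LL2 := @lebesgue_like_E2 R.
Variables (P : problem R) (hP : problem_ok P).
Variable g : 'M[R]_(4, 3) -> 'I_4 -> ('rV[R]_3 -> R) -> 'rV[R]_2 -> R.
Hypothesis hg : trace_operators P g.
Variables (D : @discretization R) (hD : discretization_ok P D).

Local Notation T3 := ('rV[R]_3 -> 'M[R]_3).
Local Notation V3 := ('rV[R]_3 -> 'rV[R]_3).
Local Notation V2 := ('rV[R]_2 -> 'rV[R]_3).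
Local Notation E3 := (E3 R).
Local Notation E2 := (E2 R).

Let pa : polyhedral_domain (alpha P). Proof. by have [[]] := hP. Qed.
Let pb : polyhedral_domain (beta P). Proof. by have [[]] := hP. Qed.
Let ta : triangulation (alpha P) (Ta D). Proof. by have [[]] := hD. Qed.
Let tb : triangulation (beta P) (Tb D). Proof. by have [[]] := hD. Qed.
Let oa := domain_open pa.
Let ob := domain_open pb.
Let ma := domain_mdom LL3 pa.
Let mb := domain_mdom LL2 pb.

Lemma Sh_span : fin_span (Sh D).
Proof. by have [_ [[h _ _ _] _]] := hD; exact: fin_dim_span h. Qed.

Lemma Vh_span : fin_span (Vh D).
Proof. by have [_ [[_ h _ _] _]] := hD; exact: fin_dim_span h. Qed.

Lemma W1h_span : fin_span (W1h D).
Proof. by have [_ [[_ _ h _] _]] := hD; exact: fin_dim_span h. Qed.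

Lemma W2h_span : fin_span (W2h D : set ('rV[R]_2 -> R^o)).
Proof. by have [_ [[_ _ _ h] _]] := hD; exact: fin_dim_span h. Qed.

(** Exhibits the plate displacements as the image of a product space, whence finite
    dimensionality. *)
Definition plate (p : ('rV[R]_2 -> 'rV[R]_2) * ('rV[R]_2 -> R^o)) : V2 :=
  fun x => \row_i if unlift out i is Some J then p.1 x 0 J else p.2 x.

Lemma plate_inp p x I : plate p x 0 (inp I) = p.1 x 0 I.
Proof.
rewrite mxE (_ : inp I = lift out I) ?liftK//.
by apply: val_inj; rewrite /= /bump leqNgt ltn_ord.
Qed.

Lemma plate_out p x : plate p x 0 out = p.2 x.
Proof. by rewrite mxE unlift_none. Qed.

Lemma plate_split (i : 'I_3) : (exists I, i = inp I) \/ i = out.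
Proof.
case: (unliftP out i) => [I ->|->]; [left; exists I|by right].
by apply: val_inj; rewrite /= /bump leqNgt ltn_ord.
Qed.

Lemma W_h_plate : W_h D = plate @` [set p | W1h D p.1 /\ W2h D p.2].
Proof.
apply/seteqP; split=> v.
  move=> [h1 h2]; exists (fun x => \row_I v x 0 (inp I), cmp v out) => //.
  apply/funext => x; apply/rowP => i.
  by have [[I ->]|->] := plate_split i; rewrite ?plate_inp ?plate_out//= mxE.
move=> [[v1 v2] /= [h1 h2] <-]; split.
  rewrite (_ : (fun _ => _) = v1)//; apply/funext => x; apply/rowP => I.
  by rewrite mxE plate_inp.
by rewrite (_ : cmp _ _ = v2)//; apply/funext => x; rewrite /cmp plate_out.
Qed.

Lemma W_h_span : fin_span (W_h D : set V2).
Proof.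
rewrite W_h_plate; apply: fin_span_image; last exact: (fin_span_prod W1h_span W2h_span).
move=> a b u v; apply/funext => x; apply/rowP => i.
have e : (a *: plate u + b *: plate v) x 0 i = a * plate u x 0 i + b * plate v x 0 i.
  by rewrite [LHS]mxE !mxE.
rewrite e; have [[I ->]|->] := plate_split i; rewrite ?plate_inp ?plate_out//=.
by rewrite [LHS]mxE !mxE.
Qed.

Lemma Sh_props tau : Sh D tau -> symv tau /\
  forall i j, pw_smooth (E := E3) (alpha P) (Ta D) (mcmp tau i j).
Proof.
have [_ [[h _ _ _] _]] := hD; move: tau.
apply: (fin_dim_ind (U := 'M[R]_3) _ _ _ h).
- by move=> f [sf pf]; split=> // i j; apply: pw_poly_smooth; exact: pf.
- split=> [x|i j]; first by rewrite trmx0.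
  rewrite (_ : mcmp _ i j = fun=> 0); first exact: pw_smooth0.
  by apply/funext => x; rewrite /mcmp mxE.
move=> a b f k [sf pf] [sk pk]; split=> [x|i j].
  by rewrite linearD !linearZ/= sf sk.
rewrite (_ : mcmp _ i j = fun x => a * mcmp f i j x + b * mcmp k i j x).
  exact: pw_smooth_lin.
by apply/funext => x; rewrite /mcmp !mxE.
Qed.

Lemma W2h_props z : W2h D z -> pw_smooth (E := E2) (beta P) (Tb D) z.
Proof.
have [_ [[_ _ _ h] _]] := hD; move: z.
apply: (fin_dim_ind (U := R^o) _ _ _ h).
- by move=> f; exact: pw_poly_smooth.
- exact: pw_smooth0.
by move=> a b f k; exact: pw_smooth_lin.
Qed.

Lemma Vh_L2 w : Vh D w -> L2v E3 (alpha P) w.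
Proof. by have [_ [_ [[h _] _]]] := hD; exact: h. Qed.

Lemma W_h_H10 v I : W_h D v -> H10 E2 (beta P) (cmp v (inp I)).
Proof.
move=> [h1 _]; have [_ [_ [[_ h] _]]] := hD.
have := h _ h1 I; congr H10; apply/funext => x.
by rewrite /cmp mxE.
Qed.

Section Stress.
Variables (s : T3) (hs : Sigma_t P s).
Local Notation S := (Sh D).

Lemma errs_sym tau : errs (S : set T3) s tau -> symv tau.
Proof.
have [[[ss _ _] _] _] := hs.
move=> [h|[->//|[u h ->]]]; first by have [] := Sh_props h.
by move=> x; have [su _] := Sh_props h; rewrite [(s - u) x]/(s x - u x) linearB/= ss su.
Qed.

Lemma obs_stress i j : obs E3 (alpha P) (S : set T3) s (fun tau => mcmp tau i j).
Proof.
have [[[_ Ls _] _] _] := hs; split.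
- move=> u Su; apply: L2_sqi => //; have [_ h] := Sh_props Su.
  exact: (pw_smooth_L2 LL3 pa ta).
- by move=> a b u v _ _; apply: ae_onT => x _; rewrite /mcmp [LHS]mxE !mxE.
- exact: L2_sqi.
by move=> u Su; apply: ae_onT => x _; rewrite /mcmp [LHS]mxE !mxE.
Qed.

Lemma obs_compliance i j : obs E3 (alpha P) (S : set T3) s (fun tau => compliance P tau i j).
Proof. by apply: obs_lin => //; [|apply: obs_sum => // k]; exact: obs_stress. Qed.

(** The exact stress has a divergence on the element by restriction, the discrete ones
    because they are polynomial there. *)
Lemma obs_wdiv K i : K \in Ta D ->
  obs E3 (elt K) (S : set T3) s (fun tau => cmp (wdiv (elt K) tau) i).
Proof.
move=> KT; have oK : open (elt K) := open_interior _; have mK := elt_mdom LL3 K.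
have sK := elt_sub pa ta KT.
have [[[_ Ls hw] _] _] := hs.
have mu u : S u -> mat_sqi (elt K) u.
  by move=> Su k j; have [h _ _ _] := obs_stress k j; apply: (sqi_sub ma mK sK); exact: h.
have ms : mat_sqi (elt K) s.
  by move=> k j; apply: (sqi_sub ma mK sK); apply: L2_sqi => //; exact: Ls.
have hs' : has_wdiv (elt K) s by apply: (wdiv_sub oa oK sK).
have hu u : S u -> has_wdiv (elt K) u.
  move=> Su; apply: has_wdiv_smooth => //; first exact: (elt_cube_bounded pa ta KT).
  by move=> k j; have [_ h] := Sh_props Su; have [_ /(_ K KT)] := h k j.
have sq t : has_wdiv (elt K) t -> sqi E3 (elt K) (cmp (wdiv (elt K) t) i).
  by move=> h; exact: wdiv_sqi.
split; [by move=> u Su; apply: sq; exact: hu| |exact: sq|].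
- move=> a b u v Su Sv; have [_] := has_wdiv_lin oK a b (mu u Su) (mu v Sv) (hu u Su) (hu v Sv).
  by apply: ae_onS => x _ h; rewrite /cmp [wdiv _ _ x]h !mxE.
move=> u Su; have [_] := has_wdiv_lin oK 1 (-1) ms (mu u Su) hs' (hu u Su).
rewrite (_ : (fun x => 1 *: s x + -1 *: u x) = s - u); last first.
  by apply/funext => x; rewrite scale1r scaleN1r.
by apply: ae_onS => x _ h; rewrite /cmp h !mxE mul1r mulN1r.
Qed.

(** A discrete stress agrees with a smooth function in the open element, so its trace is
    the restriction of that function; the error is the sum of such a function and of the
    exact stress, which belongs to H^s. *)
Lemma obs_trace K i k j : K \in Ta D -> in_Gam P K i ->
  obs E2 (face2 K i) (S : set T3) s (fun tau => g K i (mcmp tau k j)).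
Proof.
move=> KT hi; have [_ aT _ _] := ta.
have tg := hg (aT K KT) (in_Gam_plane hi).
have mF := face2_mdom K i; have bF := face2_bounded hP hi.
have oK : open (elt K) := open_interior _.
have sm u : S u -> exists p, smooth p /\ forall x, elt K x -> mcmp u k j x = p x.
  by move=> Su; have [_ h] := Sh_props Su; have [_ /(_ K KT)] := h k j.
have Hss : Hs E3 (elt K) (sreg P) (mcmp s k j).
  have [_ h] := hs; apply: (Hs_sub LL3 oa oK (elt_sub pa ta KT)); exact: h.
split.
- move=> u Su; have [p [sp up]] := sm u Su.
  apply: (@sqi_ae _ _ _ _ (p \o @embed R)).
    by apply: ae_onS (trace_smooth tg sp up) => x _ ->.
  apply: (sqi_continuous LL2) => // x; apply: continuous_comp; first exact: embed_continuous.
  exact: smooth_continuous.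
- move=> a b u v Su Sv; have [p [sp up]] := sm u Su; have [q [sq vq]] := sm v Sv.
  have e : ae_on E2 (face2 K i) (fun x => g K i (mcmp (a *: u + b *: v) k j) x =
      a * p (embed x) + b * q (embed x)).
    apply: (trace_smooth tg (smooth_lin a b sp sq)) => x Kx.
    by rewrite -up// -vq// /mcmp [LHS]mxE !mxE.
  apply: ae_onS (ae_onI e (ae_onI (trace_smooth tg sp up) (trace_smooth tg sq vq))).
  by move=> x _ [-> [-> ->]].
- by apply: L2_sqi => //; have [h _ _ _] := tg; exact: h.
move=> u Su; have [p [sp up]] := sm u Su.
have e : ae_on E2 (face2 K i) (fun x => g K i (mcmp (s - u) k j) x =
    g K i (mcmp s k j) x + (0 * p (embed x) + (-1) * p (embed x))).
  apply: (trace_affine tg Hss (smooth_lin 0 (-1) sp sp)) => x Kx.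
  by rewrite -up// /mcmp [LHS]mxE !mxE; ring.
apply: ae_onS (ae_onI e (trace_smooth tg sp up)) => x _ [-> ->].
by ring.
Qed.

Lemma obs_ntrace K i k : K \in Ta D -> in_Gam P K i ->
  obs E2 (face2 K i) (S : set T3) s (fun tau => cmp (ntrace g tau K i) k).
Proof.
move=> KT hi; have mF := face2_mdom K i.
have := @obs_sum _ _ E2 (face2 K i) mF T3 S s _ (index_enum 'I_3)
  (fun j tau x => outward_normal K i 0 j * g K i (mcmp tau k j) x).
rewrite (_ : (fun u x => \sum_(i0 <- _) _) = (fun tau => cmp (ntrace g tau K i) k)).
  by apply=> j; apply: obsZ => //; exact: obs_trace.
apply/funext => u; apply/funext => x; rewrite /cmp mxE.
by apply: eq_bigr => j _; rewrite mulrC.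
Qed.

End Stress.

Section Plate.
Variables (w : V2) (hw : W_b P w).
Local Notation W := (W_h D).
Let X := sum_space (H20 E2 (E1 R) (beta P)) (W2h D).

Lemma W_b_L2 i : L2 E2 (beta P) (cmp w i).
Proof.
have [h1 [[h2 _] _]] := hw.
by have [[I ->]|->//] := plate_split i; have [[]] := h1 I.
Qed.

Lemma W_h_L2 v i : W v -> L2 E2 (beta P) (cmp v i).
Proof.
move=> Wv; have [[I ->]|->] := plate_split i.
  by have [[]] := W_h_H10 I Wv.
by apply: (pw_smooth_L2 LL2 pb tb); apply: W2h_props; case: Wv.
Qed.

Lemma obs_disp i : obs E2 (beta P) (W : set V2) w (fun v => cmp v i).
Proof.
split.
- by move=> u Wu; apply: L2_sqi => //; exact: W_h_L2.
- by move=> a b u v _ _; apply: ae_onT => x _; rewrite /cmp [LHS]mxE !mxE.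
- by apply: L2_sqi => //; exact: W_b_L2.
by move=> u Wu; apply: ae_onT => x _; rewrite /cmp [LHS]mxE !mxE.
Qed.

(** Used for first derivatives on the plate and for second ones on the elements. *)
Lemma obs_wderiv G a i : open G -> G `<=` beta P ->
  has_wderiv E2 G a (cmp w i) -> (forall v, W v -> has_wderiv E2 G a (cmp v i)) ->
  obs E2 G (W : set V2) w (fun v => wderiv E2 G a (cmp v i)).
Proof.
move=> oG sG hwd hvd; have mG := mdom_open LL2 oG.
have [q1 _ q3 _] := obs_disp i.
have s1 v : W v -> sqi E2 G (cmp v i) by move=> Wv; apply: (sqi_sub mb mG sG); exact: q1.
have s3 := sqi_sub mb mG sG q3.
split.
- by move=> v Wv; apply: (wderiv_sqi LL2 oG); exact: hvd.
- move=> c d u v Wu Wv.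
  have [_] := has_wderiv_lin LL2 oG c d (s1 u Wu) (s1 v Wv) (hvd u Wu) (hvd v Wv).
  rewrite (_ : (fun x => _ * _ + _) = cmp (c *: u + d *: v) i)//.
  by apply/funext => x; rewrite /cmp [RHS]mxE !mxE.
- exact: (wderiv_sqi LL2 oG).
move=> u Wu; have [_] := has_wderiv_lin LL2 oG 1 (-1) s3 (s1 u Wu) hwd (hvd u Wu).
rewrite (_ : (fun x => 1 * cmp w i x + _) = cmp (w - u) i).
  by apply: ae_onS => x _ ->; rewrite mul1r mulN1r.
by apply/funext => x; rewrite /cmp [RHS]mxE !mxE; ring.
Qed.

Lemma obs_grad I J : obs E2 (beta P) (W : set V2) w (fun v => wderiv E2 (beta P) [:: I] (cmp v (inp J))).
Proof.
apply: obs_wderiv => //.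
  by have [h _] := hw; have [h1 _] := h J; exact: Hm_wderiv h1 _.
by move=> v Wv; have [h1 _] := W_h_H10 J Wv; exact: Hm_wderiv h1 _.
Qed.

Lemma obs_hessian K I J : K \in Tb D ->
  obs E2 (elt K) (W : set V2) w (fun v => wderiv E2 (elt K) [:: I; J] (cmp v out)).
Proof.
move=> KT; have oK : open (elt K) := open_interior _; have sK := elt_sub pb tb KT.
have mK := elt_mdom LL2 K.
apply: obs_wderiv => //.
  by apply: (has_wderiv_sub LL2 ob oK sK); have [_ [h _]] := hw; exact: Hm_wderiv h _.
move=> v [_ /W2h_props[_ /(_ K KT)[p [sp vp]]]].
apply: (has_wderiv_eq (u := p)); first by move=> x /vp.
exists (pderiv (rev [:: I; J]) p); split; last exact: (weak_deriv_smooth LL2 _ mK sp).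
apply: (L2_continuous LL2) => //; first exact: (elt_cube_bounded pb tb KT).
by apply: smooth_continuous; exact: smooth_pderiv.
Qed.

Lemma X_W_h v : W v -> X (cmp v out).
Proof.
move=> [_ h]; exists (fun=> 0), (cmp v out); split=> //; first exact: H20_0.
by apply/funext => x; rewrite add0r.
Qed.

Lemma X_W_b : X (cmp w out).
Proof.
have [_ h] := hw; exists (cmp w out), (fun=> 0); split=> //.
  by have := fin_span0 W2h_span.
by apply/funext => x; rewrite addr0.
Qed.

(** For the transverse component this is the linearity of the interpolation operator on
    the sum of the exact and the discrete deflections. *)
Lemma obs_Pi i : obs E2 (beta P) (W : set V2) w (fun v => cmp (PiB D v) i).
Proof.
have [[I ei]|->] := plate_split i.
  have := obs_disp i; congr obs; apply/funext => v; apply/funext => x.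
  rewrite /cmp mxE ei (_ : inp I == out = false)//.
  by apply/negbTE; rewrite neq_ltn /= ltn_ord.
have e v x : cmp (PiB D v) out x = Pi3 D (cmp v out) x by rewrite /cmp mxE eqxx.
have [_ [_ [_ [p1 p2 _]]]] := hD.
have sq z : X z -> sqi E2 (beta P) (Pi3 D z) by move=> /p1[h _]; exact: L2_sqi.
rewrite (_ : (fun v => cmp (PiB D v) out) = (fun v => Pi3 D (cmp v out))); last first.
  by apply/funext => v; apply/funext => x; exact: e.
split.
- by move=> v Wv; apply: sq; exact: X_W_h.
- move=> a b u v Wu Wv; have := p2 a b _ _ (X_W_h Wu) (X_W_h Wv).
  rewrite (_ : (fun y => _ * _ + _) = cmp (a *: u + b *: v) out)//.
  by apply/funext => x; rewrite /cmp [RHS]mxE !mxE.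
- by apply: sq; exact: X_W_b.
move=> u Wu; have := p2 1 (-1) _ _ X_W_b (X_W_h Wu).
rewrite (_ : (fun y => 1 * cmp w out y + _) = cmp (w - u) out).
  by apply: ae_onS => x _ ->; rewrite mul1r mulN1r.
by apply/funext => x; rewrite /cmp [RHS]mxE !mxE; ring.
Qed.

End Plate.

Lemma obs_V (z : V3) i : L2v E3 (alpha P) z ->
  obs E3 (alpha P) (Vh D : set V3) z (fun w => cmp w i).
Proof.
move=> Lz; split.
- by move=> u /Vh_L2 Lu; exact: L2_sqi.
- by move=> a b u v _ _; apply: ae_onT => x _; rewrite /cmp [LHS]mxE !mxE.
- exact: L2_sqi.
by move=> u _; apply: ae_onT => x _; rewrite /cmp [LHS]mxE !mxE.
Qed.

End DiscreteObservables.
(** * The forms of the method *)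

Section Forms.
Context {R : realType}.
Let LL3 := @lebesgue_like_E3 R.
Let LL2 := @lebesgue_like_E2 R.
Variables (P : problem R) (hP : problem_ok P).
Variable g : 'M[R]_(4, 3) -> 'I_4 -> ('rV[R]_3 -> R) -> 'rV[R]_2 -> R.
Hypothesis hg : trace_operators P g.
Variables (D : @discretization R) (hD : discretization_ok P D).

Local Notation T3 := ('rV[R]_3 -> 'M[R]_3).
Local Notation V3 := ('rV[R]_3 -> 'rV[R]_3).
Local Notation V2 := ('rV[R]_2 -> 'rV[R]_3).
Local Notation E3 := (E3 R).
Local Notation E2 := (E2 R).

Let pa : polyhedral_domain (alpha P). Proof. by have [[]] := hP. Qed.
Let pb : polyhedral_domain (beta P). Proof. by have [[]] := hP. Qed.
Let tA : triangulation (alpha P) (Ta D). Proof. by have [[]] := hD. Qed.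
Let tB : triangulation (beta P) (Tb D). Proof. by have [[]] := hD. Qed.
Let oa := domain_open pa.
Let ob := domain_open pb.
Let ma := domain_mdom LL3 pa.
Let mb := domain_mdom LL2 pb.
Let sS := Sh_span hD.
Let sW := W_h_span hD.
Let sV := Vh_span hD.

Lemma dotm_pair n (E : euclid R n) G m (u v : 'rV[R]_n -> 'M[R]_m) :
  dotm E G u v = rint E G (fun x => \sum_(p : 'I_m * 'I_m) u x p.1 p.2 * v x p.1 p.2).
Proof. by congr rint; apply/funext => x; rewrite pair_bigA. Qed.

Lemma dotvC n (E : euclid R n) G m (u v : 'rV[R]_n -> 'rV[R]_m) :
  dotv E G u v = dotv E G v u.
Proof.
by congr rint; apply/funext => x; apply: eq_bigr => i _; rewrite mulrC.
Qed.

Lemma dotmC n (E : euclid R n) G m (u v : 'rV[R]_n -> 'M[R]_m) :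
  dotm E G u v = dotm E G v u.
Proof.
congr rint; apply/funext => x; apply: eq_bigr => i _.
by apply: eq_bigr => j _; rewrite mulrC.
Qed.

Lemma dotv_ge0 n (E : euclid R n) G m (u : 'rV[R]_n -> 'rV[R]_m) : 0 <= dotv E G u u.
Proof. by apply: rint_ge0 => x _; apply: sumr_ge0 => i _; rewrite -expr2 sqr_ge0. Qed.

Lemma dotm_ge0 n (E : euclid R n) G m (u : 'rV[R]_n -> 'M[R]_m) : 0 <= dotm E G u u.
Proof.
apply: rint_ge0 => x _; apply: sumr_ge0 => i _; apply: sumr_ge0 => j _.
by rewrite -expr2 sqr_ge0.
Qed.

(** The semi-inner product of which [norm_divh] is the seminorm. *)
Definition divh_form (u v : T3) : R :=
  dotm E3 (alpha P) u v
  + \sum_(K <- Ta D) dotv E3 (elt K) (wdiv (elt K) u) (wdiv (elt K) v)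
  + \sum_(K <- Ta D) \sum_(i | in_Gam P K i) diam (hull (face K i)) *
      dotv E2 (face2 K i) (ntrace g u K i) (ntrace g v K i).

Lemma divh_formC u v : divh_form u v = divh_form v u.
Proof.
rewrite /divh_form; apply: (congr2 +%R); first apply: (congr2 +%R).
- exact: dotmC.
- by apply: eq_bigr => K _; exact: dotvC.
apply: eq_bigr => K _; apply: eq_bigr => i _; apply: (congr1 ( *%R _)).
exact: dotvC.
Qed.

Lemma divh_form_ge0 u : 0 <= divh_form u u.
Proof.
rewrite /divh_form !addr_ge0 ?dotm_ge0//; apply: sumr_ge0 => K _; first exact: dotv_ge0.
by apply: sumr_ge0 => i _; rewrite mulr_ge0 ?diam_ge0 ?dotv_ge0.
Qed.

Definition plate_norm (v : V2) : R :=
  Num.sqrt (\sum_I semi2 E2 (beta P) 1 (cmp v (inp I)) + semi_2h D (cmp v out) ^+ 2).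

Lemma semi_2h_sqr z : semi_2h D z ^+ 2 = \sum_(K <- Tb D) semi2 E2 (elt K) 2 z.
Proof. by rewrite sqr_sqrtr// sumr_ge0// => K _; exact: semi2_ge0. Qed.

Lemma plate_norm_sqr v : plate_norm v ^+ 2 =
  \sum_I semi2 E2 (beta P) 1 (cmp v (inp I)) + semi_2h D (cmp v out) ^+ 2.
Proof. by rewrite sqr_sqrtr// addr_ge0 ?sqr_ge0// sumr_ge0// => J _; exact: semi2_ge0. Qed.

Lemma plate_norm_ge0 v : 0 <= plate_norm v. Proof. exact: sqrtr_ge0. Qed.

Lemma plate_norm_ae0 v : eqW P v (fun=> 0) -> plate_norm v = 0.
Proof.
move=> v0; have c0 i : ae_on E2 (beta P) (fun x => cmp v i x = 0).
  by apply: ae_onS v0 => x _; rewrite /cmp => ->; rewrite mxE.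
apply/eqP; rewrite -sqrf_eq0 plate_norm_sqr big1 ?add0r.
  rewrite semi_2h_sqr big_seq big1// => K KT; rewrite /semi2 big1// => a _.
  have h := ae_on_sub (elt_sub pb tB KT) (c0 out).
  apply: rint0_ae; apply: ae_onS (wderiv0_ae LL2 (open_interior _) a h) => x _ ->.
  by rewrite expr0n.
move=> J _; rewrite /semi2 big1// => a _.
apply: rint0_ae; apply: ae_onS (wderiv0_ae LL2 ob a (c0 (inp J))) => x _ ->.
by rewrite expr0n.
Qed.

Lemma tnorm_plate tau v :
  tnorm P g D tau v = Num.sqrt (norm_divh P g D tau ^+ 2 + plate_norm v ^+ 2).
Proof. by rewrite /tnorm plate_norm_sqr addrA. Qed.

Section Bilinear.
Variables (s : T3) (w : V2) (hs : Sigma_t P s) (hw : W_b P w).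

Lemma bil_compliance : bil_at (Sh D : set T3) s (Sh D : set T3)
  (fun u v => dotm E3 (alpha P) (C0inv P \o u) v).
Proof.
have := @bil_at_rint _ _ E3 _ ma _ _ _ _ _ _ _ (index_enum _) _ _ sS sS
  (fun p : 'I_3 * 'I_3 => obs_compliance hP hD hs p.1 p.2)
  (fun p : 'I_3 * 'I_3 => obs_stress hP hD hs p.1 p.2).
apply: bil_at_eq => // u v Su Sv; rewrite dotm_pair; congr rint.
apply/funext => x; apply: eq_bigr => p _.
by rewrite /= C0inv_compliance//; exact: (errs_sym hD hs Su).
Qed.

Lemma bil_divh_form : bil_at (Sh D : set T3) s (Sh D : set T3) divh_form.
Proof.
apply: bil_atD; first apply: bil_atD.
- have := @bil_at_rint _ _ E3 _ ma _ _ _ _ _ _ _ (index_enum _) _ _ sS sS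
    (fun p : 'I_3 * 'I_3 => obs_stress hP hD hs p.1 p.2)
    (fun p : 'I_3 * 'I_3 => obs_stress hP hD hs p.1 p.2).
  by apply: bil_at_eq => // u v _ _; rewrite dotm_pair.
- under eq_fun => u do under eq_fun => v do rewrite big_seq.
  apply: bil_at_sum => K KT; have mK := elt_mdom LL3 K.
  exact: (bil_at_rint mK (index_enum 'I_3) sS sS
    (fun i => obs_wdiv hP hD hs i KT) (fun i => obs_wdiv hP hD hs i KT)).
under eq_fun => u do under eq_fun => v do rewrite big_seq.
apply: bil_at_sum => K KT; apply: bil_at_sum => i hi; apply: bil_atZ.
exact: (bil_at_rint (face2_mdom K i) (index_enum 'I_3) sS sS
    (fun k => obs_ntrace hP hg hD hs k KT hi) (fun k => obs_ntrace hP hg hD hs k KT hi)).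
Qed.

Lemma bil_b_h (z : V3) : L2v E3 (alpha P) z ->
  bil_at (Sh D : set T3) s (Vh D : set V3) (fun u y => b_h D y u).
Proof.
move=> Lz; rewrite /b_h; under eq_fun => u do under eq_fun => v do rewrite big_seq.
apply: bil_at_sum => K KT; have mK := elt_mdom LL3 K.
apply: (bil_at_rint mK (w := z) (index_enum 'I_3) sS sV
    (fun i => obs_wdiv hP hD hs i KT)) => i.
exact: (obs_subset ma mK (elt_sub pa tA KT) (obs_V hP hD i Lz)).
Qed.

(** The constraint occurs in both roles: exact stress against discrete multiplier above,
    exact multiplier against discrete stress here. *)
Lemma bil_b_h_flip (z : V3) : L2v E3 (alpha P) z ->
  bil_at (Vh D : set V3) z (Sh D : set T3) (fun y u => b_h D y u).
Proof.
move=> Lz; rewrite /b_h; under eq_fun => u do under eq_fun => v do rewrite big_seq.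
apply: bil_at_sum => K KT; have mK := elt_mdom LL3 K.
have hV i := obs_subset ma mK (elt_sub pa tA KT) (obs_V hP hD i Lz).
have := bil_at_rint mK (index_enum 'I_3) sV sS hV (fun i => obs_wdiv hP hD hs i KT).
by apply: bil_at_eq => // u v _ _; rewrite dotvC.
Qed.

Lemma obs_interface K i k : in_Gam P K i ->
  obs E2 (face2 K i) (W_h D : set V2) w (fun v => cmp (PiB D v) k).
Proof.
move=> hi; apply: (obs_null mb (face2_mdom K i) (face2_beta hP hi)).
exact: (obs_Pi hP hD hw).
Qed.

Lemma bil_Gam : bil_at (Sh D : set T3) s (W_h D : set V2)
  (fun u v => Gam_form P g D u (PiB D v)).
Proof.
rewrite /Gam_form; under eq_fun => u do under eq_fun => v do rewrite big_seq.
apply: bil_at_sum => K KT; apply: bil_at_sum => i hi.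
exact: (bil_at_rint (face2_mdom K i) (index_enum 'I_3) sS sW
  (fun k => obs_ntrace hP hg hD hs k KT hi) (fun k => obs_interface k hi)).
Qed.

(** The interface term is bilinear in either order of the arguments, as it occurs twice
    in the form of the method with opposite signs. *)
Lemma bil_Gam_flip : bil_at (W_h D : set V2) w (Sh D : set T3)
  (fun v u => Gam_form P g D u (PiB D v)).
Proof.
rewrite /Gam_form; under eq_fun => u do under eq_fun => v do rewrite big_seq.
apply: bil_at_sum => K KT; apply: bil_at_sum => i hi.
have := bil_at_rint (face2_mdom K i) (index_enum 'I_3) sW sS
  (fun k => obs_interface k hi) (fun k => obs_ntrace hP hg hD hs k KT hi).
by apply: bil_at_eq => // u v _ _; rewrite dotvC.
Qed.

Lemma obs_strain J L : obs E2 (beta P) (W_h D : set V2) w (fun v => strain P v J L).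
Proof.
have := obs_lin mb 2^-1 2^-1 (obs_grad hP hD hw J L) (obs_grad hP hD hw L J).
by congr obs; apply/funext => v; apply/funext => x; rewrite /strain mulrDr.
Qed.

Lemma bil_membrane : bil_at (W_h D : set V2) w (W_h D : set V2) (membrane_form P).
Proof.
have hm (p : 'I_2 * 'I_2) : obs E2 (beta P) (W_h D : set V2) w (fun v => membrane P v p.1 p.2).
  pose c := Eb P * tb P / (1 - nub P ^+ 2).
  have := obs_lin mb (c * (1 - nub P)) (c * nub P * (p.1 == p.2)%:R) (obs_strain p.1 p.2)
    (obs_sum mb (index_enum 'I_2) (fun L => obs_strain L L)).
  congr obs; apply/funext => v; apply/funext => x; rewrite /membrane -/c; ring.
have := bil_at_rint mb (index_enum _) sW sW hm (fun p : 'I_2 * 'I_2 => obs_strain p.1 p.2).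
apply: bil_at_eq => // u v _ _; congr rint; apply/funext => x.
by rewrite pair_bigA.
Qed.

Lemma obs_curv K J L : K \in Tb D ->
  obs E2 (elt K) (W_h D : set V2) w (fun v => curv (elt K) v J L).
Proof.
move=> KT; have := obsZ (elt_mdom LL2 K) (-1) (obs_hessian hP hD hw J L KT).
by congr obs; apply/funext => v; apply/funext => x; rewrite mulN1r.
Qed.

Lemma obs_moment K J L : K \in Tb D ->
  obs E2 (elt K) (W_h D : set V2) w (fun v => moment P (elt K) v J L).
Proof.
move=> KT; pose c := Eb P * tb P ^+ 3 / (12 * (1 - nub P ^+ 2)).
have := obs_lin (elt_mdom LL2 K) (c * (1 - nub P)) (c * nub P * (J == L)%:R) (obs_curv J L KT)
  (obs_sum (elt_mdom LL2 K) (index_enum 'I_2) (fun k => obs_curv k k KT)).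
congr obs; apply/funext => v; apply/funext => x; rewrite /moment -/c; ring.
Qed.

Lemma bil_bending : bil_at (W_h D : set V2) w (W_h D : set V2)
  (fun u v => \sum_(K <- Tb D) bending_form P (elt K) u v).
Proof.
under eq_fun => u do under eq_fun => v do rewrite big_seq.
apply: bil_at_sum => K KT.
have := bil_at_rint (elt_mdom LL2 K) (index_enum _) sW sW
  (fun p : 'I_2 * 'I_2 => obs_moment p.1 p.2 KT) (fun p : 'I_2 * 'I_2 => obs_curv p.1 p.2 KT).
apply: bil_at_eq => // u v _ _; congr rint; apply/funext => x.
by rewrite pair_bigA.
Qed.

Definition plate_form (u v : V2) : R :=
  membrane_form P u v + \sum_(K <- Tb D) bending_form P (elt K) u v.

Lemma bil_plate_form : bil_at (W_h D : set V2) w (W_h D : set V2) plate_form.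
Proof. exact: bil_atD bil_membrane bil_bending. Qed.

End Bilinear.

(** * Coercivity of the plate energy *)

Lemma ip_sum_pair n (E : euclid R n) G (F : 'I_2 -> 'I_2 -> 'rV[R]_n -> R) (k : R) :
  mdom E G -> (forall i j, sqi E G (F i j)) ->
  intg E G (fun x => \sum_i \sum_j k * (F i j x * F i j x)) /\
  rint E G (fun x => \sum_i \sum_j k * (F i j x * F i j x)) =
  k * \sum_i \sum_j ip E G (F i j) (F i j).
Proof.
move=> mG sF; have i1 i j : intg E G (fun x => k * (F i j x * F i j x)).
  by apply: intgZ => //; exact: sqi_intgM.
have i2 i : intg E G (fun x => \sum_j k * (F i j x * F i j x)) by exact: intg_sum.
split; first exact: intg_sum.
rewrite rint_sum// mulr_sumr; apply: eq_bigr => i _.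
rewrite rint_sum// mulr_sumr; apply: eq_bigr => j _.
by rewrite rintZ//; exact: sqi_intgM.
Qed.

(** The difference is a multiple of the squared trace. *)
Lemma bending_pointwise (c nu : R) (h : 'I_2 -> 'I_2 -> R) : 0 <= c -> 0 <= nu ->
  \sum_i \sum_j c * (1 - nu) * (h i j * h i j) <=
  \sum_i \sum_j c * ((1 - nu) * - h i j + nu * (\sum_l - h l l) * (i == j)%:R) * - h i j.
Proof.
move=> c0 n0; rewrite !sum_ord2 /=.
move: (h 0 0) (h 0 1) (h 1 0) (h 1 1) => a b d e.
rewrite -subr_ge0; set A := (X in 0 <= X).
have -> : A = c * nu * (a + e) ^+ 2 by rewrite /A; ring.
by rewrite mulr_ge0 ?sqr_ge0// mulr_ge0.
Qed.

(** [h i j] is the derivative in direction i of component j. Writing the squared strain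
    as half the squared gradient plus half the products [h i j * h j i] leaves
    [h 1 0 * h 0 1], from which [h 0 0 * h 1 1] is subtracted because the two have equal
    integrals; the rest is again a multiple of the squared trace. *)
Lemma membrane_pointwise (c nu : R) (h : 'I_2 -> 'I_2 -> R) : 0 <= c -> 0 <= nu ->
  \sum_i \sum_j c * (1 - nu) / 2 * (h i j * h i j) +
    (c * (1 - nu) * (h 1 0 * h 0 1) + - (c * (1 - nu)) * (h 0 0 * h 1 1)) <=
  \sum_i \sum_j c * ((1 - nu) * (2^-1 * (h i j + h j i)) +
     nu * (\sum_l 2^-1 * (h l l + h l l)) * (i == j)%:R) * (2^-1 * (h i j + h j i)).
Proof.
move=> c0 n0; rewrite !sum_ord2 /=.
move: (h 0 0) (h 0 1) (h 1 0) (h 1 1) => a b d e.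
rewrite -subr_ge0; set A := (X in 0 <= X).
have -> : A = c * ((1 + nu) / 2) * (a + e) ^+ 2 by rewrite /A; field.
by rewrite mulr_ge0 ?sqr_ge0// mulr_ge0// divr_ge0// addr_ge0.
Qed.

Lemma plate_moduli : [/\ 0 < nub P, 0 < 1 - nub P,
  0 < Eb P * tb P / (1 - nub P ^+ 2) & 0 < Eb P * tb P ^+ 3 / (12 * (1 - nub P ^+ 2))].
Proof.
have [_ [_ [[_ Eb0 tb0] [_ /andP[n0 n1] _]]]] := hP.
have n2 : nub P < 1 by apply: lt_le_trans n1 _; rewrite invf_le1// ler1n.
have h : 0 < 1 - nub P ^+ 2 by rewrite subr_gt0 expr_lt1// ltW.
split=> //; first by rewrite subr_gt0.
  by rewrite divr_gt0// mulr_gt0.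
by rewrite divr_gt0// mulr_gt0// exprn_gt0.
Qed.

Definition bending_coef : R :=
  Eb P * tb P ^+ 3 / (12 * (1 - nub P ^+ 2)) * (1 - nub P).

Definition membrane_coef : R := Eb P * tb P / (1 - nub P ^+ 2) * (1 - nub P).

Lemma bending_coercive v : W_h D v ->
  bending_coef * semi_2h D (cmp v out) ^+ 2 <=
  \sum_(K <- Tb D) bending_form P (elt K) v v.
Proof.
move=> Wv; have hw := W_b0 hP.
rewrite semi_2h_sqr mulr_sumr big_seq [leRHS]big_seq; apply: ler_sum => K KT.
have mK := elt_mdom LL2 K.
pose F J L := wderiv E2 (elt K) [:: J; L] (cmp v out).
have sF J L : sqi E2 (elt K) (F J L).
  by have [h _ _ _] := obs_hessian hP hD hw J L KT; exact: h.
have [i1 e1] := ip_sum_pair bending_coef mK sF.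
rewrite semi2_2 -e1; apply: rint_le => //.
  apply: intg_sum => // J _; apply: intg_sum => // L _; apply: sqi_intgM => //.
    by have [h _ _ _] := obs_moment hw J L KT; exact: h.
  by have [h _ _ _] := obs_curv hw J L KT; exact: h.
move=> x _; have [n0 _ _ c0] := plate_moduli.
exact: (bending_pointwise (fun J L => F J L x) (ltW c0) (ltW n0)).
Qed.

Lemma membrane_intg v : W_h D v ->
  intg E2 (beta P) (fun x => \sum_J \sum_L membrane P v J L x * strain P v J L x).
Proof.
move=> Wv; have hw := W_b0 hP.
have sq M L : sqi E2 (beta P) (strain P v M L).
  by have [h _ _ _] := obs_strain hw M L; exact: h.
apply: intg_sum => // J _; apply: intg_sum => // L _; apply: sqi_intgM => //.
pose c := Eb P * tb P / (1 - nub P ^+ 2).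
have := sqi_lin (c * (1 - nub P)) (c * nub P * (J == L)%:R) mb (sq J L)
  (sqi_sum (index_enum 'I_2) (P := xpredT) mb (fun L' _ => sq L' L')).
by apply: sqi_ae; apply: ae_onT => x _; rewrite /membrane -/c; ring.
Qed.

(** Korn's inequality with clamped edges: integrating by parts twice turns the product of
    the mixed derivatives into a product of the diagonal ones, which the squared trace
    absorbs, so that the strain controls half of the full gradient. *)
Lemma membrane_coercive v : W_h D v ->
  membrane_coef / 2 * \sum_J semi2 E2 (beta P) 1 (cmp v (inp J)) <= membrane_form P v v.
Proof.
move=> Wv; have hw := W_b0 hP.
pose F J L := wderiv E2 (beta P) [:: J] (cmp v (inp L)).
have sF J L : sqi E2 (beta P) (F J L).
  by have [h _ _ _] := obs_grad hP hD hw J L; exact: h.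
have [i1 e1] := ip_sum_pair (membrane_coef / 2) mb sF.
have swap : ip E2 (beta P) (F 0 0) (F 1 1) = ip E2 (beta P) (F 1 0) (F 0 1).
  apply: (H10_swap LL2 ob); first exact: (W_h_H10 hD 0 Wv).
  by have [] := W_h_H10 hD 1 Wv.
have i2 := sqi_intgM mb (sF 1 0) (sF 0 1).
have i3 := sqi_intgM mb (sF 0 0) (sF 1 1).
have [i4 e4] := intg_lin membrane_coef (- membrane_coef) mb i2 i3.
have e5 : rint E2 (beta P) (fun x => membrane_coef * (F 1 0 x * F 0 1 x) +
    - membrane_coef * (F 0 0 x * F 1 1 x)) = 0.
  have aux (k a b : R) : b = a -> k * a + - k * b = 0 by move=> ->; rewrite mulNr subrr.
  exact: etrans e4 (aux _ _ _ swap).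
have -> : \sum_J semi2 E2 (beta P) 1 (cmp v (inp J)) =
    \sum_J \sum_L ip E2 (beta P) (F J L) (F J L).
  have ex : \sum_J \sum_L ip E2 (beta P) (F L J) (F L J) =
      \sum_J \sum_L ip E2 (beta P) (F J L) (F J L) by exact: exchange_big.
  apply: etrans _ ex; apply: eq_bigr => J _; exact: semi2_1.
have aux (x y z c : R) : z = x + y -> x = c -> y = 0 -> c = z by move=> -> -> ->; rewrite addr0.
have aux2 (c z m : R) : c = z -> z <= m -> c <= m by move=> ->.
apply: (aux2 _ _ _ (aux _ _ _ _ (rintD mb i1 i4) e1 e5)).
apply: (rint_le mb (intgD mb i1 i4) (membrane_intg Wv)).
move=> x _; have [n0 _ c0 _] := plate_moduli.
exact: (membrane_pointwise (fun J L => F J L x) (ltW c0) (ltW n0)).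
Qed.

Definition plate_coef : R := Num.min (membrane_coef / 2) bending_coef.

Lemma plate_coercive v : W_h D v ->
  plate_coef * plate_norm v ^+ 2 <= plate_form v v.
Proof.
move=> Wv; rewrite plate_norm_sqr mulrDr; apply: lerD.
  apply: le_trans (membrane_coercive Wv); rewrite ler_wpM2r//.
    by apply: sumr_ge0 => J _; exact: semi2_ge0.
  by rewrite ge_min lexx.
apply: le_trans (bending_coercive Wv); rewrite ler_wpM2r ?sqr_ge0//.
by rewrite ge_min lexx orbT.
Qed.

Lemma plate_coef_gt0 : 0 < plate_coef.
Proof.
have [n0 n1 c0 d0] := plate_moduli.
by rewrite lt_min; apply/andP; split; [rewrite divr_gt0// mulr_gt0|rewrite mulr_gt0].
Qed.

(** * Data functionals *)

Lemma dotv_ip n (E : euclid R n) G m (u v : 'rV[R]_n -> 'rV[R]_m) : mdom E G ->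
  (forall i, sqi E G (cmp u i)) -> (forall i, sqi E G (cmp v i)) ->
  dotv E G u v = \sum_i ip E G (cmp u i) (cmp v i).
Proof. by move=> mG su sv; rewrite /dotv rint_sum// => i _; exact: (sqi_intgM mG (su i) (sv i)). Qed.

Lemma nrm_norm0v n (E : euclid R n) G m (u : 'rV[R]_n -> 'rV[R]_m) i : mdom E G ->
  (forall i, sqi E G (cmp u i)) -> nrm (E := E) G (cmp u i) <= norm0v E G u.
Proof.
move=> mG su; rewrite /nrm /norm0v ler_wsqrtr// dotv_ip// (bigD1 i)//= lerDl.
by apply: sumr_ge0 => j _; exact: ip_ge0.
Qed.

Lemma dotv_linr n (E : euclid R n) G m (a b : R) (f u v : 'rV[R]_n -> 'rV[R]_m) : mdom E G ->
  (forall i, sqi E G (cmp f i)) -> (forall i, sqi E G (cmp u i)) ->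
  (forall i, sqi E G (cmp v i)) ->
  dotv E G f (fun x => a *: u x + b *: v x) = a * dotv E G f u + b * dotv E G f v.
Proof.
move=> mG sf su sv.
have e i x : cmp (fun x => a *: u x + b *: v x) i x = a * cmp u i x + b * cmp v i x.
  by rewrite /cmp !mxE.
have sl i : sqi E G (cmp (fun x => a *: u x + b *: v x) i).
  by apply: sqi_ae (sqi_lin a b mG (su i) (sv i)); apply: ae_onT => x _; rewrite e.
rewrite !dotv_ip// !mulr_sumr -big_split; apply: eq_bigr => i _.
apply: etrans (ip_linr a b mG (su i) (sv i) (sf i)).
by apply: ip_ae; apply: ae_onT => x _; rewrite ?e.
Qed.

Lemma dotv_sqr_lin n (E : euclid R n) G m (a b : R) (u v : 'rV[R]_n -> 'rV[R]_m) : mdom E G ->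
  (forall i, sqi E G (cmp u i)) -> (forall i, sqi E G (cmp v i)) ->
  dotv E G (fun x => a *: u x + b *: v x) (fun x => a *: u x + b *: v x) =
  a ^+ 2 * dotv E G u u + 2 * (a * b) * dotv E G u v + b ^+ 2 * dotv E G v v.
Proof.
move=> mG su sv.
have sl i : sqi E G (cmp (fun x => a *: u x + b *: v x) i).
  apply: sqi_ae (sqi_lin a b mG (su i) (sv i)).
  by apply: ae_onT => x _; rewrite /cmp !mxE.
rewrite dotv_linr// [dotv E G _ u]dotvC [dotv E G (fun x => _ + _) v]dotvC.
rewrite !dotv_linr// [dotv E G v u]dotvC; ring.
Qed.

Lemma dotv_quad_ge0 n (E : euclid R n) G m (t : R) (u v : 'rV[R]_n -> 'rV[R]_m) : mdom E G ->
  (forall i, sqi E G (cmp u i)) -> (forall i, sqi E G (cmp v i)) ->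
  0 <= dotv E G u u + 2 * t * dotv E G u v + t ^+ 2 * dotv E G v v.
Proof.
move=> mG su sv; have := dotv_ge0 E G (fun x => 1 *: u x + t *: v x).
by rewrite dotv_sqr_lin// expr1n !mul1r.
Qed.

Lemma dotv_cauchy n (E : euclid R n) G m (u v : 'rV[R]_n -> 'rV[R]_m) : mdom E G ->
  (forall i, sqi E G (cmp u i)) -> (forall i, sqi E G (cmp v i)) ->
  `|dotv E G u v| <= norm0v E G u * norm0v E G v.
Proof.
move=> mG su sv; apply: ler_norm_sqrtM; first exact: dotv_ge0.
by apply: discriminant_le => t; exact: dotv_quad_ge0.
Qed.

Lemma norm0v_sub n (E : euclid R n) G m (u v : 'rV[R]_n -> 'rV[R]_m) : mdom E G ->
  (forall i, sqi E G (cmp u i)) -> (forall i, sqi E G (cmp v i)) ->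
  norm0v E G (fun x => u x - v x) <= norm0v E G u + norm0v E G v.
Proof.
move=> mG su sv.
have -> : (fun x => u x - v x) = (fun x => 1 *: u x + (-1) *: v x).
  by apply/funext => x; rewrite scale1r scaleN1r.
have n0 (f : 'rV[R]_n -> 'rV[R]_m) : 0 <= norm0v E G f by exact: sqrtr_ge0.
rewrite -ler_sqr ?nnegrE ?addr_ge0// sqrrD ![norm0v E G _ ^+ 2]sqr_sqrtr ?dotv_ge0//.
rewrite dotv_sqr_lin//; have := dotv_cauchy mG su sv; rewrite ler_norml => /andP[h _].
move: h; move: (norm0v E G u * _) (dotv E G u v) (dotv E G u u) (dotv E G v v) => a b c d h.
lra.
Qed.

Lemma norm0v_ae0 n (E : euclid R n) G m (u : 'rV[R]_n -> 'rV[R]_m) : mdom E G ->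
  (forall i, sqi E G (cmp u i)) -> norm0v E G u = 0 -> ae_on E G (fun x => u x = 0).
Proof.
move=> mG su u0; have h i : ae_on E G (fun x => cmp u i x = 0).
  apply: nrm0_ae => //; apply/le_anti; rewrite nrm_ge0 andbT -u0.
  exact: nrm_norm0v.
by apply: ae_onS (ae_on_fin h) => x _ ux; apply/rowP => i; rewrite mxE; exact: ux.
Qed.

(** The in-plane components vanish on the boundary, so that Poincare's inequality bounds
    them; the constant [C] does the same for the transverse one, which need not
    vanish there. *)
Lemma load_bound (C M : R) fb v : 0 <= M -> beta P `<=` cubeR M ->
  (forall z, W2h D z -> Num.sqrt (rint E2 (beta P) (fun x => z x ^+ 2)) <= C * semi_2h D z) ->
  L2v E2 (beta P) fb -> W_h D v ->
  `|dotv E2 (beta P) fb v| <= (4 * M + `|C|) * norm0v E2 (beta P) fb * plate_norm v.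
Proof.
move=> M0 bM hC Lf Wv.
have sf i : sqi E2 (beta P) (cmp fb i) by apply: L2_sqi => //; exact: Lf.
have sv i : sqi E2 (beta P) (cmp v i) by apply: L2_sqi => //; exact: (W_h_L2 hP hD).
have nsq z : 0 <= semi2 E2 (beta P) 1 z by exact: semi2_ge0.
have p1 J : nrm (E := E2) (beta P) (cmp v (inp J)) <= 2 * M * plate_norm v.
  apply: le_trans (poincare LL2 ob 0 M0 bM (W_h_H10 hD J Wv)) _.
  rewrite ler_wpM2l ?mulr_ge0// -ler_sqr ?nnegrE ?nrm_ge0 ?plate_norm_ge0//.
  rewrite nrm_sqr plate_norm_sqr (bigD1 J)//= semi2_1 (bigD1 (0 : 'I_2))//= -!addrA lerDl.
  rewrite !addr_ge0 ?sqr_ge0//; first by apply: sumr_ge0 => i _; exact: ip_ge0.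
  by apply: sumr_ge0 => i _; exact: nsq.
have p2 : nrm (E := E2) (beta P) (cmp v out) <= `|C| * plate_norm v.
  have [_ Wz] := Wv; have := hC _ Wz; rewrite /nrm /ip.
  under eq_fun do rewrite expr2.
  move=> h; apply: le_trans h _; apply: le_trans (_ : `|C| * semi_2h D (cmp v out) <= _).
    by rewrite ler_wpM2r ?ler_norm// sqrtr_ge0.
  rewrite ler_wpM2l// -ler_sqr ?nnegrE ?plate_norm_ge0 ?sqrtr_ge0//.
  by rewrite plate_norm_sqr lerDr; apply: sumr_ge0 => i _; exact: nsq.
have t i (c : R) : nrm (E := E2) (beta P) (cmp v i) <= c * plate_norm v ->
    `|ip E2 (beta P) (cmp fb i) (cmp v i)| <= norm0v E2 (beta P) fb * (c * plate_norm v).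
  move=> h; apply: le_trans (ip_cauchy mb (sf i) (sv i)) _.
  apply: ler_pM; rewrite ?nrm_ge0//; exact: nrm_norm0v.
rewrite dotv_ip// sum_ord3.
have e0 : (0 : 'I_3) = inp 0 by exact: val_inj.
have e1 : (1 : 'I_3) = inp 1 by exact: val_inj.
have e2 : (inord 2 : 'I_3) = out by apply: val_inj; rewrite /= inordK.
have t0 := t 0 _ (etrans (congr1 (fun i => _ (cmp v i) <= _) e0) (p1 0)).
have t1 := t 1 _ (etrans (congr1 (fun i => _ (cmp v i) <= _) e1) (p1 1)).
have t2 := t (inord 2) _ (etrans (congr1 (fun i => _ (cmp v i) <= _) e2) p2).
apply: le_trans (ler_normD _ _) _.
apply: le_trans (lerD (ler_normD _ _) (lexx _)) _.
apply: le_trans (lerD (lerD t0 t1) t2) _.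
by rewrite le_eqVlt; apply/orP; left; apply/eqP; ring.
Qed.

End Forms.
(** * Well-posedness and error analysis on one mesh *)

Section Method.
Context {R : realType}.
Let LL3 := @lebesgue_like_E3 R.
Let LL2 := @lebesgue_like_E2 R.
Variables (P : problem R) (hP : problem_ok P).
Variable g : 'M[R]_(4, 3) -> 'I_4 -> ('rV[R]_3 -> R) -> 'rV[R]_2 -> R.
Hypothesis hg : trace_operators P g.
Variables (D : @discretization R) (hD : discretization_ok P D).
Variables (C2 C3 : R).
Hypotheses (C20 : 0 < C2) (C30 : 0 < C3).
Hypotheses (hA1 : A1 P g D) (hA2 : A2 P g D C2) (hA3 : A3 P g D C3).

Local Notation T3 := ('rV[R]_3 -> 'M[R]_3).
Local Notation V3 := ('rV[R]_3 -> 'rV[R]_3).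
Local Notation V2 := ('rV[R]_2 -> 'rV[R]_3).
Local Notation E3 := (E3 R).
Local Notation E2 := (E2 R).
Local Notation S := (Sh D : set T3).
Local Notation W := (W_h D : set V2).
Local Notation V := (Vh D : set V3).

Let pa : polyhedral_domain (alpha P). Proof. by have [[]] := hP. Qed.
Let pb : polyhedral_domain (beta P). Proof. by have [[]] := hP. Qed.
Let tA : triangulation (alpha P) (Ta D). Proof. by have [[]] := hD. Qed.
Let ma := domain_mdom LL3 pa.
Let mb := domain_mdom LL2 pb.
Let sS : fin_span S := Sh_span hD.
Let sW : fin_span W := W_h_span hD.
Let sV : fin_span V := Vh_span hD.
Let S0 := fin_span0 sS.
Let W0 := fin_span0 sW.
Let V0 := fin_span0 sV.

Definition stress_form (u v : T3) : R := dotm E3 (alpha P) (C0inv P \o u) v.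
Definition interface_form (u : T3) (v : V2) : R := Gam_form P g D u (PiB D v).

Lemma a_hE u y u' y' : a_h P g D u y u' y' =
  af stress_form (plate_form P D) interface_form u y u' y'.
Proof. by rewrite /a_h /af /plate_form addrA. Qed.

Lemma tnormE u y : tnorm P g D u y = tn (divh_form P g D) (plate_norm P D) u y.
Proof. exact: tnorm_plate. Qed.

Lemma tnorm_ge0 u y : 0 <= tnorm P g D u y. Proof. exact: sqrtr_ge0. Qed.

Lemma norm_divh_le u y : norm_divh P g D u <= tnorm P g D u y.
Proof.
rewrite -ler_sqr ?nnegrE ?sqrtr_ge0// tnorm_plate [leRHS]sqr_sqrtr.
  by rewrite lerDl sqr_ge0.
by rewrite addr_ge0 ?sqr_ge0.
Qed.

Lemma plate_norm_le u y : plate_norm P D y <= tnorm P g D u y.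
Proof.
rewrite -ler_sqr ?nnegrE ?sqrtr_ge0// tnorm_plate [leRHS]sqr_sqrtr.
  by rewrite lerDr sqr_ge0.
by rewrite addr_ge0 ?sqr_ge0.
Qed.

Lemma XS_discrete u : S u -> XS P D u.
Proof.
move=> Su; exists (fun=> 0), u; split=> //; first exact: Sigma_t0.
by apply/funext => x; rewrite add0r.
Qed.

Lemma XW_discrete y : W y -> XW P D y.
Proof.
move=> Wy; exists (fun=> 0), y; split=> //; first exact: W_b0.
by apply/funext => x; rewrite add0r.
Qed.

Lemma XS_error s u : Sigma_t P s -> S u -> XS P D (s - u).
Proof.
move=> hs Su; exists s, (- u); split=> //.
by have := fin_span_lin (-1) 0 sS Su Su; rewrite scaleN1r scale0r addr0.
Qed.

Lemma XW_error w y : W_b P w -> W y -> XW P D (w - y).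
Proof.
move=> hw Wy; exists w, (- y); split=> //.
by have := fin_span_lin (-1) 0 sW Wy Wy; rewrite scaleN1r scale0r addr0.
Qed.

Lemma Vh_sqi z i : V z -> sqi E3 (alpha P) (cmp z i).
Proof. by move=> /(Vh_L2 hD) h; apply: L2_sqi. Qed.

Lemma W_h_sqi y i : W y -> sqi E2 (beta P) (cmp y i).
Proof. by move=> h; apply: L2_sqi => //; exact: (W_h_L2 hP hD). Qed.

(** The hypotheses on the method are stated on the sum spaces, which contain the discrete
    ones. *)
Lemma saddle_bounded u y u' y' : S u -> W y -> S u' -> W y' ->
  `|af stress_form (plate_form P D) interface_form u y u' y'| <=
  C2 * tn (divh_form P g D) (plate_norm P D) u y * tn (divh_form P g D) (plate_norm P D) u' y'.
Proof.
move=> Su Wy Su' Wy'; rewrite -a_hE -!tnormE.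
by have [] := hA2 (XS_discrete Su) (XW_discrete Wy) Su' Wy' V0.
Qed.

Lemma saddle_kernel u : S u -> (forall z, V z -> b_h D z u = 0) ->
  C3 * nU (divh_form P g D) u ^+ 2 <= stress_form u u.
Proof. by move=> Su h; have [h3 _] := hA3; exact: h3. Qed.

(** The inf-sup condition as a lower bound for the dual norm. A stress of norm zero
    contributes a quotient with denominator zero, that is zero, to the supremum. *)
Lemma saddle_infsup z F : V z -> 0 <= F ->
  (forall u, S u -> `|b_h D z u| <= F * nU (divh_form P g D) u) ->
  C3 * norm0v E3 (alpha P) z <= F.
Proof.
move=> Vz F0 hF; have n0 : 0 <= norm0v E3 (alpha P) z by exact: sqrtr_ge0.
have [->|nz] := eqVneq (norm0v E3 (alpha P) z) 0; first by rewrite mulr0.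
have np : 0 < norm0v E3 (alpha P) z by rewrite lt0r nz.
rewrite -ler_pdivlMr//; have [_ h3] := hA3; rewrite -lee_fin; apply: le_trans h3 _.
apply: ge_ereal_inf; exists (ereal_sup [set t | exists tau, [/\ Sh D tau, ~ eqS P tau (fun=> 0) &
      t = (b_h D z tau / (norm0v E3 (alpha P) z * norm_divh P g D tau))%:E]]).
  exists z; split=> //.
  move=> z0; move: nz; rewrite /norm0v /dotv rint0_ae ?sqrtr0 ?eqxx//.
  by apply: ae_onS z0 => x _ ->; rewrite big1// => i _; rewrite mxE mul0r.
apply: ge_ereal_sup => _ [tau [St _ ->]]; rewrite lee_fin.
have m0 : 0 <= norm_divh P g D tau by exact: sqrtr_ge0.
have [->|mz] := eqVneq (norm_divh P g D tau) 0.
  by rewrite mulr0 invr0 mulr0 divr_ge0.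
have mp : 0 < norm_divh P g D tau by rewrite lt0r mz.
rewrite ler_pdivrMr ?mulr_gt0// mulrA divfK//.
exact: le_trans (ler_norm _) (hF _ St).
Qed.

Lemma bil_stress : bil_on S S stress_form.
Proof. by have [h _] := bil_compliance hP hD (Sigma_t0 hP). Qed.

Lemma bil_divh : bil_on S S (divh_form P g D).
Proof. by have [h _] := bil_divh_form hP hg hD (Sigma_t0 hP). Qed.

Lemma bil_plate : bil_on W W (plate_form P D).
Proof. by have [h _] := bil_plate_form hP hD (W_b0 hP). Qed.

Lemma bil_interface : bil_on S W interface_form.
Proof. by have [h _] := bil_Gam hP hg hD (Sigma_t0 hP) (W_b0 hP). Qed.

Lemma bil_constraint : bil_on V S (b_h D).
Proof.
have L0 : L2v E3 (alpha P) (0 : V3) by exact: (Vh_L2 hD V0).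
by have [h _] := bil_b_h_flip hP hD (Sigma_t0 hP) L0.
Qed.

Lemma plate_norm0 : plate_norm P D 0 = 0.
Proof. by apply: (plate_norm_ae0 hP hD); exact: ae_onT. Qed.

Definition stab_const : R := saddle_const C2 C3 C3 (plate_coef P).

Lemma stab_const_gt0 : 0 < stab_const.
Proof. by apply: saddle_const_gt0 => //; exact: plate_coef_gt0. Qed.

Lemma method_stable u y z (Fn : T3 -> V2 -> R) (G : V3 -> R) (F0 G0 : R) :
  S u -> W y -> V z -> 0 <= F0 -> 0 <= G0 -> lin_on V G ->
  (forall u' y', S u' -> W y' -> a_h P g D u y u' y' + b_h D z u' = Fn u' y') ->
  (forall z', V z' -> b_h D z' u = G z') ->
  (forall u' y', S u' -> W y' -> `|Fn u' y'| <= F0 * tnorm P g D u' y') ->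
  (forall z', V z' -> `|G z'| <= G0 * norm0v E3 (alpha P) z') ->
  tnorm P g D u y + norm0v E3 (alpha P) z <= stab_const * (F0 + G0).
Proof.
move=> Su Wy Vz F00 G00 lG e1 e2 hF hG; rewrite tnormE.
have f1 u' y' : S u' -> W y' ->
    af stress_form (plate_form P D) interface_form u y u' y' + b_h D z u' = Fn u' y'.
  by move=> Su' Wy'; rewrite -a_hE; exact: e1.
have f3 u' y' : S u' -> W y' ->
    `|Fn u' y'| <= F0 * tn (divh_form P g D) (plate_norm P D) u' y'.
  by move=> Su' Wy'; rewrite -tnormE; exact: hF.
exact: (saddle_stable sS sW sV bil_stress bil_divh bil_plate bil_interface bil_constraint
  (fun u v _ _ => divh_formC P g D u v) (fun u _ => divh_form_ge0 P g D u) plate_norm0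
  (fun z => sqrtr_ge0 _) C20 C30 C30 (plate_coef_gt0 hP) saddle_bounded saddle_kernel
  saddle_infsup (fun y => plate_coercive hP hD (v := y)) Su Wy Vz F00 G00 lG f1 e2 f3 hG).
Qed.

Lemma load_lin fb : L2v E2 (beta P) fb -> lin_on W (dotv E2 (beta P) fb).
Proof.
move=> Lf a b u v Wu Wv; apply: dotv_linr => // i; try exact: W_h_sqi.
by apply: L2_sqi => //; exact: Lf.
Qed.

Lemma body_load_lin fa : L2v E3 (alpha P) fa -> lin_on V (fun z => - dotv E3 (alpha P) fa z).
Proof.
move=> Lf a b u v Vu Vv; rewrite !mulrN -opprD; congr (- _).
apply: dotv_linr => // i; try exact: Vh_sqi.
by apply: L2_sqi => //; exact: Lf.
Qed.

Lemma body_load_bound fa z : L2v E3 (alpha P) fa -> V z ->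
  `|- dotv E3 (alpha P) fa z| <= norm0v E3 (alpha P) fa * norm0v E3 (alpha P) z.
Proof.
move=> Lf Vz; rewrite normrN; apply: dotv_cauchy => // i; last exact: Vh_sqi.
by apply: L2_sqi => //; exact: Lf.
Qed.

Lemma load_ae0 fb y : eqW P y (fun=> 0) -> dotv E2 (beta P) fb y = 0.
Proof.
move=> y0; apply: rint0_ae; apply: ae_onS y0 => x _ ->.
by rewrite big1// => i _; rewrite mxE mulr0.
Qed.

Lemma tnorm_eq0 u y : XS P D u -> XW P D y -> tnorm P g D u y = 0 ->
  eqS P u (fun=> 0) /\ eqW P y (fun=> 0).
Proof. by have [_ _ h] := hA1; exact: h. Qed.

Lemma method_exists fa fb : L2v E3 (alpha P) fa -> L2v E2 (beta P) fb ->
  exists sg ua ub, discrete_solution P g D fa fb sg ua ub.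
Proof.
move=> La Lb.
have [] := @saddle_exists _ _ _ _ S W V sS sW sV stress_form (divh_form P g D) (plate_form P D)
  interface_form (b_h D) (plate_norm P D) (norm0v E3 (alpha P))
  bil_stress bil_divh bil_plate bil_interface bil_constraint plate_norm0
  (fun z => sqrtr_ge0 _) C2 C3 C3 (plate_coef P) C30 C30 (plate_coef_gt0 hP) saddle_bounded
  saddle_kernel saddle_infsup (fun y => plate_coercive hP hD (v := y))
  (fun _ y => dotv E2 (beta P) fb y) (fun z => - dotv E3 (alpha P) fa z).
- by move=> a b [u1 y1] [u2 y2] [_ /= h1] [_ /= h2]; exact: load_lin.
- exact: body_load_lin.
- move=> u y Su Wy; rewrite -tnormE => /(tnorm_eq0 (XS_discrete Su) (XW_discrete Wy))[_ h].
  exact: load_ae0.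
- move=> z Vz z0; have := body_load_bound La Vz.
  by rewrite z0 mulr0 normr_le0 => /eqP.
move=> u [y [z [Su Wy Vz e1 e2]]]; exists u, z, y; split=> // u' z' y' Su' Vz' Wy'.
by rewrite a_hE; split; [exact: e1|exact: e2].
Qed.

Lemma solution_eqs fa fb u z y : discrete_solution P g D fa fb u z y ->
  [/\ S u, W y, V z,
    forall u' y', S u' -> W y' -> a_h P g D u y u' y' + b_h D z u' = dotv E2 (beta P) fb y' &
    forall z', V z' -> b_h D z' u = - dotv E3 (alpha P) fa z'].
Proof.
move=> [[Su Vz Wy] h]; split=> //.
  by move=> u' y' Su' Wy'; have [] := h u' 0 y' Su' V0 Wy'.
by move=> z' Vz'; have [] := h 0 z' 0 S0 Vz' W0.
Qed.

Lemma span_sub (U : lmodType R) (A : set U) u v : fin_span A -> A u -> A v -> A (u - v).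
Proof. by move=> sA Au Av; have := fin_span_lin 1 (-1) sA Au Av; rewrite scale1r scaleN1r. Qed.

Lemma a_h_sub u y u1 y1 u' y' : S u -> W y -> S u1 -> W y1 -> S u' -> W y' ->
  a_h P g D (u - u1) (y - y1) u' y' = a_h P g D u y u' y' - a_h P g D u1 y1 u' y'.
Proof.
move=> Su Wy Su1 Wy1 Su' Wy'; rewrite !a_hE; apply: af_sub.
- exact: (lin_onB (bil_stress.1 _ Su') Su Su1).
- exact: (lin_onB (bil_plate.1 _ Wy') Wy Wy1).
- exact: (lin_onB (bil_interface.1 _ Wy') Su Su1).
- exact: (lin_onB (bil_interface.2 _ Su') Wy Wy1).
Qed.

(** The difference of two solutions has zero data, hence norm zero; the norm property
    turns this into equality almost everywhere. *)
Lemma method_unique fa fb u z y u1 z1 y1 :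
  discrete_solution P g D fa fb u z y -> discrete_solution P g D fa fb u1 z1 y1 ->
  [/\ eqS P u u1, eqV P z z1 & eqW P y y1].
Proof.
move=> /solution_eqs[Su Wy Vz e1 e2] /solution_eqs[Su1 Wy1 Vz1 f1 f2].
have Sd := span_sub sS Su Su1; have Wd := span_sub sW Wy Wy1; have Vd := span_sub sV Vz Vz1.
have h : tnorm P g D (u - u1) (y - y1) + norm0v E3 (alpha P) (z - z1) <= stab_const * (0 + 0).
  apply: (@method_stable _ _ _ (fun _ _ => 0) (fun=> 0)) => //.
  - by move=> a b x1 x2 _ _; rewrite !mulr0 addr0.
  - move=> u' y' Su' Wy'; rewrite a_h_sub// (lin_onB (bil_constraint.1 _ Su'))//.
    by rewrite addrACA -opprD e1// f1// subrr.
  - by move=> z' Vz'; rewrite (lin_onB (bil_constraint.2 _ Vz'))// e2// f2// subrr.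
  - by move=> u' y' _ _; rewrite normr0 mul0r.
  - by move=> z' _; rewrite normr0 mul0r.
rewrite addr0 mulr0 in h.
have n0 : 0 <= norm0v E3 (alpha P) (z - z1) by exact: sqrtr_ge0.
have t0 := tnorm_ge0 (u - u1) (y - y1).
have tz : tnorm P g D (u - u1) (y - y1) = 0 by apply/le_anti/andP; split=> //; lra.
have nz : norm0v E3 (alpha P) (z - z1) = 0 by apply/le_anti/andP; split=> //; lra.
have [zu zy] := tnorm_eq0 (XS_discrete Sd) (XW_discrete Wd) tz.
have zz := norm0v_ae0 ma (fun i => Vh_sqi i Vd) nz.
split.
- by apply: ae_onS zu => x _ /eqP; rewrite [(u - u1) x]/(u x - u1 x) subr_eq0 => /eqP.
- by apply: ae_onS zz => x _ /eqP; rewrite [(z - z1) x]/(z x - z1 x) subr_eq0 => /eqP.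
- by apply: ae_onS zy => x _ /eqP; rewrite [(y - y1) x]/(y x - y1 x) subr_eq0 => /eqP.
Qed.

Lemma method_bound (C M : R) fa fb u z y : 0 <= M -> beta P `<=` cubeR M ->
  (forall z, W2h D z -> Num.sqrt (rint E2 (beta P) (fun x => z x ^+ 2)) <= C * semi_2h D z) ->
  L2v E3 (alpha P) fa -> L2v E2 (beta P) fb ->
  discrete_solution P g D fa fb u z y ->
  tnorm P g D u y + norm0v E3 (alpha P) z <=
  stab_const * (1 + (4 * M + `|C|)) * (norm0v E3 (alpha P) fa + norm0v E2 (beta P) fb).
Proof.
move=> M0 bM hC La Lb /solution_eqs[Su Wy Vz e1 e2].
have a0 : 0 <= norm0v E3 (alpha P) fa by exact: sqrtr_ge0.
have b0 : 0 <= norm0v E2 (beta P) fb by exact: sqrtr_ge0.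
have k0 : 0 <= 4 * M + `|C| by rewrite addr_ge0// mulr_ge0.
apply: le_trans (_ : _ <= stab_const * ((4 * M + `|C|) * norm0v E2 (beta P) fb + norm0v E3 (alpha P) fa)) _.
  apply: (method_stable Su Wy Vz _ a0 (body_load_lin La) e1 e2).
  - by rewrite mulr_ge0.
  - move=> u' y' Su' Wy'; apply: le_trans (load_bound hP hD M0 bM hC Lb Wy') _.
    by rewrite ler_wpM2l ?mulr_ge0// plate_norm_le.
  - by move=> z' Vz'; exact: body_load_bound.
rewrite -mulrA ler_pM2l ?stab_const_gt0//.
move: a0 b0 k0; move: (norm0v _ _ fa) (norm0v _ _ fb) (4 * M + `|C|) => a b k; nra.
Qed.

(** On a fixed mesh, [semi_2h] dominates the L^2 norm: a deflection whose seminorm vanishes,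
    taken as a plate displacement without in-plane part, has norm zero and thus vanishes
    almost everywhere, and the space of deflections is finite-dimensional. *)
Lemma mesh_poincare : exists C : R, forall z, W2h D z ->
  Num.sqrt (rint E2 (beta P) (fun x => z x ^+ 2)) <= C * semi_2h D z.
Proof.
have sZ := W2h_span hD.
have [w hw] : exists w, W_b P w by exists (fun=> 0); exact: W_b0.
pose J (z : 'rV[R]_2 -> R) : V2 := plate (fun=> 0, z).
have WJ z : W2h D z -> W (J z).
  move=> hz; rewrite W_h_plate; exists (fun=> 0, z) => //; split=> //.
  exact: (fin_span0 (W1h_span hD)).
have Jo z : cmp (J z) out = z by apply/funext => x; rewrite /cmp plate_out.
have Jl (a b : R) (z z' : 'rV[R]_2 -> R^o) : J (a *: z + b *: z') = a *: J z + b *: J z'.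
  apply/funext => x; apply/rowP => i; rewrite [RHS]mxE !mxE.
  have [[k ->]|->] := plate_split i; last by rewrite unlift_none.
  rewrite (_ : inp k = lift out k); first by rewrite liftK !mxE !mulr0 addr0.
  by apply: val_inj; rewrite /= /bump leqNgt ltn_ord.
pose B (v v' : V2) := \sum_(K <- Tb D)
  rint E2 (elt K) (fun x => \sum_(p : 'I_2 * 'I_2)
    wderiv E2 (elt K) [:: p.1; p.2] (cmp v out) x *
    wderiv E2 (elt K) [:: p.1; p.2] (cmp v' out) x).
pose N (z z' : 'rV[R]_2 -> R^o) := B (J z) (J z').
have bN : bil_on W W B.
  suff : bil_at W w W B by case.
  rewrite /B.
  under eq_fun => u do under eq_fun => v do rewrite big_seq.
  apply: bil_at_sum => K KT.
  exact: (bil_at_rint (elt_mdom LL2 K) (index_enum _) sW sW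
    (fun p : 'I_2 * 'I_2 => obs_hessian hP hD hw p.1 p.2 KT)
    (fun p : 'I_2 * 'I_2 => obs_hessian hP hD hw p.1 p.2 KT)).
have NE z : W2h D z -> N z z = semi_2h D z ^+ 2.
  move=> hz; rewrite semi_2h_sqr /N /B big_seq [RHS]big_seq; apply: eq_bigr => K KT.
  have mK := elt_mdom LL2 K.
  rewrite semi2_2 Jo rint_sum//; last first.
    move=> [i j] _ /=; have [h _ _ _] := obs_hessian hP hD (W_b0 hP) i j KT.
    by have h' := h _ (WJ z hz); rewrite Jo in h'; exact: sqi_intgM.
  by rewrite pair_bigA.
have sz z : W2h D z -> sqi E2 (beta P) z.
  by move=> hz; have := W_h_sqi out (WJ z hz); rewrite Jo.
have bNz : bil_on (W2h D : set ('rV[R]_2 -> R^o)) (W2h D : set ('rV[R]_2 -> R^o)) N.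
  split=> v Wv a b u u' Wu Wu'; rewrite /N Jl.
    exact: (bN.1 _ (WJ _ Wv) a b _ _ (WJ _ Wu) (WJ _ Wu')).
  exact: (bN.2 _ (WJ _ Wv) a b _ _ (WJ _ Wu) (WJ _ Wu')).
have N0 z : W2h D z -> 0 <= N z z by move=> hz; rewrite NE// sqr_ge0.
have NC z z' : W2h D z -> W2h D z' -> N z z' = N z' z.
  move=> _ _; apply: eq_bigr => K _; apply: (congr1 (rint E2 (elt K))); apply/funext => x.
  by apply: eq_bigr => p _; rewrite mulrC.
have [] := span_kernel_bound sZ bNz N0 NC (fun z => nrm_ge0 (E := E2) (beta P) z)
  (fun a b z z' hz hz' => nrm_lin mb a b (sz z hz) (sz z' hz')); last first.
  move=> C C0 hC; exists C => z hz; have := hC z hz; rewrite NE// sqrtr_sqr ger0_norm ?sqrtr_ge0//.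
  move=> z hz; rewrite NE// => /eqP; rewrite sqrf_eq0 => /eqP z0.
  have t0 : tnorm P g D 0 (J z) = 0.
    rewrite tnorm_plate.
    have -> : norm_divh P g D 0 = 0.
      rewrite -[LHS]/(nU (divh_form P g D) 0).
      by rewrite /nU (lin_on0 sS (bil_divh.2 _ S0)) sqrtr0.
    have -> : plate_norm P D (J z) = 0.
      apply/eqP; rewrite -sqrf_eq0 plate_norm_sqr Jo z0 expr0n addr0 big1// => k _.
      have := plate_norm_sqr P D (J 0).
      have J00 : J 0 = 0.
        by have := Jl 0 0 0 0; rewrite !scale0r !addr0.
      rewrite J00 plate_norm0 expr0n => /esym/eqP.
      rewrite paddr_eq0 ?sqr_ge0//; last by apply: sumr_ge0 => *; exact: semi2_ge0.
      move=> /andP[h _]; move: h; rewrite psumr_eq0; last by move=> *; exact: semi2_ge0.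
      move=> /allP/(_ k (mem_index_enum _))/= /eqP h.
      rewrite -[RHS]h; congr semi2; apply/funext => x.
      by rewrite /cmp plate_inp [RHS]mxE mxE.
    by rewrite !expr0n addr0 sqrtr0.
  have [_ y0] := tnorm_eq0 (XS_discrete S0) (XW_discrete (WJ z hz)) t0.
  rewrite (@nrm_ae _ _ E2 (beta P) _ (fun=> 0)).
    by rewrite /nrm ip0l ?sqrtr0//; exact: ae_onT.
  apply: ae_onS y0 => x _ /(congr1 (fun v : 'rV[R]_3 => v 0 out)).
  by rewrite plate_out mxE.
Qed.

Section Error.
Variables (s : T3) (w : V2) (z : V3).
Hypotheses (hs : Sigma_t P s) (hw : W_b P w) (Lz : L2v E3 (alpha P) z).

Lemma a_h_error u y u' y' : S u -> W y -> S u' -> W y' ->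
  a_h P g D (s - u) (w - y) u' y' = a_h P g D s w u' y' - a_h P g D u y u' y'.
Proof.
move=> Su Wy Su' Wy'; rewrite !a_hE.
have [_ h1] := bil_compliance hP hD hs.
have [_ h2] := bil_plate_form hP hD hw.
have [_ h3] := bil_Gam hP hg hD hs hw.
have [_ h4] := bil_Gam_flip hP hg hD hs hw.
exact: (af_sub (h1 _ _ Su Su') (h2 _ _ Wy Wy') (h3 _ _ Su Wy') (h4 _ _ Wy Su')).
Qed.

Lemma mesh_dotv (f h : V3) : (forall i, sqi E3 (alpha P) (cmp f i)) ->
  (forall i, sqi E3 (alpha P) (cmp h i)) ->
  dotv E3 (alpha P) f h = \sum_(K <- Ta D) dotv E3 (elt K) f h.
Proof.
move=> sf sh; apply: (rint_mesh LL3 pa tA); apply: intg_sum => // i _.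
exact: (sqi_intgM ma (sf i) (sh i)).
Qed.

(** The elementwise divergence of the exact stress is its global one. *)
Lemma b_h_exact (fa : V3) z' : V z' ->
  dotv E3 (alpha P) (wdiv (alpha P) s) z' = - dotv E3 (alpha P) fa z' ->
  b_h D z' s = - dotv E3 (alpha P) fa z'.
Proof.
move=> Vz' <-; have [[[_ _ hd] _] _] := hs; have oa := domain_open pa.
rewrite mesh_dotv; first last.
- by move=> i; exact: Vh_sqi.
- by move=> i; exact: (wdiv_sqi oa).
rewrite /b_h big_seq [RHS]big_seq; apply: eq_bigr => K KT.
have := wdiv_sub_ae oa (open_interior _) (elt_sub pa tA KT) hd.
by move=> h; apply: rint_ae; apply: ae_onS h => x _ ->.
Qed.

(** Unlike the boundedness assumed of the method, this covers the exact multiplier. *)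
Lemma b_h_cauchy (f : V3) u : L2v E3 (alpha P) f -> S u ->
  `|b_h D f u| <= norm0v E3 (alpha P) f * norm_divh P g D u.
Proof.
move=> Lf Su; have sf i : sqi E3 (alpha P) (cmp f i) by apply: L2_sqi => //; exact: Lf.
rewrite mulrC; apply: le_trans (_ : _ <= Num.sqrt (\sum_(K <- Ta D)
    dotv E3 (elt K) (wdiv (elt K) u) (wdiv (elt K) u)) * norm0v E3 (alpha P) f) _; last first.
  rewrite ler_wpM2r ?sqrtr_ge0// /norm_divh ler_wsqrtr//.
  rewrite -addrA addrCA lerDl addr_ge0 ?dotm_ge0//.
  apply: sumr_ge0 => K _; apply: sumr_ge0 => i _.
  by rewrite mulr_ge0 ?diam_ge0 ?dotv_ge0.
apply: ler_norm_sqrtM; first by apply: sumr_ge0 => K _; exact: dotv_ge0.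
apply: discriminant_le => t; rewrite mesh_dotv// /b_h !mulr_sumr -!big_split /=.
rewrite big_seq; apply: sumr_ge0 => K KT; apply: dotv_quad_ge0; first exact: elt_mdom.
- by move=> i; have [h _ _ _] := obs_wdiv hP hD (Sigma_t0 hP) i KT; exact: h.
by move=> i; apply: (sqi_sub ma (elt_mdom LL3 K) (elt_sub pa tA KT)); exact: sf.
Qed.

(** The face terms of the norm see a null set of the body, so this is not a matter of
    integrals. Rather, [u] lies in the kernel of the constraint, where the norm is
    controlled by the compliance energy, which vanishes. *)
Lemma norm_divh_ae0 u : S u -> eqS P u (fun=> 0) -> norm_divh P g D u = 0.
Proof.
move=> Su u0.
have bu : B_nc D u.
  split=> // z' _; rewrite /b_h big_seq big1// => K KT; apply: rint0_ae.
  have oK : open (elt K) := open_interior _.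
  have uK := ae_on_sub (elt_sub pa tA KT) u0.
  have [_ d0] := wdiv_ae0 oK uK; apply: ae_onS d0 => x _ ->.
  by rewrite big1// => i _; rewrite mxE mul0r.
have [h3 _] := hA3; have := h3 u bu; rewrite [leRHS]rint0_ae; last first.
  apply: ae_onS u0 => x _ ux; rewrite big1// => i _; rewrite big1// => j _.
  by rewrite ux [X in _ * X]mxE mulr0.
rewrite pmulr_rle0// => h; apply/eqP; rewrite -sqrf_eq0; apply/eqP/le_anti.
by rewrite h sqr_ge0.
Qed.

(** The supremum leaves out the functions that vanish almost everywhere; on those every
    term of the consistency functional vanishes by the boundedness of the forms. *)
Lemma consistency_bound fb (c : R) u' y' : L2v E2 (beta P) fb -> 0 <= c ->
  (consistency_error P g D fb s z w <= c%:E)%E -> S u' -> W y' ->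
  `|a_h P g D s w u' y' + b_h D z u' - dotv E2 (beta P) fb y'| <= c * tnorm P g D u' y'.
Proof.
move=> Lb c0 hc Su' Wy'.
have [[u0 y0]|n0] := pselect (eqS P u' (fun=> 0) /\ eqW P y' (fun=> 0)).
  have nd := norm_divh_ae0 Su' u0.
  have tz : tnorm P g D u' y' = 0.
    by rewrite tnorm_plate nd (plate_norm_ae0 hP hD y0) !expr0n addr0 sqrtr0.
  have Xs : XS P D s by have := XS_error hs S0; rewrite subr0.
  have Xw : XW P D w by have := XW_error hw W0; rewrite subr0.
  have [h1 _] := hA2 Xs Xw Su' Wy' V0; rewrite tz mulr0 normr_le0 in h1.
  have h2 := b_h_cauchy Lz Su'; rewrite nd mulr0 normr_le0 in h2.
  by rewrite (eqP h1) (eqP h2) load_ae0// tz mulr0 subr0 addr0 normr0.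
have tp : 0 < tnorm P g D u' y'.
  rewrite lt0r tnorm_ge0 andbT; apply/eqP => tz; apply: n0.
  exact: (tnorm_eq0 (XS_discrete Su') (XW_discrete Wy') tz).
rewrite -ler_pdivrMr// -lee_fin; apply: le_trans hc.
by apply: ereal_sup_ubound; exists u', y'.
Qed.

Lemma tnorm_sub u y u1 y1 : S u -> W y -> S u1 -> W y1 ->
  tnorm P g D (s - u1) (w - y1) <= tnorm P g D (s - u) (w - y) + tnorm P g D (u1 - u) (y1 - y).
Proof.
move=> Su Wy Su1 Wy1; have [h1 h2 _] := hA1.
have Sd := span_sub sS Su1 Su; have Wd := span_sub sW Wy1 Wy.
have Sm : S (- (u1 - u)) by rewrite opprB; exact: (span_sub sS).
have Wm : W (- (y1 - y)) by rewrite opprB; exact: (span_sub sW).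
have := h1 _ _ _ _ (XS_error hs Su) (XW_error hw Wy) (XS_discrete Sm) (XW_discrete Wm).
rewrite (_ : (fun x => (s - u) x + _) = s - u1); last first.
  by apply/funext => x; rewrite /=; rewrite -[LHS]/((s - u + - (u1 - u)) x) opprB addrA subrK.
rewrite (_ : (fun x => (w - y) x + _) = w - y1); last first.
  by apply/funext => x; rewrite -[LHS]/((w - y + - (y1 - y)) x) opprB addrA subrK.
have := h2 (-1) _ _ (XS_discrete Sd) (XW_discrete Wd).
rewrite normrN normr1 mul1r => <-.
rewrite (_ : (fun x => -1 *: (u1 - u) x) = - (u1 - u)); last first.
  by apply/funext => x; rewrite scaleN1r.
rewrite (_ : (fun x => -1 *: (y1 - y) x) = - (y1 - y)) //.
by apply/funext => x; rewrite scaleN1r.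
Qed.

(** The discrete solution minus (u, y, v) solves the discrete problem with three data
    terms in the first equation: the error of (u, y) in [a_h], the consistency
    functional, and the error of v in [b_h]; and with the error of u in the second
    one. The constraint equation of the continuous problem identifies the latter; its other
    equations enter through the consistency functional. *)
Lemma quasi_optimal fa fb (c : R) u y v uh yh zh :
  L2v E2 (beta P) fb -> 0 <= c ->
  (forall z', V z' -> dotv E3 (alpha P) (wdiv (alpha P) s) z' = - dotv E3 (alpha P) fa z') ->
  (consistency_error P g D fb s z w <= c%:E)%E ->
  S u -> W y -> V v -> discrete_solution P g D fa fb uh zh yh ->
  tnorm P g D (s - uh) (w - yh) + norm0v E3 (alpha P) (z - zh) <=
  (1 + stab_const * (2 * C2 + 1)) *
    (tnorm P g D (s - u) (w - y) + norm0v E3 (alpha P) (z - v)) + stab_const * c.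
Proof.
move=> Lb c0 he hc Su Wy Vv /solution_eqs[Suh Wyh Vzh e1 e2].
set t1 := tnorm P g D (s - u) (w - y); set t2 := norm0v E3 (alpha P) (z - v).
have t10 : 0 <= t1 by exact: tnorm_ge0.
have t20 : 0 <= t2 by exact: sqrtr_ge0.
have Sd := span_sub sS Suh Su; have Wd := span_sub sW Wyh Wy; have Vd := span_sub sV Vzh Vv.
have [_ bz] := bil_b_h_flip hP hD hs Lz.
have Lzv : L2v E3 (alpha P) (z - v).
  move=> i; apply: (L2_eq (u := fun x => 1 * cmp z i x + (-1) * cmp v i x)).
    by move=> x _; rewrite /cmp [RHS]mxE !mxE; ring.
  exact: L2_lin (Lz i) (Vh_L2 hD Vv i).
have [bs1 bs2] := bil_b_h hP hD hs Lz.
have key : tnorm P g D (uh - u) (yh - y) + norm0v E3 (alpha P) (zh - v) <=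
    stab_const * ((C2 * t1 + c + t2) + C2 * t1).
  apply: (@method_stable _ _ _
    (fun u' y' => a_h P g D (s - u) (w - y) u' y'
       - (a_h P g D s w u' y' + b_h D z u' - dotv E2 (beta P) fb y') + b_h D (z - v) u')
    (fun z' => b_h D z' (uh - u))) => //.
  - by rewrite addr_ge0// addr_ge0// mulr_ge0// ltW.
  - by rewrite mulr_ge0// ltW.
  - by move=> a b x1 x2 V1 V2; exact: (bil_constraint.1 _ Sd).
  - move=> u' y' Su' Wy'; rewrite a_h_sub// a_h_error// (bz _ _ Vv Su').
    by rewrite (lin_onB (bil_constraint.1 _ Su'))// -(e1 _ _ Su' Wy'); ring.
  - move=> u' y' Su' Wy'; apply: le_trans (ler_normD _ _) _; rewrite mulrDl; apply: lerD.
      apply: le_trans (ler_normB _ _) _; rewrite mulrDl; apply: lerD.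
        by have [] := hA2 (XS_error hs Su) (XW_error hw Wy) Su' Wy' V0.
      exact: consistency_bound.
    apply: le_trans (b_h_cauchy Lzv Su') _.
    exact: (ler_wpM2l t20 (norm_divh_le u' y')).
  - move=> z' Vz'.
    have -> : b_h D z' (uh - u) = b_h D z' (s - u).
      rewrite (lin_onB (bil_constraint.2 _ Vz'))// e2//.
      by rewrite [RHS](bs2 _ _ Su Vz') (b_h_exact Vz' (he _ Vz')).
    by have [_] := hA2 (XS_error hs Su) (XW_error hw Wy) S0 W0 Vz'.
have k1 := tnorm_sub Su Wy Suh Wyh.
have k2 : norm0v E3 (alpha P) (z - zh) <= t2 + norm0v E3 (alpha P) (zh - v).
  have si i : sqi E3 (alpha P) (cmp (z - v) i) by apply: L2_sqi => //; exact: Lzv.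
  have := norm0v_sub ma si (fun i => Vh_sqi i Vd).
  rewrite (_ : (fun x => (z - v) x - _) = z - zh)//.
  by apply/funext => x; rewrite -[LHS]/((z - v - (zh - v)) x) opprB addrA subrK.
apply: le_trans (lerD k1 k2) _; rewrite -/t1.
have sc := stab_const_gt0.
move: key; move: (tnorm _ _ _ _ _) (norm0v _ _ _) => a b key.
rewrite addrACA; apply: le_trans (lerD (lexx _) key) _ => {k1 k2 key}.
move: sc C20 t10 t20 c0; move: stab_const C2 t1 t2 => K A p q K0 A0 p0 q0 c0.
rewrite -subr_ge0; set X := (X in 0 <= X).
have -> : X = K * p + 2 * (K * A) * q by rewrite /X; ring.
by rewrite addr_ge0// mulr_ge0 ?mulr_ge0// ltW.
Qed.

End Error.
End Method.
(** * Passage to a family of meshes *)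

Section Family.
Context {R : realType}.

Lemma mesh_size_ge0 d (T : seq 'M[R]_(d.+2, d.+1)) : 0 <= mesh_size T.
Proof.
rewrite /mesh_size; elim: T => [|K T IH]; first by rewrite big_nil.
by rewrite big_cons le_max IH orbT.
Qed.

Lemma rate_ge0 (D : @discretization R) k : 0 <= rate D k.
Proof. by rewrite /rate addr_ge0 ?exprn_ge0 ?mesh_size_ge0. Qed.

(** The infima over the two factors need not be attained; they are finite because their
    sum is. *)
Lemma ereal_inf_add_approx (A B : set \bar R) (c e : R) : 0 < e ->
  (forall x, A x -> (0 <= x)%E) -> (forall x, B x -> (0 <= x)%E) ->
  (ereal_inf A + ereal_inf B <= c%:E)%E ->
  exists x y, [/\ A x, B y & (x + y <= (c + e)%:E)%E].
Proof.
move=> e0 A0 B0 h.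
have a0 : (0 <= ereal_inf A)%E by apply: le_ereal_inf_tmp => x /A0.
have b0 : (0 <= ereal_inf B)%E by apply: le_ereal_inf_tmp => x /B0.
have fa : ereal_inf A \is a fin_num.
  rewrite ge0_fin_numE//; apply: le_lt_trans (ltry c); apply: le_trans h.
  by rewrite leeDl.
have fb : ereal_inf B \is a fin_num.
  rewrite ge0_fin_numE//; apply: le_lt_trans (ltry c); apply: le_trans h.
  by rewrite leeDr.
have e2 : 0 < e / 2 by rewrite divr_gt0.
have [x Ax hx] := lb_ereal_inf_adherent e2 fa.
have [y By hy] := lb_ereal_inf_adherent e2 fb.
exists x, y; split=> //; apply: le_trans (leeD (ltW hx) (ltW hy)) _.
rewrite addeACA -EFinD (_ : e / 2 + e / 2 = e); last by field.
by rewrite EFinD leeD2r.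
Qed.

Lemma beta_cube (P : problem R) : problem_ok P ->
  exists2 M : R, 0 <= M & beta P `<=` cubeR M.
Proof.
move=> [[_ pb _] _]; have [M HM] := domain_cube_bounded pb.
exists (Num.max M 0); first by rewrite le_max lexx orbT.
by apply: subset_trans HM _; apply: cubeR_le; rewrite le_max lexx.
Qed.

End Family.

Theorem theorem4p6 (R : realType) (P : problem R) (hP : problem_ok P)
  (ext : ('rV[R]_2 -> 'rV[R]_3) -> 'rV[R]_3 -> 'rV[R]_3)
  (hext : is_extension P ext)
  (g : 'M[R]_(4, 3) -> 'I_4 -> ('rV[R]_3 -> R) -> 'rV[R]_2 -> R)
  (hg : trace_operators P g)
  (I : Type) (D : I -> @discretization R)
  (hD : forall i, discretization_ok P (D i))
  (hTa : shape_regular (fun i => Ta (D i)))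
  (hTb : shape_regular (fun i => Tb (D i)))
  (hA1 : forall i, A1 P g (D i))
  (hA2 : exists2 C : R, 0 < C & forall i, A2 P g (D i) C)
  (hA3 : exists2 C : R, 0 < C & forall i, A3 P g (D i) C) :
  (forall i fa fb,
     L2v (E3 R) (alpha P) fa -> L2v (E2 R) (beta P) fb ->
     (exists sg ua ub, discrete_solution P g (D i) fa fb sg ua ub) /\
     (forall sg ua ub sg' ua' ub',
        discrete_solution P g (D i) fa fb sg ua ub ->
        discrete_solution P g (D i) fa fb sg' ua' ub' ->
        [/\ eqS P sg sg', eqV P ua ua' & eqW P ub ub'])) /\
  (* stability; constant for each mesh *)
  (forall i, exists2 C : R, 0 < C &
     forall fa fb, L2v (E3 R) (alpha P) fa -> L2v (E2 R) (beta P) fb ->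
     forall sg ua ub, discrete_solution P g (D i) fa fb sg ua ub ->
       tnorm P g (D i) sg ub + norm0v (E3 R) (alpha P) ua <=
       C * (norm0v (E3 R) (alpha P) fa + norm0v (E2 R) (beta P) fb)) /\
  (* stability; mesh-independent constant as soon as ||z||_0 <= C |z|_{2,h} on
     W_2h, which the norm property alone gives only mesh by mesh *)
  ((exists C : R, forall i z, W2h (D i) z ->
      Num.sqrt (rint (E2 R) (beta P) (fun x => z x ^+ 2)) <=
      C * semi_2h (D i) z) ->
   exists2 C : R, 0 < C &
     forall i fa fb, L2v (E3 R) (alpha P) fa -> L2v (E2 R) (beta P) fb ->
     forall sg ua ub, discrete_solution P g (D i) fa fb sg ua ub ->
       tnorm P g (D i) sg ub + norm0v (E3 R) (alpha P) ua <=
       C * (norm0v (E3 R) (alpha P) fa + norm0v (E2 R) (beta P) fb)) /\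
  (forall (k : nat) fa fb sg ua ub, (0 < k)%N ->
     L2v (E3 R) (alpha P) fa -> L2v (E2 R) (beta P) fb ->
     exact_solution P ext fa fb sg ua ub -> Sigma_t P sg ->
     (exists2 C : R, 0 < C & forall i,
        (approx_error P g (D i) sg ua ub <= (C * rate (D i) k)%:E)%E) ->
     (exists2 C : R, 0 < C & forall i,
        (consistency_error P g (D i) fb sg ua ub <=
         (C * rate (D i) k)%:E)%E) ->
     exists2 C : R, 0 < C & forall i sgh uah ubh,
       discrete_solution P g (D i) fa fb sgh uah ubh ->
       tnorm P g (D i) (fun x => sg x - sgh x) (fun x => ub x - ubh x)
       + norm0v (E3 R) (alpha P) (fun x => ua x - uah x) <=
       C * rate (D i) k).
Proof.
have [C2 C20 h2] := hA2; have [C3 C30 h3] := hA3.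
have [M M0 bM] := beta_cube hP.
split; last split; last split.
- move=> i fa fb La Lb; split.
    exact: (method_exists hP hg (hD i) C30 (hA1 i) (h2 i) (h3 i) La Lb).
  move=> sg ua ub sg' ua' ub'.
  exact: (method_unique hP hg (hD i) C20 C30 (hA1 i) (h2 i) (h3 i)).
- move=> i; have [C hC] := mesh_poincare hP hg (hD i) (hA1 i).
  exists (stab_const P C2 C3 * (1 + (4 * M + `|C|))).
    by rewrite mulr_gt0 ?stab_const_gt0// ltr_pwDl// addr_ge0// mulr_ge0.
  move=> fa fb La Lb sg ua ub.
  exact: (method_bound hP hg (hD i) C20 C30 (h2 i) (h3 i) M0 bM hC La Lb).
- move=> [C hC]; exists (stab_const P C2 C3 * (1 + (4 * M + `|C|))).
    by rewrite mulr_gt0 ?stab_const_gt0// ltr_pwDl// addr_ge0// mulr_ge0.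
  move=> i fa fb La Lb sg ua ub.
  exact: (method_bound hP hg (hD i) C20 C30 (h2 i) (h3 i) M0 bM (hC i) La Lb).
move=> k fa fb sg ua ub _ La Lb [[_ Lua Wub] [_ e2 _]] Ssg [C4 C40 h4] [C5 C50 h5].
have K0 := stab_const_gt0 hP C20 C30; set K := stab_const P C2 C3 in K0.
pose A := 1 + K * (2 * C2 + 1).
have A0 : 0 < A by rewrite addr_gt0// mulr_gt0// addr_gt0// mulr_gt0.
(* C4 weights the approximation error, C5 the consistency error *)
exists (A * C4 + K * C5); first by rewrite addr_gt0// mulr_gt0.
move=> i sgh uah ubh sol; have r0 := rate_ge0 (D i) k.
apply/ler_addgt0Pr => e e0.
have eA : 0 < e / A by rewrite divr_gt0.
have [||_ [_ [[tau [v [St Wv ->]]] [w [Vw ->]] hx]]] :=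
  ereal_inf_add_approx eA _ _ (h4 i).
- by move=> x [tau [v [_ _ ->]]]; rewrite lee_fin tnorm_ge0.
- by move=> x [w [_ ->]]; rewrite lee_fin sqrtr_ge0.
have c0 : 0 <= C5 * rate (D i) k by rewrite mulr_ge0// ltW.
have he z' : Vh (D i) z' -> dotv (E3 R) (alpha P) (wdiv (alpha P) sg) z' =
    - dotv (E3 R) (alpha P) fa z'.
  by move=> Vz; apply: e2; exact: (Vh_L2 (hD i) Vz).
have := quasi_optimal hP hg (hD i) C20 C30 (hA1 i) (h2 i) (h3 i) Ssg Wub Lua Lb c0 he (h5 i) St Wv Vw sol.
rewrite -/K -/A => h; apply: le_trans h _.
rewrite -EFinD lee_fin in hx.
apply: le_trans (lerD (ler_wpM2l (ltW A0) hx) (lexx _)) _.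
rewrite mulrDr (mulrC A (e / A)) divfK ?gt_eqF//.
by rewrite le_eqVlt; apply/orP; left; apply/eqP; ring.
Qed.
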